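(* Let $\Gamma$ be an uncountable set and let $\kappa=|\Gamma|$. (i) Let $Y$ be a weakly compactly generated (WCG) Banach space, suppose that $\kappa>\omega_1$, and put $X_1=\ell_1(\mathbb N,Y)$. Assume that either (U) $X_1$ is uniformly primary; or (CF) $X_1$ is primary and $\operatorname{cf}(\kappa)>\omega$. Then $\ell_1(\Gamma,Y)$ is primary, and it is uniformly primary in case (U). (ii) Let $Y$ be a separable Banach space. For $1<p<\infty$ put $X_p=\ell_p(\mathbb N,Y)$, and put $X_0=c_0(\mathbb N,Y)$. If the corresponding countable model $X_p$ (respectively $X_0$) is uniformly primary, then $\ell_p(\Gamma,Y)$ (respectively $c_0(\Gamma,Y)$) is uniformly primary. If the corresponding countable model $X_p$ (respectively $X_0$) is primary and $\operatorname{cf}(\kappa)>\omega$, then $\ell_p(\Gamma,Y)$ (respectively $c_0(\Gamma,Y)$) is primary.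
   Context: Banach spaces are over $\mathbb K\in\{\mathbb R,\mathbb C\}$. For Banach spaces $E,F$ and $C\ge 1$, write $E\simeq_C F$ if there is an isomorphism $T\colon E\to F$ with $\|T\|\,\|T^{-1}\|\le C$; $E\simeq F$ means isomorphic (linearly homeomorphic). A Banach space $E$ is primary if for every bounded projection $P\colon E\to E$ one has $PE\simeq E$ or $(\mathrm{Id}_E-P)E\simeq E$. Given an increasing function $C\colon[1,\infty)\to[1,\infty)$, $E$ is $C$-primary if for every bounded projection $P\colon E\to E$ one has $PE\simeq_{C(\|P\|)}E$ or $(\mathrm{Id}_E-P)E\simeq_{C(\|P\|)}E$ (for $P=0$ this is trivial, as $(\mathrm{Id}_E-P)E=E$). $E$ is uniformly primary if it is $C$-primary for some such function $C$. For a set $\Lambda$ and $1\le p<\infty$, $\ell_p(\Lambda,Y)$ is the space of families $(y_\gamma)_{\gamma\in\Lambda}$ in $Y$ with $(\|y_\gamma\|)_\gamma\in\ell_p(\Lambda)$, with the corresponding norm; $c_0(\Lambda,Y)$ is defined in the same way with $c_0(\Lambda)$. $\operatorname{cf}$ denotes cofinality. A Banach space is WCG if it is the closed linear span of a weakly compact subset. *)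

(* Defs.v *)
From HB Require Import structures.
From mathcomp Require Import all_boot all_order all_algebra finmap.
From mathcomp Require Import all_classical all_reals all_analysis.
From mathcomp Require wochoice.
From mathcomp Require Import complex ring.
Set Implicit Arguments.
Unset Strict Implicit.
Unset Printing Implicit Defensive.
Import Order.TTheory GRing.Theory Num.Theory.
Import numFieldNormedType.Exports.
Local Open Scope classical_set_scope.
Local Open Scope ring_scope.

Variant scalar_kind := RealScalars | ComplexScalars.

Definition scalar_field (R : realType) (k : scalar_kind) : numFieldType :=
  match k with RealScalars => R | ComplexScalars => R[i]%C end.

Section Scalar.
Variables (R : realType) (k : scalar_kind).
Local Notation K := (scalar_field R k).

Definition scalar_re : K -> R :=
  match k with RealScalars => id | ComplexScalars => @complex.Re R end.

Definition of_real : R -> K :=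
  match k with RealScalars => id | ComplexScalars => real_complex R end.

Lemma of_realK : cancel of_real scalar_re.
Proof. by rewrite /of_real /scalar_re; case: k. Qed.

Lemma scalar_reK (a : K) : 0 <= a -> of_real (scalar_re a) = a.
Proof.
rewrite /scalar_field in a *; rewrite /of_real /scalar_re; case: k a => //= a a0.
by apply: RRe_real; exact: ger0_real.
Qed.

Lemma of_real_le r s : (of_real r <= of_real s) = (r <= s).
Proof. by rewrite /of_real /scalar_field; case: k => //=; rewrite lecR. Qed.

Lemma of_real_lt r s : (of_real r < of_real s) = (r < s).
Proof. by rewrite /of_real /scalar_field; case: k => //=; rewrite ltcR. Qed.

Lemma of_realD r s : of_real (r + s) = of_real r + of_real s.
Proof. by rewrite /of_real /scalar_field; case: k => //=; rewrite rmorphD. Qed.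

Lemma of_realM r s : of_real (r * s) = of_real r * of_real s.
Proof. by rewrite /of_real /scalar_field; case: k => //=; rewrite rmorphM. Qed.

Lemma of_real0 : of_real 0 = 0.
Proof. by rewrite /of_real /scalar_field; case: k. Qed.

Lemma of_real_gt0 r : (0 < of_real r) = (0 < r).
Proof. by rewrite -{1}of_real0 of_real_lt. Qed.

Definition rabs (a : K) : R := scalar_re `|a|.

Lemma rabsE a : of_real (rabs a) = `|a|.
Proof. exact: scalar_reK. Qed.

Lemma of_real_inj : injective of_real.
Proof. exact: can_inj of_realK. Qed.

Lemma rabs_ge0 a : 0 <= rabs a.
Proof. by rewrite -of_real_le rabsE of_real0. Qed.

Lemma rabsM a b : rabs (a * b) = rabs a * rabs b.
Proof. by apply: of_real_inj; rewrite of_realM !rabsE normrM. Qed.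

Lemma rabs1 : rabs 1 = 1.
Proof.
apply: of_real_inj; rewrite rabsE normr1.
by rewrite /of_real /scalar_field; case: k.
Qed.

(* The norm of a normedModType over K takes values in K; rnorm and rabs are the
   same norms as elements of R. *)
Definition rnorm (E : normedModType K) (x : E) : R := scalar_re `|x|.

Section rnorm_theory.
Variable E : normedModType K.
Implicit Types x y : E.

Lemma rnormE x : of_real (rnorm x) = `|x|.
Proof. exact: scalar_reK. Qed.

Lemma rnorm_ge0 x : 0 <= rnorm x.
Proof. by rewrite -of_real_le rnormE of_real0. Qed.

Lemma rnormD x y : rnorm (x + y) <= rnorm x + rnorm y.
Proof. by rewrite -of_real_le of_realD !rnormE ler_normD. Qed.

Lemma rnormZ a x : rnorm (a *: x) = rabs a * rnorm x.
Proof. by apply: of_real_inj; rewrite of_realM !rnormE rabsE normrZ. Qed.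

Lemma rnorm0 : rnorm (0 : E) = 0.
Proof. by apply: of_real_inj; rewrite rnormE normr0 of_real0. Qed.

Lemma rnorm_eq0 x : rnorm x = 0 -> x = 0.
Proof. by move=> x0; apply: normr0_eq0; rewrite -rnormE x0 of_real0. Qed.

Lemma rnormN x : rnorm (- x) = rnorm x.
Proof. by apply: of_real_inj; rewrite !rnormE normrN. Qed.

End rnorm_theory.

Lemma cvg_rnorm (E : normedModType K) (T : Type) (F : set_system T)
    (f : T -> E) (l : E) : Filter F ->
  f @ F --> l <-> forall e : R, 0 < e -> \forall x \near F, rnorm (l - f x) < e.
Proof.
move=> FF; split=> [fl e e0|fl].
  move/cvgrPdist_lt : fl => /(_ (of_real e)); rewrite of_real_gt0 => /(_ e0).
  by apply: filterS => x; rewrite -rnormE of_real_lt.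
apply/cvgrPdist_lt => e e0.
have := fl (scalar_re e); rewrite -of_real_gt0 scalar_reK ?ltW// => /(_ e0).
by apply: filterS => x; rewrite -of_real_lt rnormE scalar_reK// ltW.
Qed.

Lemma ball_rnorm (E : normedModType K) (x y : E) (e : R) :
  ball x (of_real e) y <-> rnorm (x - y) < e.
Proof. by rewrite -ball_normE /ball_/= -rnormE of_real_lt. Qed.

Lemma cauchy_rnorm (E : normedModType K) (F : set_system E) : ProperFilter F ->
  cauchy F -> forall e : R, 0 < e ->
    exists x : E, \forall y \near F, rnorm (x - y) < e.
Proof.
move=> FF /cauchyP cF e e0; have [|x Fx] := cF (of_real e).
  by rewrite of_real_gt0.
by exists x; apply: filterS Fx => y /ball_rnorm.
Qed.

Lemma cauchy_of_rnorm (E : normedModType K) (F : set_system E) : ProperFilter F ->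
  (forall e : R, 0 < e -> exists x : E, \forall y \near F, rnorm (x - y) < e) ->
  cauchy F.
Proof.
move=> FF cF; apply/cauchyP => e e0.
have e0' := e0; rewrite -(scalar_reK (ltW e0)) of_real_gt0 in e0'.
have [x Fx] := cF _ e0'; exists x; rewrite -(scalar_reK (ltW e0)).
by apply: filterS Fx => y /ball_rnorm.
Qed.

End Scalar.

Section FamilyCompleteness.
Variables (R : realType) (k : scalar_kind).
Local Notation K := (scalar_field R k).
Variables (L : Type) (Y : completeNormedModType K).
Variables (T : normedModType K) (c : T -> L -> Y).
Variable (le : R -> (L -> Y) -> Prop).
Hypothesis cB : forall x z i, c (x - z) i = c x i - c z i.
Hypothesis le_norm : forall x s, 0 < s -> rnorm x <= s <-> le s (c x).
Hypothesis le_coord : forall s y i, 0 < s -> le s y -> rnorm (y i) <= s.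
Hypothesis le_lim : forall (F : set_system T) (g : T -> L -> Y) y s,
  ProperFilter F -> 0 < s -> (forall i, g x i @[x --> F] --> y i) ->
  (\forall x \near F, le s (g x)) -> le s y.
Hypothesis le_closed : forall y,
  (forall e : R, 0 < e -> exists x : T, le e (fun i => c x i - y i)) ->
  exists z, c z = y.

Lemma family_cauchy_cvg (F : set_system T) : ProperFilter F -> cauchy F -> cvg F.
Proof.
move=> FF /cauchy_rnorm cF.
have coordF i : cvg (c x i @[x --> F]).
  apply: cauchy_cvg; apply: cauchy_of_rnorm => e e0.
  have e20 : 0 < e / 2 by rewrite divr_gt0.
  have [x Fx] := cF _ e20; exists (c x i).
  apply: filterS Fx => z /ltW /(le_norm _ e20) /(le_coord i e20).
  rewrite cB => /le_lt_trans; apply.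
  by rewrite ltr_pdivrMr// ltr_pMr// ltr1n.
pose y i := lim (c x i @[x --> F]).
have cy i : c x i @[x --> F] --> y i by exact: coordF.
have approx e : 0 < e -> exists x : T,
    (\forall z \near F, rnorm (x - z) < e) /\ le e (fun i => c x i - y i).
  move=> e0; have [x Fx] := cF _ e0; exists x; split => //.
  apply: (@le_lim F (fun z i => c x i - c z i)) => // [i|].
    by apply: cvgB => //; exact: cvg_cst.
  apply: filterS Fx => z /ltW /(le_norm _ e0).
  by rewrite (_ : c (x - z) = (fun i => c x i - c z i))//; apply/funext.
have [|z cz] := @le_closed y.
  by move=> e /approx [x [_ xy]]; exists x.
apply/cvg_ex; exists z; apply/cvg_rnorm => e e0.
have e20 : 0 < e / 2 by rewrite divr_gt0.
have [x [Fx xy]] := approx _ e20.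
have xz : rnorm (x - z) <= e / 2.
  apply/le_norm => //; rewrite (_ : c (x - z) = (fun i => c x i - y i))//.
  by apply/funext => i; rewrite cB cz.
apply: filterS Fx => t xt.
rewrite (_ : z - t = - (x - z) + (x - t)); last by rewrite opprB addrA subrK.
rewrite (le_lt_trans (rnormD _ _))// rnormN (splitr e).
by rewrite ler_ltD.
Qed.

End FamilyCompleteness.

Section RangeSpace.
Variables (R : realType) (k : scalar_kind).
Local Notation K := (scalar_field R k).
Variables (E F : normedModType K) (T : {linear E -> F}).

Definition range_pred : {pred F} := [pred y | y \in range T].

Lemma range_pred_submod : submod_closed range_pred.
Proof.
split=> [|a x y]; rewrite !inE /=; first by exists 0; rewrite ?linear0.
move=> -[u _ <-] [v _ <-]; exists (a *: u + v) => //.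
by rewrite linearP.
Qed.

HB.instance Definition _ :=
  GRing.isSubmodClosed.Build K F range_pred range_pred_submod.

(* The image of T as a subspace of F; for a projection P of E the subspaces PE and
   (Id - P)E are range_space P and range_space (idfun \- P). *)
Record range_space := RangeSpace {
  range_val :> F; range_valP : range_val \in range_pred }.

HB.instance Definition _ := [isSub for range_val].
HB.instance Definition _ := [Choice of range_space by <:].
HB.instance Definition _ := [SubChoice_isSubLmodule of range_space by <:].

Let normrange (x : range_space) : K := `|range_val x|.

Let normrangeD x y : normrange (x + y) <= normrange x + normrange y.
Proof. exact: ler_normD. Qed.

Let normrangeZ a x : normrange (a *: x) = `|a| * normrange x.
Proof. exact: normrZ. Qed.

Let normrange_eq0 x : normrange x = 0 -> x = 0.
Proof. by move/normr0_eq0 => x0; exact: val_inj. Qed.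

HB.instance Definition _ := @Lmodule_isNormed.Build K range_space normrange
  normrangeD normrangeZ normrange_eq0.

End RangeSpace.


Section LpFamilies.
Variables (R : realType) (k : scalar_kind).
Local Notation K := (scalar_field R k).
Variables (p : R) (p1 : 1 <= p) (L : choiceType) (Y : completeNormedModType K).
Implicit Types y z : L -> Y.

Definition lp_esum y : \bar R := \esum_(i in [set: L]) ((rnorm (y i)) `^ p)%:E.

Definition lp_pred : {pred (L -> Y)} := [pred y | (lp_esum y < +oo)%E].

Definition lp_norm y : R := (fine (lp_esum y)) `^ p^-1.

Let p0 : 0 < p. Proof. exact: lt_le_trans p1. Qed.
Let p_ge0 : 0 <= p. Proof. exact: ltW. Qed.
Let pN0 : p != 0. Proof. by rewrite gt_eqF. Qed.

Let powR_le (s t : R) : 0 <= s -> 0 <= t -> (s `^ p <= t `^ p) = (s <= t).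
Proof.
move=> s0 t0; apply/idP/idP => [|st].
  by apply: contraTT; rewrite -!ltNge => ts; apply: gt0_ltr_powR.
by apply: ge0_ler_powR.
Qed.

Let powRK (s : R) : 0 <= s -> (s `^ p^-1) `^ p = s.
Proof. by move=> s0; rewrite -powRrM mulVf// powRr1. Qed.

Let powRV (s : R) : 0 <= s -> (s `^ p) `^ p^-1 = s.
Proof. by move=> s0; rewrite -powRrM mulfV// powRr1. Qed.

Definition lp_le (s : R) y :=
  forall F : {fset L}, \sum_(i <- F) (rnorm (y i)) `^ p <= s `^ p.

Lemma lp_esum_ge0 y : (0 <= lp_esum y)%E.
Proof. by apply: esum_ge0 => i _; rewrite lee_fin powR_ge0. Qed.

Lemma lp_esum_le y c : (lp_esum y <= c%:E)%E <->
  forall F : {fset L}, \sum_(i <- F) (rnorm (y i)) `^ p <= c.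
Proof.
split=> [yc F|yc].
  rewrite -lee_fin -sumEFin (le_trans _ yc)//; apply: esum_ge.
  exists [set` F]; first by split.
  by rewrite fsbig_finite//= set_fsetK.
apply: ge_ereal_sup => _ [A [finA _] <-].
by rewrite fsbig_finite//= sumEFin lee_fin.
Qed.

Lemma lp_normP s y : 0 <= s ->
  lp_le s y <-> y \in lp_pred /\ lp_norm y <= s.
Proof.
move=> s0; rewrite /lp_le; split=> [/lp_esum_le ys|].
  have yoo : (lp_esum y < +oo)%E by rewrite (le_lt_trans ys)// ltry.
  split => //; rewrite -powR_le ?powR_ge0// powRK.
    by rewrite -lee_fin fineK// ge0_fin_numE// lp_esum_ge0.
  by rewrite fine_ge0// lp_esum_ge0.
move=> [yoo]; rewrite -powR_le ?powR_ge0// powRK; last first.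
  by rewrite fine_ge0// lp_esum_ge0.
rewrite -lee_fin fineK; first by move/lp_esum_le.
by rewrite ge0_fin_numE// lp_esum_ge0.
Qed.

Let lpF (F : {fset L}) (s : R) (a : L -> R) := \sum_(i <- F) (a i) `^ p <= s `^ p.

(* Minkowski inequality, by convexity of the power function *)
Let lpFD F s t a b : (forall i, 0 <= a i) -> (forall i, 0 <= b i) ->
  0 < s -> 0 < t -> lpF F s a -> lpF F t b -> lpF F (s + t) (fun i => a i + b i).
Proof.
move=> a0 b0 s0 t0 Fa Fb; rewrite /lpF.
have st0 : 0 < s + t by rewrite addr_gt0.
set w := s / (s + t).
have w0 : 0 <= w by rewrite divr_ge0 ?(ltW s0) ?(ltW st0).
have w1 : w <= 1 by rewrite ler_pdivrMr// mul1r lerDl ltW.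
have conv i : (a i + b i) `^ p <=
    (s + t) `^ p * (w * (a i / s) `^ p + (1 - w) * (b i / t) `^ p).
  have u0 : 0 <= a i / s by rewrite divr_ge0 ?(ltW s0).
  have v0 : 0 <= b i / t by rewrite divr_ge0 ?(ltW t0).
  have abE : a i + b i = (s + t) * (w * (a i / s) + (1 - w) * (b i / t)).
    by rewrite /w; field; rewrite (gt_eqF s0) (gt_eqF t0) (gt_eqF st0).
  rewrite abE powRM ?(ltW st0)//; last first.
    by apply: addr_ge0; apply: mulr_ge0; rewrite // subr_ge0.
  rewrite ler_pM2l ?powR_gt0//.
  have := @convex_powR _ p p1 (Itv01 w0 w1) (a i / s) (b i / t).
  by rewrite !inE /= !in_itv/= !andbT => /(_ u0 v0); rewrite !convRE.
have scale c (u : R) : (forall i, 0 <= c i) -> 0 < u -> lpF F u c ->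
    \sum_(i <- F) (c i / u) `^ p <= 1.
  move=> c0 u0 Fc; rewrite -(ler_pM2l (powR_gt0 p u0)) mulr1 mulr_sumr.
  apply: le_trans Fc; apply: ler_sum => i _.
  rewrite -powRM ?(ltW u0) ?divr_ge0 ?(ltW u0)//.
  by rewrite mulrC divfK ?gt_eqF.
apply: (le_trans (ler_sum _ (fun i _ => conv i))).
rewrite -mulr_sumr big_split/= -!mulr_sumr ler_piMr ?powR_ge0//.
rewrite [leRHS](_ : 1 = w * 1 + (1 - w) * 1); last by rewrite !mulr1 addrC subrK.
by rewrite lerD// ler_wpM2l ?subr_ge0// scale.
Qed.

Let lpF_mono F s a b : (forall i, 0 <= a i) -> (forall i, a i <= b i) ->
  lpF F s b -> lpF F s a.
Proof.
move=> a0 ab; apply: le_trans; apply: ler_sum => i _.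
by apply: ge0_ler_powR; rewrite ?nnegrE// (le_trans (a0 i)).
Qed.

Let lpF_small F (e : R) : 0 < e -> exists2 d : R, 0 < d &
  forall a, (forall i, 0 <= a i) -> (forall i, i \in F -> a i <= d) -> lpF F e a.
Proof.
move=> e0; pose n : R := (size F).+1%:R.
have n0 : 0 < n by rewrite ltr0n.
exists (e / n); first by rewrite divr_gt0.
move=> a a0 ad; rewrite /lpF big_seq.
apply: (@le_trans _ _ (\sum_(i <- F | i \in F) (e / n) `^ p)).
  apply: ler_sum => i iF; apply: ge0_ler_powR; rewrite ?nnegrE//.
    by rewrite divr_ge0 ?ltW.
  exact: ad.
rewrite -big_seq big_const_seq count_predT iter_addr_0 -mulr_natl.
apply: (@le_trans _ _ (n * (e / n) `^ p)).
  by rewrite ler_wpM2r ?powR_ge0// ler_nat.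
rewrite -{2}(divfK (lt0r_neq0 n0) e) [_ * n]mulrC.
by apply: le1r_powRZ; rewrite ?ler1n// divr_ge0// ltW.
Qed.

Lemma lp_leD s t y z : 0 < s -> 0 < t -> lp_le s y -> lp_le t z ->
  lp_le (s + t) (fun i => y i + z i).
Proof.
move=> s0 t0 ys zt F; apply: (@lpF_mono F _ _ (fun i => rnorm (y i) + rnorm (z i))).
- by move=> i; exact: rnorm_ge0.
- by move=> i; exact: rnormD.
- apply: lpFD => //; [by move=> i; exact: rnorm_ge0..|exact: ys|exact: zt].
Qed.

Lemma lp_le_mono s t y : 0 <= s -> s <= t -> lp_le s y -> lp_le t y.
Proof.
move=> s0 st ys F; apply: (le_trans (ys F)).
by rewrite powR_le// (le_trans s0).
Qed.

Lemma lp_leZ s y (a : K) : 0 <= s -> lp_le s y ->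
  lp_le (rabs a * s) (fun i => a *: y i).
Proof.
move=> s0 ys F; rewrite powRM ?rabs_ge0//.
rewrite (le_trans _ (ler_wpM2l (powR_ge0 _ _) (ys F)))// mulr_sumr.
by apply: ler_sum => i _; rewrite rnormZ powRM ?rabs_ge0 ?rnorm_ge0.
Qed.

Lemma lp_le_coord s y i : 0 <= s -> lp_le s y -> rnorm (y i) <= s.
Proof.
move=> s0 /(_ [fset i]%fset); rewrite big_seq_fset1 powR_le//.
exact: rnorm_ge0.
Qed.

Lemma lp_le_lim (T : Type) (F : set_system T) (g : T -> L -> Y) y s :
  ProperFilter F -> 0 < s -> (forall i, g x i @[x --> F] --> y i) ->
  (\forall x \near F, lp_le s (g x)) -> lp_le s y.
Proof.
move=> FF s0 gy gs A.
have key (e : R) : 0 < e -> lpF A (s + e) (fun i => rnorm (y i)).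
  move=> e0; have [d d0 dA] := lpF_small A e0.
  have near_d : \forall x \near F, forall i, i \in A -> rnorm (y i - g x i) <= d.
    apply: (@filterS _ _ _ (\bigcap_(i in [set` A]) [set x | rnorm (y i - g x i) < d])).
      by move=> x xA i iA; apply/ltW; exact: xA.
    apply: filter_bigI => i _.
    by move/cvg_rnorm : (gy i); exact.
  have [x [xs xd]] := filter_ex (filterI gs near_d).
  apply: (@lpF_mono _ _ _ (fun i => rnorm (g x i) + rnorm (y i - g x i))).
  - by move=> i; exact: rnorm_ge0.
  - by move=> i; rewrite -[in leLHS](subrKC (g x i) (y i)) rnormD.
  - apply: lpFD => //; [by move=> i; exact: rnorm_ge0..|exact: xs|].
    by apply: dA => // i; exact: rnorm_ge0.
have sum_ge0 : 0 <= \sum_(i <- A) rnorm (y i) `^ p.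
  by apply: sumr_ge0 => i _; exact: powR_ge0.
rewrite -(powRK sum_ge0) powR_le ?powR_ge0 ?(ltW s0)//.
apply/ler_addgt0Pr => e e0; rewrite -powR_le ?powR_ge0//; last first.
  by rewrite addr_ge0 ?(ltW s0) ?(ltW e0).
by rewrite powRK//; exact: key.
Qed.

Lemma lp_pred_le y : y \in lp_pred <-> exists2 s, 0 < s & lp_le s y.
Proof.
split=> [ylp|[s s0 /(lp_normP _ (ltW s0))[]//]].
exists (lp_norm y + 1); first by rewrite ltr_wpDl ?powR_ge0.
by apply/lp_normP; rewrite ?addr_ge0 ?powR_ge0// lerDl.
Qed.

Lemma lp_norm_le y : y \in lp_pred -> lp_le (lp_norm y) y.
Proof. by move=> ylp; apply/lp_normP => //; exact: powR_ge0. Qed.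

Lemma lp_normD y z : y \in lp_pred -> z \in lp_pred ->
  lp_norm (y + z) <= lp_norm y + lp_norm z.
Proof.
move=> ylp zlp; apply/ler_addgt0Pr => e e0.
have e20 : 0 < e / 2 by rewrite divr_gt0.
have pos u : 0 < lp_norm u + e / 2 by rewrite ltr_wpDl ?powR_ge0.
have le u (ulp : u \in lp_pred) : lp_le (lp_norm u + e / 2) u.
  apply: (lp_le_mono (powR_ge0 _ _) _ (lp_norm_le ulp)).
  by rewrite lerDl; exact: ltW.
rewrite (splitr e) addrACA.
by apply: (proj2 (iffLR (lp_normP (y + z) (ltW (addr_gt0 (pos y) (pos z)))) _));
  exact: lp_leD (pos y) (pos z) (le y ylp) (le z zlp).
Qed.

Lemma lp_normZ (a : K) y : y \in lp_pred ->
  lp_norm (a *: y) = rabs a * lp_norm y.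
Proof.
have ub b z : z \in lp_pred ->
    b *: z \in lp_pred /\ lp_norm (b *: z) <= rabs b * lp_norm z.
  move=> zlp; apply/lp_normP; first by rewrite mulr_ge0 ?rabs_ge0 ?powR_ge0.
  by apply: lp_leZ; [exact: powR_ge0|exact: lp_norm_le].
move=> ylp; have [aylp ay] := ub a _ ylp; apply/eqP; rewrite eq_le ay/=.
have [->|a0] := eqVneq a 0.
  rewrite (_ : rabs 0 = 0) ?mul0r ?powR_ge0//.
  by apply: (@of_real_inj R k); rewrite rabsE normr0 of_real0.
have [_] := ub a^-1 _ aylp; rewrite scalerA mulVf// scale1r.
move=> /(ler_wpM2l (rabs_ge0 a)) /le_trans; apply.
by rewrite mulrA -rabsM divff// rabs1 mul1r.
Qed.

Lemma lp_norm_eq0 y : y \in lp_pred -> lp_norm y = 0 -> y = 0.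
Proof.
move=> ylp y0; apply/funext => i; apply: rnorm_eq0; apply/eqP.
rewrite eq_le rnorm_ge0 andbT; apply: (@lp_le_coord _ y) => //.
by rewrite -y0; exact: lp_norm_le.
Qed.

Lemma lp_pred_submod : submod_closed lp_pred.
Proof.
split=> [|a y z]; rewrite ?inE.
  apply/lp_pred_le; exists 1 => // F; rewrite powR1 big1// => i _.
  by rewrite rnorm0 powR0.
move=> /lp_pred_le[s s0 ys] /lp_pred_le[t t0 zt]; apply/lp_pred_le.
exists (rabs a * s + t + 1).
  by rewrite ltr_wpDl// addr_ge0 ?mulr_ge0 ?rabs_ge0 ?(ltW s0) ?(ltW t0).
rewrite addrAC; apply: lp_leD => //.
  by rewrite ltr_wpDl// mulr_ge0 ?rabs_ge0 ?(ltW s0).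
have ab := lp_leZ a (ltW s0) ys.
move=> F; apply: (le_trans (ab F)).
by rewrite powR_le ?lerDl ?addr_ge0 ?mulr_ge0 ?rabs_ge0 ?(ltW s0).
Qed.

End LpFamilies.

(* The proof of 1 <= p is a parameter of the type because lp_norm is a norm only
   in that range. *)
Record lp (R : realType) (k : scalar_kind) (p : R) (p1 : 1 <= p)
    (L : choiceType) (Y : completeNormedModType (scalar_field R k)) : Type :=
  Lp { lp_val :> L -> Y; lp_valP : lp_val \in lp_pred p (L:=L) (Y:=Y) }.

Section LpSpace.
Variables (R : realType) (k : scalar_kind).
Local Notation K := (scalar_field R k).
Variables (p : R) (p1 : 1 <= p) (L : choiceType) (Y : completeNormedModType K).
Local Notation lp := (lp p1 L Y).
Local Notation lp_pred := (lp_pred p (L:=L) (Y:=Y)).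

HB.instance Definition _ :=
  GRing.isSubmodClosed.Build K (L -> Y) lp_pred (@lp_pred_submod R k p p1 L Y).
HB.instance Definition _ := [isSub for @lp_val R k p p1 L Y].
HB.instance Definition _ := [Choice of lp by <:].
HB.instance Definition _ := [SubChoice_isSubLmodule of lp by <:].

Let normlp (x : lp) : K := of_real k (lp_norm p x).

Let normlpD x y : normlp (x + y) <= normlp x + normlp y.
Proof. by rewrite /normlp -of_realD of_real_le; exact: (lp_normD p1 (lp_valP x) (lp_valP y)). Qed.

Let normlpZ a x : normlp (a *: x) = `|a| * normlp x.
Proof. by rewrite /normlp -rabsE -of_realM -(lp_normZ p1 a (lp_valP x)). Qed.

Let normlp_eq0 x : normlp x = 0 -> x = 0.
Proof.
rewrite /normlp -(of_real0 R k) => /of_real_inj x0; apply: val_inj.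
exact: (lp_norm_eq0 p1 (lp_valP x) x0).
Qed.

HB.instance Definition _ := @Lmodule_isNormed.Build K lp normlp
  normlpD normlpZ normlp_eq0.

Lemma rnorm_lp (x : lp) : rnorm x = lp_norm p x.
Proof. exact: of_realK. Qed.

Lemma lp_cauchy_cvg (F : set_system lp) : ProperFilter F -> cauchy F -> cvg F.
Proof.
apply: (@family_cauchy_cvg R k L Y lp (fun x => lp_val x) (@lp_le R k p L Y)).
- by [].
- move=> x s s0; rewrite rnorm_lp; split.
    by move=> xs; apply: (iffRL (lp_normP p1 _ (ltW s0))); split => //; exact: lp_valP.
  by case/(lp_normP p1 _ (ltW s0)).
- by move=> s y i s0; exact: (lp_le_coord p1 i (ltW s0)).
- move=> G g y s GG s0; exact: lp_le_lim.
- move=> y ye; have [x xy] := ye 1 ltr01.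
  have ylp : y \in lp_pred.
    have := iffLR (lp_normP p1 _ ler01) xy; case=> xylp _.
    have -> : y = lp_val x - (fun i => lp_val x i - y i).
      by apply/funext => i; rewrite !fctE /= opprB addrC subrK.
    by rewrite rpredB//; exact: lp_valP.
  by exists (Lp p1 ylp).
Qed.

HB.instance Definition _ := @Uniform_isComplete.Build lp lp_cauchy_cvg.

End LpSpace.

Section C0Families.
Variables (R : realType) (k : scalar_kind).
Local Notation K := (scalar_field R k).
Variables (L : choiceType) (Y : completeNormedModType K).
Implicit Types y z : L -> Y.

Definition c0_pred : {pred (L -> Y)} :=
  [pred y | `[< forall e : R, 0 < e -> finite_set [set i | e <= rnorm (y i)] >]].

Definition c0_norm y : R := sup [set rnorm (y i) | i in [set: L]].

Lemma c0_predP y : reflect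
  (forall e : R, 0 < e -> finite_set [set i | e <= rnorm (y i)]) (y \in c0_pred).
Proof. exact: asboolP. Qed.

Lemma c0_pred_submod : submod_closed c0_pred.
Proof.
split=> [|a y z /c0_predP yc0 /c0_predP zc0]; apply/c0_predP => e e0.
  rewrite (_ : [set _ | _] = set0)// -subset0 => i /=.
  by rewrite rnorm0 leNgt e0.
have a1 : 0 < rabs a + 1 by rewrite ltr_wpDl// rabs_ge0.
have e1 : 0 < e / 2 / (rabs a + 1) by rewrite !divr_gt0.
have e2 : 0 < e / 2 by rewrite divr_gt0.
have fin : finite_set ([set i | e / 2 / (rabs a + 1) <= rnorm (y i)] `|`
                       [set i | e / 2 <= rnorm (z i)]).
  by rewrite finite_setU; split; [exact: yc0|exact: zc0].
apply: sub_finite_set fin => i /= ei.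
have [zi|zi] := leP (e / 2) (rnorm (z i)); [by right|left].
rewrite leNgt; apply/negP; rewrite ltr_pdivlMr// => yi.
move: ei; apply/negP; rewrite -ltNge (le_lt_trans (rnormD _ _))// (splitr e).
apply: ltrD zi; apply: le_lt_trans yi.
by rewrite rnormZ mulrC ler_wpM2l ?rnorm_ge0// lerDl.
Qed.

Lemma c0_has_ub y : y \in c0_pred ->
  has_ubound [set rnorm (y i) | i in [set: L]].
Proof.
move=> /c0_predP /(_ 1 ltr01) fin.
exists (1 + \sum_(i \in [set i | 1 <= rnorm (y i)]) rnorm (y i)) => _ [i _ <-].
rewrite fsbig_finite//.
have sum_ge0 (s : seq L) : 0 <= \sum_(j <- s) rnorm (y j).
  by apply: sumr_ge0 => j _; exact: rnorm_ge0.
have [yi|yi] := leP 1 (rnorm (y i)); last first.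
  by rewrite (le_trans (ltW yi))// lerDl.
have iF : i \in fset_set [set i | 1 <= rnorm (y i)].
  by rewrite in_fset_set// inE.
rewrite (big_fsetD1 i)//= addrCA lerDl addr_ge0//.
Qed.

Lemma c0_norm_ge0 y : 0 <= c0_norm y.
Proof.
have [ub|noub] := pselect (has_sup [set rnorm (y i) | i in [set: L]]).
  have [r [i Li yi]] := ub.1.
  apply: le_trans (rnorm_ge0 (y i)) _.
  by apply: ub_le_sup; [exact: ub.2|exists i].
by rewrite /c0_norm sup_out.
Qed.

Lemma c0_coord y i : y \in c0_pred -> rnorm (y i) <= c0_norm y.
Proof. by move=> yc0; apply: ub_le_sup; [exact: c0_has_ub|exists i]. Qed.

Lemma c0_norm_le s y : 0 <= s -> (forall i, rnorm (y i) <= s) -> c0_norm y <= s.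
Proof.
move=> s0 ys; rewrite /c0_norm.
have [->|/set0P ne] := eqVneq [set rnorm (y i) | i in [set: L]] set0.
  by rewrite sup0.
by apply: ge_sup => // _ [i _ <-].
Qed.

Lemma c0_normD y z : y \in c0_pred -> z \in c0_pred ->
  c0_norm (y + z) <= c0_norm y + c0_norm z.
Proof.
move=> yc0 zc0; apply: c0_norm_le => [|i].
  by rewrite addr_ge0// c0_norm_ge0.
by rewrite (le_trans (rnormD _ _))// lerD// c0_coord.
Qed.

Lemma c0_normZ (a : K) y : y \in c0_pred ->
  c0_norm (a *: y) = rabs a * c0_norm y.
Proof.
have ub b z : z \in c0_pred -> c0_norm (b *: z) <= rabs b * c0_norm z.
  move=> zc0; apply: c0_norm_le => [|i].
    by rewrite mulr_ge0 ?rabs_ge0 ?c0_norm_ge0.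
  by rewrite rnormZ ler_wpM2l ?rabs_ge0// c0_coord.
move=> yc0; apply/eqP; rewrite eq_le ub//=.
have [->|a0] := eqVneq a 0.
  rewrite (_ : rabs 0 = 0) ?mul0r ?c0_norm_ge0//.
  by apply: (@of_real_inj R k); rewrite rabsE normr0 of_real0.
have aylp : a *: y \in c0_pred.
  by rewrite -[a *: y]addr0; apply: (proj2 c0_pred_submod) => //;
    exact: (proj1 c0_pred_submod).
have := ub a^-1 _ aylp; rewrite scalerA mulVf// scale1r.
move=> /(ler_wpM2l (rabs_ge0 a)) /le_trans; apply.
by rewrite mulrA -rabsM divff// rabs1 mul1r.
Qed.

Lemma c0_norm_eq0 y : y \in c0_pred -> c0_norm y = 0 -> y = 0.
Proof.
move=> yc0 y0; apply/funext => i; apply: rnorm_eq0; apply/eqP.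
by rewrite eq_le rnorm_ge0 andbT -y0 c0_coord.
Qed.

Record c0 : Type := C0 { c0_val :> L -> Y; c0_valP : c0_val \in c0_pred }.

HB.instance Definition _ :=
  GRing.isSubmodClosed.Build K (L -> Y) c0_pred c0_pred_submod.
HB.instance Definition _ := [isSub for c0_val].
HB.instance Definition _ := [Choice of c0 by <:].
HB.instance Definition _ := [SubChoice_isSubLmodule of c0 by <:].

Let normc0 (x : c0) : K := of_real k (c0_norm x).

Let normc0D (x y : c0) : normc0 (x + y) <= normc0 x + normc0 y.
Proof.
rewrite /normc0 -of_realD of_real_le.
exact: (c0_normD (c0_valP x) (c0_valP y)).
Qed.

Let normc0Z a x : normc0 (a *: x) = `|a| * normc0 x.
Proof. by rewrite /normc0 -rabsE -of_realM -(c0_normZ a (c0_valP x)). Qed.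

Let normc0_eq0 x : normc0 x = 0 -> x = 0.
Proof.
rewrite /normc0 -(of_real0 R k) => /of_real_inj x0; apply: val_inj.
exact: (c0_norm_eq0 (c0_valP x) x0).
Qed.

HB.instance Definition _ := @Lmodule_isNormed.Build K c0 normc0
  normc0D normc0Z normc0_eq0.

Lemma rnorm_c0 (x : c0) : rnorm x = c0_norm x.
Proof. exact: of_realK. Qed.

Lemma c0_cauchy_cvg (F : set_system c0) : ProperFilter F -> cauchy F -> cvg F.
Proof.
apply: (@family_cauchy_cvg R k L Y c0 (fun x => c0_val x)
  (fun s y => forall i, rnorm (y i) <= s)).
- by [].
- move=> x s s0; rewrite rnorm_c0; split=> [xs i|xs].
    by apply: le_trans xs; apply: c0_coord; exact: c0_valP.
  by apply: c0_norm_le => //; exact: ltW.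
- by move=> s y i _; exact.
- move=> G g y s GG s0 gy gs i; apply/ler_addgt0Pr => e e0.
  move/cvg_rnorm : (gy i) => /(_ _ e0) gye.
  have [x [xs /ltW xe]] := filter_ex (filterI gs gye).
  by rewrite -(subrK (g x i) (y i)) addrC (le_trans (rnormD _ _))// lerD.
- move=> y ye; suff yc0 : y \in c0_pred by exists (C0 yc0).
  apply/c0_predP => e e0; have e20 : 0 < e / 2 by rewrite divr_gt0.
  have [x xy] := ye _ e20; have /c0_predP/(_ _ e20) := c0_valP x.
  apply: sub_finite_set => i /= ei.
  rewrite -(lerD2r (e / 2)) -splitr (le_trans ei)//.
  rewrite (_ : y i = x i - (x i - y i)); last by rewrite opprB addrC subrK.
  by rewrite (le_trans (rnormD _ _))// rnormN lerD2l.
Qed.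

HB.instance Definition _ := @Uniform_isComplete.Build c0 c0_cauchy_cvg.

End C0Families.

Section Operators.
Variables (R : realType) (k : scalar_kind).
Local Notation K := (scalar_field R k).
Implicit Types E F : normedModType K.

Definition opnorm E F (T : {linear E -> F}) : R :=
  sup [set rnorm (T x) | x in [set x | rnorm x <= 1]].

Definition isomorphic E F := exists (T : {linear E -> F}) (S : {linear F -> E}),
  [/\ cancel T S, cancel S T, continuous T & continuous S].

Definition isomorphic_within (C : R) E F :=
  exists (T : {linear E -> F}) (S : {linear F -> E}),
    [/\ cancel T S, cancel S T, continuous T, continuous S
       & opnorm T * opnorm S <= C].

Definition bounded_projection E (P : {linear E -> E}) :=
  bounded_near P (nbhs (0 : E)) /\ forall x, P (P x) = P x.

Definition primary E := forall P : {linear E -> E}, bounded_projection P ->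
  isomorphic (range_space P) E \/ isomorphic (range_space (idfun \- P)) E.

(* C is only meaningful on [1, +oo[, where the norm of every nonzero projection
   lies; for P = 0 the condition holds because Id - P is the identity. *)
Definition primary_within (C : R -> R) E :=
  forall P : {linear E -> E}, bounded_projection P -> (exists x, P x != 0) ->
    isomorphic_within (C (opnorm P)) (range_space P) E \/
    isomorphic_within (C (opnorm P)) (range_space (idfun \- P)) E.

Definition uniformly_primary E := exists C : R -> R,
  [/\ forall t, 1 <= t -> 1 <= C t,
      forall s t, 1 <= s -> s <= t -> C s <= C t
    & primary_within C E].

Definition weak_space E : topologicalType := sup_topology
  (fun f : {f : {linear E -> K^o} | continuous f} =>
     Topological.class (initial_topology (sval f))).

Definition linear_span E (A : set E) : set E :=
  [set v | exists (n : nat) (a : 'I_n -> K) (x : 'I_n -> E),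
     (forall i, A (x i)) /\ v = \sum_(i < n) a i *: x i].

Definition WCG E := exists A : set E,
  @compact (weak_space E) A /\ closure (linear_span A) = [set: E].

Definition separable_space (T : topologicalType) :=
  exists A : set T, countable A /\ dense A.

End Operators.

Section Cardinals.

Definition card_lt (T U : Type) (A : set T) (B : set U) : Prop :=
  (A #<= B)%card /\ ~ (B #<= A)%card.

(* For a well-order le, the initial segment of the elements strictly below x. *)
Definition segment (T : Type) (le : rel T) (x : T) : set T :=
  [set y | ~~ le x y].

(* (W, le) is order isomorphic to the first uncountable ordinal: it is uncountable
   and all its proper initial segments are countable. *)
Definition is_omega1 (W : Type) (le : rel W) :=
  [/\ wochoice.well_order le, ~ countable [set: W]
    & forall x, countable (segment le x)].

Definition card_gt_omega1 (T : Type) := exists (W : Type) (le : rel W),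
  is_omega1 le /\ card_lt [set: W] [set: T].

(* le has the order type of the initial ordinal of |T| *)
Definition initial_order (T : Type) (le : rel T) :=
  wochoice.well_order le /\ forall x, card_lt (segment le x) [set: T].

Definition cofinal (T : Type) (le : rel T) (A : set T) :=
  forall x, exists2 y, A y & le x y.

(* B has cardinality cf(|T|) *)
Definition has_cofinality (T : Type) (le : rel T) (B : set T) :=
  cofinal le B /\ forall A, cofinal le A -> (B #<= A)%card.

Definition cof_gt_omega (T : Type) := exists (le : rel T) (B : set T),
  [/\ initial_order le, has_cofinality le B & card_lt [set: nat] B].

End Cardinals.

(* Main.v *)
(* Call m below l if the entry of P at (m, l) is nonzero. Columns have countable
   support: for separable Y by density, for WCG Y and p = 1 because the coordinates
   of a weakly compact subset of an l_1-sum tend to zero uniformly (gliding hump).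
   For separable Y and p > 1 or c_0 the rows are countable too, by averaging.
   Hence the strongly connected components of this relation are countable, and
   card Gamma of them are pairwise unreachable: when rows are countable these are the
   connected components, otherwise they come from Hajnal's free set theorem, which
   is where card Gamma > omega_1 is used. Unions of countably many of these
   components form blocks indexed by Gamma on which the compression of P is block
   diagonal, each block being a projection P_g of the countable model X: a path that
   leaves a block never returns, so that P_g is idempotent. By hypothesis P_g X or
   (1 - P_g) X is isomorphic to X, with a uniform constant for card Gamma many g, by
   uniform primariness or because cf(Gamma) > omega, and always on the same side.
   Thus the identity factors through P (or through 1 - P), and the Pelczynski
   decomposition method, carried out with explicit constants, concludes. *)
Require Import Defs.
From HB Require Import structures.
From mathcomp Require Import all_boot all_order all_algebra finmap.
From mathcomp Require Import all_classical all_reals all_analysis.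
From mathcomp Require wochoice.
From mathcomp Require Import complex ring lra.
Set Implicit Arguments.
Unset Strict Implicit.
Unset Printing Implicit Defensive.
Import Order.TTheory GRing.Theory Num.Theory.
Import numFieldNormedType.Exports.
Local Open Scope classical_set_scope.
Local Open Scope ring_scope.

(** * Cardinal arithmetic *)

(** For [p = 1] a row can be uncountable: on an $\ell_1$-sum of scalars, adding up all coordinates
    and placing the result at one coordinate is bounded. The relation then cannot be symmetrised
    without losing countability, and this is what forces free sets and blocks closed under paths.

    A strongly connected component may be a single point. Each block therefore collects infinitely
    many components, so that its index set is a copy of [nat] and its compression acts on the
    countable model itself.

    A statement about the range of an idempotent P is handled as a pair S, T with T S = 1 and S T =
    P, both maps bounded by one constant. Unlike isomorphisms of subspaces, such pairs can be put
    side by side into diagonal operators over Γ. This needs one constant for all blocks used, which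
    uniform primariness or the cofinality provides. Only card Γ many blocks have to be good: the
    others are dropped and the good ones are reindexed by Γ. *)

Lemma card_le_rel (T U : Type) (A : set T) (B : set U) (r : T -> U -> Prop) :
  (forall x, A x -> exists2 y, B y & r x y) ->
  (forall x x' y, A x -> A x' -> r x y -> r x' y -> x = x') -> (A #<= B)%card.
Proof.
move=> rAB rI.
have /choice[f fP] : forall x : A, exists y : B, r (val x) (val y).
  move=> [x xA]; have [y By rxy] := rAB x (set_mem xA).
  by exists (SigSub (mem_set By)).
apply/card_leP/injfunPex; exists f => //.
move=> x x' _ _ fxx'; apply: val_inj.
apply: (rI _ _ (val (f x))) => //; [exact: set_valP|exact: set_valP|].
by rewrite fxx'.
Qed.

Lemma card_le_inj (T U : Type) (A : set T) (B : set U) (f : T -> U) :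
  (forall x, A x -> B (f x)) ->
  (forall x x', A x -> A x' -> f x = f x' -> x = x') -> (A #<= B)%card.
Proof.
move=> fAB fI; apply: (@card_le_rel _ _ _ _ (fun x y => f x = y)).
  by move=> x Ax; exists (f x) => //; exact: fAB.
by move=> x x' y Ax Ax' <- /esym; exact: fI.
Qed.

Lemma card_le_ex (T U : Type) (A : set T) (B : set U) (u : U) :
  (A #<= B)%card -> exists f : T -> U, (forall x, A x -> B (f x)) /\
    forall x x', A x -> A x' -> f x = f x' -> x = x'.
Proof.
elim/Ppointed: U => U in B u *; first by have := no u.
move=> /pcard_leP/injfunPex[f fAB fI]; exists f; split=> // x x' Ax Ax'.
by apply: fI; exact: mem_set.
Qed.

Lemma card_leX (T T' U U' : Type) (A : set T) (B : set U) (A' : set T') (B' : set U') :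
  (A #<= A')%card -> (B #<= B')%card -> (A `*` B #<= A' `*` B')%card.
Proof.
elim/Ppointed: T' => T' in A' *.
  rewrite card_le_emptyr => /eqP-> _.
  by rewrite (_ : set0 `*` B = set0) ?card_ge0// -subset0 => -[? ?] [].
elim/Ppointed: U' => U' in B' *.
  rewrite card_le_emptyr => _ /eqP->.
  by rewrite (_ : A `*` set0 = set0) ?card_ge0// -subset0 => -[? ?] [].
move=> /(card_le_ex point)[f [fA fI]] /(card_le_ex point)[g [gB gI]].
apply: (@card_le_inj _ _ _ _ (fun p => (f p.1, g p.2))).
  by move=> [x y] [/= Ax By]; split; [exact: fA|exact: gB].
move=> [x y] [x' y'] [/= Ax By] [/= Ax' By'] [/fI xx' /gI yy'].
by rewrite xx'// yy'.
Qed.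

Lemma card_leU (T U V : Type) (A B : set T) (C : set U) (a b : V) : a <> b ->
  (A #<= C)%card -> (B #<= C)%card -> (A `|` B #<= C `*` [set a; b])%card.
Proof.
move=> ab; elim/Ppointed: U => U in C *.
  rewrite !card_le_emptyr => /eqP-> /eqP->; rewrite setU0; exact: card_ge0.
move=> /(card_le_ex point)[f [fA fI]] /(card_le_ex point)[g [gB gI]].
apply: (@card_le_rel _ _ _ _ (fun x p =>
   (A x /\ p = (f x, a)) \/ (~ A x /\ p = (g x, b)))).
  move=> x ABx; have [Ax|nAx] := pselect (A x).
    by exists (f x, a); [split => //=; [exact: fA|left]|left].
  case: ABx => // Bx.
  by exists (g x, b); [split => //=; [exact: gB|right]|right].
move=> x x' y ABx ABx' [[Ax ->]|[nAx ->]] [[Ax' []]|[nAx' []]].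
- exact: fI.
- by move=> _ /ab.
- by move=> _ /esym/ab.
- by case: ABx => // Bx; case: ABx' => // Bx'; exact: gI.
Qed.

(** Zorn's lemma on graphs of partial injections: if a maximal one missed a point on each side, that
    pair could be added. *)
Lemma card_le_total (T U : Type) (A : set T) (B : set U) :
  (A #<= B)%card \/ (B #<= A)%card.
Proof.
pose P (r : set (T * U)) := [/\ forall p, r p -> A p.1 /\ B p.2,
  forall x y y', r (x, y) -> r (x, y') -> y = y' &
  forall x x' y, r (x, y) -> r (x', y) -> x = x'].
have [F FP Ftot|r [[rAB rf rI] rmax]] := @Zorn_bigcup _ P.
  have F2 p q : (\bigcup_(X in F) X) p -> (\bigcup_(X in F) X) q ->
      exists X, [/\ F X, X p & X q].
    move=> [X FX Xp] [X' FX' X'q].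
    by have [|] := Ftot _ _ FX FX' => XX'; [exists X'|exists X]; split=> //;
      exact: XX'.
  split.
  - by move=> p [X /FP[XAB _ _]]; exact: XAB.
  - by move=> x y y' /F2/[apply] -[X [/FP[_ Xf _]]]; exact: Xf.
  - by move=> x x' y /F2/[apply] -[X [/FP[_ _ XI]]]; exact: XI.
have [rA|] := pselect (forall x, A x -> exists y, r (x, y)).
  left; apply: (@card_le_rel _ _ _ _ (fun x y => r (x, y))).
    by move=> x /rA[y rxy]; exists y => //; exact: (rAB _ rxy).2.
  by move=> x x' y _ _; exact: rI.
move=> /existsNP[x0 /not_implyP[Ax0 /forallNP rx0]].
have [rB|] := pselect (forall y, B y -> exists x, r (x, y)).
  right; apply: (@card_le_rel _ _ _ _ (fun y x => r (x, y))).
    by move=> y /rB[x rxy]; exists x => //; exact: (rAB _ rxy).1.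
  by move=> y y' x _ _; exact: rf.
move=> /existsNP[y0 /not_implyP[By0 /forallNP ry0]].
exfalso; apply: (rmax (r `|` [set (x0, y0)])).
  by split; [move=> p rp; left|move=> /(_ (x0, y0) (or_intror erefl))/rx0].
split.
- by move=> p [/rAB//|->].
- move=> x y y' [xy|[-> ->]] [xy'|[]]; [exact: rf xy xy'| |by move/rx0: xy'|by []].
  by move=> xx0; move: xy; rewrite xx0 => /rx0.
- move=> x x' y [xy|[-> ->]] [xy'|[]]; [exact: rI xy xy'| |by move/ry0: xy'|by []].
  by move=> _ yy0; move: xy; rewrite yy0 => /ry0.
Qed.

(** [R] is the graph of an injection of [D * D] into [D]. The pairs that involve a point of [E] are
    all sent into [E], where they cannot collide with the old values. *)
Lemma setX_le_extend (T : Type) (R : set (T * T * T)) (D E : set T) :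
  (forall p, R p -> [/\ D p.1.1, D p.1.2 & D p.2]) ->
  (forall x y, D x -> D y -> exists z, R (x, y, z)) ->
  (forall q z z', R (q, z) -> R (q, z') -> z = z') ->
  (forall q q' z, R (q, z) -> R (q', z) -> q = q') ->
  D `&` E = set0 -> ((D `|` E) `*` (D `|` E) #<= E)%card ->
  exists R' : set (T * T * T), [/\ R `<=` R',
   forall p, R' p -> [/\ (D `|` E) p.1.1, (D `|` E) p.1.2 & (D `|` E) p.2],
   forall x y, (D `|` E) x -> (D `|` E) y -> exists z, R' (x, y, z),
   forall q z z', R' (q, z) -> R' (q, z') -> z = z' &
   forall q q' z, R' (q, z) -> R' (q', z) -> q = q'].
Proof.
move=> RD Rtot Rf RI DE.
have [->|/set0P[e Ee]] := eqVneq E set0.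
  by move=> _; exists R; rewrite setU0; split.
move=> /(card_le_ex e)[h [hE hI]].
pose new (q : T * T) := ((D `|` E) `*` (D `|` E)) q /\ ~ (D q.1 /\ D q.2).
have disj z : D z -> E z -> False by move=> Dz Ez; rewrite -[False]/(set0 z) -DE.
exists (R `|` [set p | new p.1 /\ p.2 = h p.1]); split.
- by move=> p Rp; left.
- move=> p [/RD[? ? ?]|[[[? ?] ?] ->]]; first by split; left.
  by split=> //; right; exact: hE.
- move=> x y DEx DEy; have [[Dx Dy]|nD] := pselect (D x /\ D y).
    by have [z Rz] := Rtot x y Dx Dy; exists z; left.
  by exists (h (x, y)); right.
- move=> q z z' [Rz|[/= [_ nq] ->]] [Rz'|[/= [_ nq'] ->]] //; first exact: Rf Rz Rz'.
    by have [? ?] := RD _ Rz; case: nq'.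
  by have [? ?] := RD _ Rz'; case: nq.
- move=> q q' z [Rz|[/= [qDE nq] zE]] [Rz'|[/= [qDE' nq'] zE']].
  + exact: RI Rz Rz'.
  + have [_ _ Dz] := RD _ Rz; exfalso; apply: (disj z) => //.
    by rewrite zE'; exact: hE.
  + have [_ _ Dz] := RD _ Rz'; exfalso; apply: (disj z) => //.
    by rewrite zE; exact: hE.
  + by apply: hI => //; rewrite -zE -zE'.
Qed.

Lemma card_setX_infinite (T : Type) :
  infinite_set [set: T] -> ([set: T * T] #<= [set: T])%card.
Proof.
move=> infT.
(* The domain is read off the diagonal of the graph, so that Zorn's lemma needs to order graphs
   only. *)
pose dom (R : set (T * T * T)) : set T := [set x | exists z, R (x, x, z)].
pose P (R : set (T * T * T)) := [/\
  forall p, R p -> [/\ dom R p.1.1, dom R p.1.2 & dom R p.2],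
  forall x y, dom R x -> dom R y -> exists z, R (x, y, z),
  forall q z z', R (q, z) -> R (q, z') -> z = z' &
  forall q q' z, R (q, z) -> R (q', z) -> q = q'].
have domS (R R' : set (T * T * T)) : R `<=` R' -> dom R `<=` dom R'.
  by move=> RR' x [z Rz]; exists z; exact: RR'.
have [F FP Ftot|R [[RD Rtot Rf RI] Rmax]] := @Zorn_bigcup _ P.
  have F2 p q : (\bigcup_(X in F) X) p -> (\bigcup_(X in F) X) q ->
      exists X, [/\ F X, X p & X q].
    move=> [X FX Xp] [X' FX' X'q].
    by have [|] := Ftot _ _ FX FX' => XX'; [exists X'|exists X]; split=> //;
      exact: XX'.
  split.
  - move=> p [X FX Xp]; have XF : X `<=` \bigcup_(X in F) X by exact: bigcup_sup.
    by have [/(_ _ Xp)[? ? ?] _ _ _] := FP _ FX; split; exact: (domS X).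
  - move=> x y [z /F2 xz] [z' /xz[X [FX Xx Xy]]].
    have [_ /(_ x y) []] := FP _ FX; [by exists z|by exists z'|].
    by move=> t Xt _ _; exists t, X.
  - by move=> q z z' /F2/[apply] -[X [/FP[_ _ Xf _]]]; exact: Xf.
  - by move=> q q' z /F2/[apply] -[X [/FP[_ _ _ XI]]]; exact: XI.
set D := dom R in RD Rtot.
have nE E : E !=set0 -> D `&` E = set0 -> ~ ((D `|` E) `*` (D `|` E) #<= E)%card.
  move=> [e Ee] DE DEE.
  have [R' [RR' R'D R'tot R'f R'I]] := setX_le_extend RD Rtot Rf RI DE DEE.
  have domR' : dom R' = D `|` E.
    apply/seteqP; split=> x; first by move=> [z /R'D[]].
    by move=> DEx; exact: R'tot.
  apply: (Rmax R'); last by split; rewrite ?domR'.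
  split => // R'R; have [z Rz] := R'tot e e (or_intror Ee) (or_intror Ee).
  by move/R'R/RD : Rz => [De _ _]; rewrite -[False]/(set0 e) -DE.
have RX : (D `*` D #<= D)%card.
  apply: (@card_le_rel _ _ _ _ (fun q z => R (q, z))).
    by move=> [x y] [/= Dx Dy]; have [z Rz] := Rtot _ _ Dx Dy; exists z => //; have [] := RD _ Rz.
  by move=> q q' z _ _; exact: RI.
(* If [D] were finite, a countably infinite subset of its complement would contradict [nE]. *)
have infD : infinite_set D.
  move=> finD.
  have infC : infinite_set (~` D).
    by move=> finC; apply: infT; rewrite -(setUv D) finite_setU.
  have [x0 _] : exists x, (~` D) x by apply: infinite_setN0.
  have [h [hC hI]] := card_le_ex x0 ((infiniteP _).1 infC).
  have cE : countable (range h) by exact: card_image_le.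
  apply: (nE (range h)); first by exists (h 0%N), 0%N.
    by rewrite -subset0 => x [Dx [n _ hnx]]; have := hC n I; rewrite hnx.
  have cDE : countable (D `|` range h).
    rewrite -bigcup2E; apply: bigcup_countable => [|i _]; first exact: countableP.
    by case: i => [|[|i]] /=; [exact: finite_set_countable|exact: cE|exact: countable0].
  apply: card_le_trans (countableX cDE cDE) _.
  apply: (@card_le_inj _ _ _ _ h) => [n _|]; last exact: hI.
  by exists n.
have [a [b [Da Db ab]]] : exists a b, [/\ D a, D b & a <> b].
  have [a Da] := infinite_setN0 infD.
  have [b [Db ab]] := infinite_setN0 (infinite_setD infD (finite_set1 a)).
  by exists a, b; split => // ab'; apply: ab.
have two (A : set T) : (A #<= D)%card -> (D `|` A #<= D)%card.
  move=> AD; apply: card_le_trans (card_leU ab (card_lexx D) AD) _.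
  apply: card_le_trans RX; apply: card_leX; first exact: card_lexx.
  by apply: subset_card_le => x [->|->].
(* A copy of [D] inside its complement would contradict [nE]. So the complement is no larger than
   [D], and neither is [T]. *)
have [DC|CD] := card_le_total D (~` D).
  have [f [fC fI]] := card_le_ex a DC.
  exfalso; apply: (nE (f @` D)); first by exists (f a), a.
    by rewrite -subset0 => x [Dx [y /fC Cy yx]]; move: Cy; rewrite yx.
  have ED : (f @` D #<= D)%card by exact: card_image_le.
  apply: card_le_trans (card_leX (two _ ED) (two _ ED)) _.
  apply: card_le_trans RX _; apply: (@card_le_inj _ _ _ _ f) => [x Dx|]; last exact: fI.
  by exists x.
have TD : ([set: T] #<= D)%card by rewrite -(setUv D); exact: two.
rewrite -setXTT; apply: card_le_trans (card_leX TD TD) _.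
by apply: card_le_trans RX _; exact: card_leT.
Qed.

(** * Well-orders, recursion along them and cardinal bounds for unions *)

Section WellOrder.
Variables (T : eqType) (le : rel T).
Hypothesis wo : wochoice.well_order le.

Lemma wo_total : total le.
Proof.
have /wochoice.wo_chainW : wochoice.wo_chain le predT by move=> A _; exact: wo.
by move=> tot x y; exact: tot.
Qed.

Lemma wo_anti : antisymmetric le.
Proof.
have /wochoice.wo_chain_antisymmetric : wochoice.wo_chain le predT by move=> A _; exact: wo.
by move=> anti x y; exact: anti.
Qed.

Lemma wo_trans : transitive le.
Proof.
move=> y x z xy yz.
have [|m [[mA mmin] _]] := wo (A := pred3 x y z); first by exists x; rewrite !inE eqxx.
have mx : le m x by apply: mmin; rewrite !inE eqxx.
have my : le m y by apply: mmin; rewrite !inE eqxx orbT.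
have mz : le m z by apply: mmin; rewrite !inE eqxx !orbT.
move: mA; rewrite !inE => /or3P[] /eqP mE; subst m => //.
  by rewrite (wo_anti (introT andP (conj xy mx))).
by rewrite -(wo_anti (introT andP (conj yz my))).
Qed.

Lemma wo_wf : well_founded (fun x y => ~~ le y x).
Proof.
move=> x0; apply/not_notP => nx0.
have [|z [[/asboolP nz zmin] _]] := wo (A := [pred x | `[< ~ Acc (fun x y => ~~ le y x) x >]]).
  by exists x0; apply/asboolP.
apply: nz; constructor => y yz; apply/not_notP => ny.
by move/negP: yz; apply; apply: zmin; apply/asboolP.
Qed.

(** Transfinite recursion with choice. [Q] takes total functions, which keeps invariants simple; the
    values at and above [s] are irrelevant by the first hypothesis and are filled with [u0]. *)
Lemma wo_choice (U : Type) (u0 : U) (Q : T -> (T -> U) -> U -> Prop) :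
  (forall s g g' u, (forall t, ~~ le s t -> g t = g' t) -> Q s g u -> Q s g' u) ->
  (forall s g, exists u, Q s g u) -> exists g : T -> U, forall s, Q s g (g s).
Proof.
move=> Qloc Qex.
pose ext s (rec : forall t, ~~ le s t -> U) t :=
  if pselect (~~ le s t) is left h then rec t h else u0.
pose F s (rec : forall t, ~~ le s t -> U) := sval (cid (Qex s (ext s rec))).
pose g := Fix wo_wf (fun=> U) F.
have gE s : g s = F s (fun t _ => g t).
  apply: Fix_eq => x f f' ff'; congr F.
  by apply/functional_extensionality_dep => t; apply/functional_extensionality_dep.
exists g => s; rewrite gE /F; case: cid => u /=; apply: Qloc => t st.
by rewrite /ext; case: pselect => [|nst] //; case: (nst st).
Qed.

End WellOrder.

(** Among the points of a well-order whose initial segment is as large as [T], take the least one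
    and pull the order back along an injection of [T] into its segment. *)
Lemma initial_order_exists (T : eqType) : exists le : rel T, initial_order le.
Proof.
have [le wo] := wochoice.well_ordering_principle T.
have [small|/existsNP[x1 nx1]] :=
    pselect (forall x, card_lt (segment le x) [set: T]).
  by exists le.
have [|x [[/asboolP Tx xmin] _]] :=
    wo [pred x | `[< ([set: T] #<= segment le x)%card >]].
  exists x1; apply/asboolP; apply/not_notP => Tx1; apply: nx1.
  by split => //; exact: card_leT.
have [h [hx hI]] := card_le_ex x1 Tx.
have {}hI : injective h by move=> a b; exact: hI.
exists (fun a b => le (h a) (h b)); split.
  move=> A [a Aa].
  have [|y [[/asboolP[b [Ab bE]] ymin] _]] :=
      wo [pred y | `[< exists b, b \in A /\ h b = y >]].
    by exists (h a); apply/asboolP; exists a.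
  have bmin : wochoice.minimum_of (fun a b => le (h a) (h b)) A b.
    by split=> // c Ac; rewrite bE; apply: ymin; apply/asboolP; exists c.
  exists b; split=> // c [Ac cmin]; apply: hI; apply: (wo_anti wo).
  by rewrite (bmin.2 _ Ac); exact: cmin.
move=> a; split; first exact: card_leT.
move=> Ta; have /negP := hx a I; apply; apply: xmin; apply/asboolP.
apply: card_le_trans Ta _; apply: (@card_le_inj _ _ _ _ h) => // b c _ _.
exact: hI.
Qed.

Lemma card_bigcup_countable (I T : Type) (D : set I) (F : I -> set T) :
  (forall i, D i -> countable (F i)) ->
  (\bigcup_(i in D) F i #<= D `*` [set: nat])%card.
Proof.
move=> cF.
have [->|/set0P[i0 Di0]] := eqVneq D set0; first by rewrite bigcup_set0 card_ge0.
have /choice[h hP] : forall i, exists h : T -> nat, D i ->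
    forall x y, F i x -> F i y -> h x = h y -> x = y.
  move=> i; have [Di|nD] := pselect (D i); last by exists (fun=> 0%N).
  have [h [_ hI]] := card_le_ex 0%N (cF i Di).
  by exists h => _ x y Fx Fy; exact: hI.
apply: (@card_le_rel _ _ _ _ (fun x p => [/\ D p.1, F p.1 x & h p.1 x = p.2])).
  by move=> x [i Di Fx]; exists (i, h i x).
by move=> x x' [i n] _ _ /= [Di Fx <-] [_ Fx' /esym]; exact: hP.
Qed.

Lemma card_setX_nat (T : Type) (D : set T) :
  infinite_set D -> (D `*` [set: nat] #<= D)%card.
Proof.
move=> infD; have infD' : infinite_set [set: D].
  by move=> finD; apply: infD; rewrite -(eq_finite_set (card_setT D)).
have := card_setX_infinite infD'.
rewrite -setXTT => XD.
have DD : (D #<= [set: D])%card by have := card_setT D; rewrite card_eq_le => /andP[].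
have DD' : ([set: D] #<= D)%card by have := card_setT D; rewrite card_eq_le => /andP[].
apply: card_le_trans _ DD'; apply: card_le_trans XD.
by apply: card_leX => //; apply: card_le_trans DD; apply/infiniteP.
Qed.

(** The union has at most |D| times ω points: countably many if [D] is finite, and |D| many
    otherwise. *)
Lemma card_bigcup_small (I T U : Type) (D : set I) (F : I -> set T) (A : set U) :
  ~ countable A -> ~ (A #<= D)%card -> (forall i, D i -> countable (F i)) ->
  ~ (A #<= \bigcup_(i in D) F i)%card.
Proof.
move=> cA AD cF AF.
have [finD|infD] := pselect (finite_set D).
  apply: cA; apply: card_le_trans AF _; apply: bigcup_countable => //.
  exact: finite_set_countable.
apply: AD; apply: card_le_trans AF _.
exact: card_le_trans (card_bigcup_countable cF) (card_setX_nat infD).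
Qed.

Lemma infinite_uncountable (T : Type) (A : set T) : ~ countable A -> infinite_set A.
Proof. by move=> cA /finite_set_countable. Qed.

(** View [T] as containing a square [T * T]. Either some full row of the square lies in [A], or
    every row has a point in [B], and different rows give different points. *)
Lemma card_le_setU (T : Type) (A B : set T) : infinite_set [set: T] ->
  A `|` B = setT -> ([set: T] #<= A)%card \/ ([set: T] #<= B)%card.
Proof.
move=> infT ABT.
have [t0 _] := infinite_setN0 infT.
have [k [_ kI]] := card_le_ex t0 (card_setX_infinite infT).
have [[x xA]|nA] := pselect (exists x, forall y, A (k (x, y))).
  left; apply: (@card_le_inj _ _ _ _ (fun y => k (x, y))) => // y y' _ _.
  by move/kI => /(_ I I)[].
right; apply: (@card_le_rel _ _ _ _ (fun x z => exists y, z = k (x, y))).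
  move=> x _; move/forallNP: nA => /(_ x)/existsNP[y nAy].
  exists (k (x, y)); last by exists y.
  by have : (A `|` B) (k (x, y)); [rewrite ABT|case].
by move=> x x' z _ _ [y ->] [y' kxy]; have [] := kI _ _ I I kxy.
Qed.

(** * Free sets and blocks *)

(* Hajnal's free set theorem for countable set mappings. Stage s tries to add a
   new point to the set of colour p s. A colour is dead at stage s if this is
   impossible; each stage kills only countably many colours, so that the
   increasing union of the sets of dead colours has cardinality at most omega1
   and some colour receives card T points. *)
Lemma free_set (T : choiceType) (W : Type) (f : T -> set T) :
  ~ countable [set: W] -> ~ ([set: T] #<= [set: W])%card ->
  (forall x, countable (f x)) -> (forall x, f x x) ->
  exists h : T -> T, forall a b, a <> b -> ~ f (h a) (h b).
Proof.
move=> cW TW cf frefl.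
have cT : ~ countable [set: T].
  move=> cT; have [TleW|WleT] := card_le_total [set: T] [set: W]; first exact: TW.
  by apply: cW; exact: card_le_trans WleT cT.
have [t0 _] := infinite_setN0 (infinite_uncountable cT).
have [le [wo small]] := initial_order_exists T.
have [k [_ kI]] := card_le_ex t0 (card_setX_infinite (infinite_uncountable cT)).
(* [p] colours the stages so that every colour [w] owns the stages [k (w, t)], one for each [t]. *)
have /choice[p pk] : forall s, exists w, forall w' t, s = k (w', t) -> w = w'.
  move=> s; have [[w [t ->]]|nk] := pselect (exists w t, s = k (w, t)).
    by exists w => w' t' kE; have [] := kI _ _ I I kE.
  by exists t0 => w' t' sE; case: nk; exists w', t'.
pose D (g : T -> option T) s : set T :=
  \bigcup_(t in segment le s) [set z | exists2 y, g t = Some y & f y z].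
(* The first clause keeps [x] out of the images of all earlier points, whatever their colour; the
   second keeps earlier points of the same colour out of [f x]. *)
pose ok (g : T -> option T) s x := ~ D g s x /\
  forall t y, ~~ le s t -> p t = p s -> g t = Some y -> ~ f x y.
pose Q s g (u : option T) := if u is Some x then ok g s x else forall x, ~ ok g s x.
have Qex s g : exists u, Q s g u.
  have [[x okx]|nok] := pselect (exists x, ok g s x); first by exists (Some x).
  by exists None => x okx; apply: nok; exists x.
have okE s g g' x : (forall t, ~~ le s t -> g t = g' t) -> ok g s x -> ok g' s x.
  move=> gg' [nD okx]; split.
    move=> [t st [y gt fy]]; apply: nD; exists t => //.
    by exists y => //; rewrite gg'.
  by move=> t y st pt gt; apply: (okx t y) => //; rewrite gg'.
have Qloc s g g' u : (forall t, ~~ le s t -> g t = g' t) -> Q s g u -> Q s g' u.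
  move=> gg'; case: u => [x|nok x okx]; first exact: okE.
  by apply: (nok x); apply: okE okx => t st; rewrite gg'.
have [g gP] := wo_choice wo None Qloc Qex.
have DT s : exists x, ~ D g s x.
  apply/existsNP => DT.
  have := @card_bigcup_small _ _ _ (segment le s) (fun t => [set z | exists2 y, g t = Some y & f y z]) _ cT (small s).2.
  apply => [t _|]; last by apply: subset_card_le => x _; exact: DT.
  case: (g t) => [y|].
    by apply: card_le_trans (cf y); apply: subset_card_le => z [y' [<-]].
  by apply: card_le_trans (countable0 T); apply: subset_card_le => z [y'].
pose dead s : set T := [set w | forall x, ~ D g s x ->
  exists t y, [/\ ~~ le s t, p t = w, g t = Some y & f x y]].
(* Fix [x] outside [D g s]. Every colour dead at [s] has a point in the countable set [f x], and
   different colours have different points because, [f] being reflexive, no point is placed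
   twice. *)
have dead_countable s : countable (dead s).
  have [x nDx] := DT s; apply: card_le_trans (cf x).
  apply: (@card_le_rel _ _ _ _ (fun w y =>
    exists t, [/\ ~~ le s t, p t = w & g t = Some y])).
    by move=> w /(_ x nDx)[t [y [st pt gt fy]]]; exists y => //; exists t.
  move=> w w' y _ _ [t [st <- gt]] [t' [st' <- gt']].
  have [->//|tt'] := eqVneq t t'.
  have nlt a b : g a = Some y -> g b = Some y -> ~~ le a b -> False.
    move=> ga gb ab; have := gP a; rewrite ga => -[nD _]; apply: nD.
    by exists b => //; exists y.
  exfalso; have [tle|] := boolP (le t t'); last exact: nlt.
  have [tge|] := boolP (le t' t); last exact: nlt.
  by move/eqP: tt'; apply; apply: (wo_anti wo); rewrite tle.
have lt_le s s' t : le s s' -> ~~ le s t -> ~~ le s' t.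
  by move=> ss'; apply: contra => /(wo_trans wo ss').
have dead_mono s s' : le s s' -> dead s `<=` dead s'.
  move=> ss' w ws x nDx; have [|t [y [st pt gt fy]]] := ws x.
    move=> [t st Dt]; apply: nDx; exists t => //; exact: lt_le ss' st.
  by exists t, y; split => //; exact: lt_le ss' st.
have [w0 alive] : exists w0, forall s, ~ dead s w0.
  apply/not_notP => nalive.
  have /choice[s sdead] : forall w, exists s, dead s w.
    by move=> w; apply/not_notP => nw; apply: nalive; exists w => s ws; apply: nw; exists s.
  have [TleW|WleT] := card_le_total [set: T] [set: W]; first exact: TW.
  have [i [_ iI]] := card_le_ex t0 WleT.
  (* If the death stages of the colours [i w] are bounded, uncountably many colours are dead at a
     single stage. Otherwise every colour is dead at one of these stages, and |W| many countable
     sets would cover [T]. *)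
  have [[s0 bounded]|unbounded] := pselect (exists s0, forall w, le (s (i w)) s0).
    apply: cW; apply: card_le_trans (dead_countable s0).
    apply: (@card_le_inj _ _ _ _ i) => // w _; exact: dead_mono (sdead _).
  apply: (@card_bigcup_small _ _ _ [set: W] (fun w => dead (s (i w))) _ cT TW).
    by move=> w _; exact: dead_countable.
  apply: subset_card_le => w _; move/forallNP: unbounded => /(_ (s w))/existsNP[v sv].
  exists v => //; apply: dead_mono (sdead w).
  by have /orP[|/sv] := wo_total wo (s w) (s (i v)).
have /choice[h hP] : forall t, exists x, g (k (w0, t)) = Some x.
  move=> t; have := gP (k (w0, t)); case: (g (k (w0, t))) => [x _|nok]; first by exists x.
  exfalso; apply: (alive (k (w0, t))) => x nDx; apply/not_notP => nex.
  apply: (nok x); split => // t' y st pt gt fy; apply: nex; exists t', y; split => //.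
  by rewrite pt; exact: pk.
have hok t : ok g (k (w0, t)) (h t) by have := gP (k (w0, t)); rewrite hP.
exists h => a b ab fab.
have kab : k (w0, a) <> k (w0, b) by move/(kI _ _ I I) => -[].
have [lab|nlab] := boolP (le (k (w0, a)) (k (w0, b))); last first.
  have [_ okab] := hok a.
  apply: (okab (k (w0, b)) (h b) nlab) => //.
  by rewrite (pk _ _ _ erefl) (pk _ _ _ erefl).
have [lba|nlba] := boolP (le (k (w0, b)) (k (w0, a))).
  by apply: kab; apply: (wo_anti wo); rewrite lab.
have [nD _] := hok b; apply: nD; exists (k (w0, a)) => //.
by exists (h a).
Qed.

(** The sets [f x] are countable equivalence classes, so there are as many classes as points; [h]
    picks representatives of different classes. *)
Lemma equivalence_transversal (T : choiceType) (f : T -> set T) :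
  ~ countable [set: T] -> (forall x, countable (f x)) ->
  (forall x, f x x) -> (forall x y, f x y -> f x = f y) ->
  exists h : T -> T, forall a b, a <> b -> ~ f (h a) (h b).
Proof.
move=> cT cf frefl feq.
have [t0 _] := infinite_setN0 (infinite_uncountable cT).
pose r x := xget t0 (f x).
have rP x : f x (r x) by apply: (xgetPex t0); exists x.
have rE x y : f x y -> r x = r y by move=> /feq; rewrite /r => ->.
have Tr : ([set: T] #<= range r)%card.
  apply/not_notP => Tr; apply: (card_bigcup_small cT Tr (fun x _ => cf x)).
  apply: subset_card_le => x _; exists (r x); first by exists x.
  by rewrite -(feq _ _ (rP x)).
have [h [hr hI]] := card_le_ex t0 Tr.
exists h => a b ab fab; apply: ab; apply: hI => //.
have [x _ rx] := hr a I; have [y _ ry] := hr b I.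
have rr z : r (r z) = r z by rewrite -(rE _ _ (rP z)).
by move: (rE _ _ fab); rewrite -rx -ry !rr.
Qed.

(** If all [G n] were smaller than [T], each would fit into a proper initial segment. Countably many
    bounds are not cofinal, so one segment would serve for all [n], and [T] would have at most ω
    times as many points as that segment. *)
Lemma cof_gt_omega_bigcup (T : choiceType) (G : nat -> set T) :
  ~ countable [set: T] -> cof_gt_omega T -> (forall x, exists n, G n x) ->
  exists n, ([set: T] #<= G n)%card.
Proof.
move=> cT [le [B [[wo small] [_ Bmin] [_ nB]]]] GT.
apply/not_existsP => TG.
have /choice[x xP] : forall n, exists x, (G n #<= segment le x)%card.
  move=> n; apply/not_existsP => nx; apply: (TG n).
  have [t0 Gt0] : exists t, G n t.
    apply: contrapT => /forallNP G0; have [x _] := infinite_setN0 (infinite_uncountable cT).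
    by apply: (nx x); rewrite (_ : G n = set0) ?card_ge0// -subset0.
  (* If [G n] fitted into no segment, every stage could choose a point of [G n] not chosen before,
     and [T] would embed in [G n]. *)
  pose Q s (g : T -> T) u := G n u /\ forall t, ~~ le s t -> g t <> u.
  have Qloc s g g' u : (forall t, ~~ le s t -> g t = g' t) -> Q s g u -> Q s g' u.
    by move=> gg' [Gu gu]; split=> // t st; rewrite -gg'//; exact: gu.
  have Qex s g : exists u, Q s g u.
    apply: contrapT => /forallNP nQ; apply: (nx s).
    apply: (@card_le_trans _ _ _ (g @` segment le s)); last exact: card_image_le.
    apply: subset_card_le => u Gu; apply: contrapT => gu; apply: (nQ u); split => // t st gt.
    by apply: gu; exists t.
  have [g gP] := wo_choice wo t0 Qloc Qex.
  apply: (@card_le_inj _ _ _ _ g) => [t _|t t' _ _ gtt']; first exact: (gP t).1.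
  have nlt a b : g a = g b -> le a b.
    move=> gab; apply: contrapT => /negP lab.
    by have [_ /(_ b lab)] := gP a; apply.
  by apply: (wo_anti wo); rewrite !nlt.
have [cofx|] := pselect (cofinal le (range x)).
  by apply: nB; apply: card_le_trans (Bmin _ cofx) _; exact: card_image_le.
move=> /existsNP[y ny].
have Gy n : (G n #<= segment le y)%card.
  apply: card_le_trans (xP n) _; apply: subset_card_le => z; rewrite /segment/=.
  apply: contra => yz; have /orP[xy|yx] := wo_total wo (x n) y.
    exact: (wo_trans wo) xy yz.
  by exfalso; apply: ny; exists (x n) => //; exists n.
have TI : ~ ([set: T] #<= (setT : set nat) `*` segment le y)%card.
  move=> TI; have [finy|infy] := pselect (finite_set (segment le y)).
    apply: cT; apply: card_le_trans TI _.
    by apply: countableX => //; exact: finite_set_countable.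
  apply: (small y).2; apply: card_le_trans TI _.
  apply: card_le_trans (card_setX_nat infy).
  apply: (@card_le_inj _ _ _ _ (fun p => (p.2, p.1))) => [[a b] [_ ?]//|].
  by move=> [a b] [c d] _ _ [-> ->].
apply: TI.
have /choice[h hP] : forall n, exists h : T -> T, (forall z, G n z -> segment le y (h z)) /\ forall z z', G n z -> G n z' -> h z = h z' -> z = z'.
  by move=> n; exact: card_le_ex y (Gy n).
have /choice[m mP] := GT.
apply: (@card_le_inj _ _ _ _ (fun z => (m z, h (m z) z))).
  by move=> z _; split => //=; apply: (hP _).1.
by move=> z z' _ _ [mzz']; rewrite mzz'; apply: (hP _).2 => //; rewrite -mzz'.
Qed.

Lemma card_bij_ex (T U : Type) (A : set T) (B : set U) (u : U) :
  (A #= B)%card -> exists f : T -> U, set_bij A B f.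
Proof.
elim/Ppointed: U => U in B u *; first by have := no u.
by move=> /card_set_bijP.
Qed.

(* [e (g, n)] enumerates the g-th block, a union of countably many strongly
   connected components of pairwise unreachable points. *)
Lemma convex_blocks (T : choiceType) (f : T -> set T) (h : T -> T) :
  infinite_set [set: T] -> (forall x, countable (f x)) -> (forall x, f x x) ->
  (forall x y z, f x y -> f y z -> f x z) ->
  (forall a b, a <> b -> ~ f (h a) (h b)) ->
  exists e : T * nat -> T, [/\ injective e,
    forall g n g' n', g <> g' -> ~ f (e (g, n)) (e (g', n')) &
    forall g n n' m, f (e (g, n)) m -> f m (e (g, n')) -> exists i, m = e (g, i)].
Proof.
move=> infT cf frefl ftrans hP.
have [t0 _] := infinite_setN0 infT.
have [k [_ kI]] := card_le_ex t0 (card_setX_nat infT).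
have {}kI p q : k p = k q -> p = q by apply: kI.
pose N g : set T := [set y | exists n, f (h (k (g, n))) y /\ f y (h (k (g, n)))].
have hinj a b : f (h a) (h b) -> a = b by move=> fab; apply/not_notP => /hP.
have NE g g' y y' : N g y -> N g' y' -> f y y' -> g = g'.
  move=> [n [ny _]] [n' [_ yn']] yy'.
  by have /hinj/kI[] := ftrans _ _ _ (ftrans _ _ _ ny yy') yn'.
have cN g : (N g #= [set: nat])%card.
  apply: eq_card_nat.
    apply: (@card_le_trans _ _ _ (\bigcup_n f (h (k (g, n))))).
      by apply: subset_card_le => y [n [hy _]]; exists n.
    by apply: bigcup_countable => //; exact: countableP.
  apply/infiniteP; apply: (@card_le_inj _ _ _ _ (fun n => h (k (g, n)))).
    by move=> n _; exists n; split; exact: frefl.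
  move=> n n' _ _ hnn'; suff /kI[] : k (g, n) = k (g, n') by [].
  by apply: hinj; rewrite hnn'; exact: frefl.
have /choice[u uP] : forall g, exists u : nat -> T, set_bij [set: nat] (N g) u.
  by move=> g; apply: (card_bij_ex t0); exact: card_esym.
exists (fun p => u p.1 p.2).
have uN g n : N g (u g n) by have [uN _ _] := uP g; exact: uN.
split=> [[g n] [g' n'] /= uu|g n g' n' gg' uu|g n n' m /= gm mg].
- have gg' : g = g'.
    by apply: (@NE g g' (u g n) (u g' n')) => //; rewrite -uu; exact: frefl.
  by subst g'; have [_ uI _] := uP g; rewrite (uI n n') ?inE.
- by apply: gg'; apply: NE uu.
(* The path through [m] leads from the base point number [j] of the block to number [j']. Base
   points do not reach each other, so [j = j'] and [m] lies in that component. *)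
- have [_ _ uS] := uP g; have [i _ <-] : range (u g) m; last by exists i.
  apply: uS; have [j [jn nj]] := uN g n; have [j' [jn' nj']] := uN g n'.
  have jm := ftrans _ _ _ jn gm; have mj' := ftrans _ _ _ mg nj'.
  have /hinj/kI[jj'] := ftrans _ _ _ jm mj'; subst j'.
  by exists j.
Qed.

(** The reflexive transitive closure in impredicative form: induction along a path is an instance of
    the definition. *)
Definition reachable (T : Type) (r : T -> set T) (x : T) : set T :=
  [set y | forall A : set T, A x -> (forall u v, A u -> r u v -> A v) -> A y].

Section Reachable.
Variables (T : Type) (r : T -> set T).

Lemma reachable_refl x : reachable r x x. Proof. by move=> A. Qed.

Lemma reachable_step x y : r x y -> reachable r x y.
Proof. by move=> rxy A Ax Ar; exact: Ar rxy. Qed.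

Lemma reachable_trans x y z :
  reachable r x y -> reachable r y z -> reachable r x z.
Proof. by move=> xy yz A Ax Ar; apply: yz => //; exact: xy. Qed.

Lemma reachable_countable x : (forall y, countable (r y)) -> countable (reachable r x).
Proof.
move=> cr; pose step (A : set T) := \bigcup_(y in A) r y.
have cA n : countable (iter n step [set x]).
  elim: n => [|n IH] /=; first exact: countable1.
  exact: bigcup_countable.
apply: card_le_trans (bigcup_countable (countableP setT) (fun n _ => cA n)).
apply: subset_card_le => y; apply; first by exists 0%N.
by move=> u v [n _ Au] ruv; exists n.+1 => //; exists u.
Qed.

Lemma reachable_sym x y : (forall u v, r u v -> r v u) ->
  reachable r x y -> reachable r y x.
Proof.
move=> rC xy; apply: (xy [set z | reachable r z x]); first exact: reachable_refl.
move=> u v ux ruv; apply: reachable_trans ux.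
by apply: reachable_step; exact: rC.
Qed.

End Reachable.

(* For r y = the support of the column y of a projection, these conditions make
   the compression of the projection to the blocks e (g, _) block diagonal with
   idempotent blocks. *)
Definition block_system (T : Type) (r : T -> set T) (e : T * nat -> T) :=
  [/\ injective e,
    forall g n g' n', g <> g' -> ~ r (e (g, n)) (e (g', n')) &
    forall g n n' m, r (e (g, n)) m -> r m (e (g, n')) -> exists i, m = e (g, i)].

Lemma block_system_antichain (T : choiceType) (r : T -> set T) (h : T -> T) :
  ~ countable [set: T] -> (forall x, countable (r x)) ->
  (forall a b, a <> b -> ~ reachable r (h a) (h b)) ->
  exists e, block_system r e.
Proof.
move=> cT cr hP; have [|e [eI eA eC]] := convex_blocks (infinite_uncountable cT) _
    (@reachable_refl _ r) (@reachable_trans _ r) hP.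
  by move=> x; exact: reachable_countable.
exists e; split => [//|g n g' n' gg' rgg'|g n n' m gm mg].
  exact: (eA _ n _ n' gg' (reachable_step rgg')).
exact: eC (reachable_step gm) (reachable_step mg).
Qed.

Lemma block_system_omega1 (T : choiceType) (r : T -> set T) :
  card_gt_omega1 T -> (forall x, countable (r x)) -> exists e, block_system r e.
Proof.
move=> [W [le [[_ cW _] [WT TW]]]] cr.
have cT : ~ countable [set: T] by move=> cT; apply: cW; exact: card_le_trans WT cT.
have [h hP] := free_set cW TW (fun x => reachable_countable x cr) (@reachable_refl _ r).
exact: block_system_antichain hP.
Qed.

Lemma block_system_sym (T : choiceType) (r : T -> set T) :
  ~ countable [set: T] -> (forall x, countable (r x)) ->
  (forall x y, r x y -> r y x) -> exists e, block_system r e.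
Proof.
move=> cT cr rC.
have [|h hP] := equivalence_transversal cT (fun x => reachable_countable x cr) (@reachable_refl _ r).
  move=> x y xy; apply/seteqP; split=> z; apply: reachable_trans => //.
  exact: reachable_sym.
exact: block_system_antichain hP.
Qed.

Lemma block_system_sub (T : Type) (r : T -> set T) e (h : T -> T) :
  injective h -> block_system r e ->
  block_system r (fun p => e (h p.1, p.2)).
Proof.
move=> hI [eI eA eC]; split => [[g n] [g' n'] /= /eI[/hI-> ->]//|g n g' n' gg' /=|g n n' m /=].
  by apply: eA => /hI.
exact: eC.
Qed.

(** * Abstract sums of copies of a Banach space *)

Section Bounds.
Variables (R : realType) (k : scalar_kind).
Local Notation K := (scalar_field R k).
Implicit Types E F G : normedModType K.

Lemma linear_ex (U V : lmodType K) (g : U -> V) : linear g ->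
  exists T : {linear U -> V}, T =1 g.
Proof.
move=> lg.
pose T : {linear U -> V} := HB.pack g (GRing.isLinear.Build K U V *:%R g lg).
by exists T.
Qed.

Lemma rnorm_gt0 E (x : E) : x != 0 -> 0 < rnorm x.
Proof.
move=> x0; rewrite lt_neqAle rnorm_ge0 andbT eq_sym; apply: contra x0 => /eqP x0.
by apply/eqP; exact: rnorm_eq0.
Qed.

Lemma rabs_of_real (s : R) : 0 <= s -> rabs (of_real k s) = s.
Proof.
move=> s0; apply: (@of_real_inj R k); rewrite rabsE ger0_norm//.
by rewrite -(of_real0 R k) of_real_le.
Qed.

Definition op_le E F (c : R) (T : E -> F) := forall x, rnorm (T x) <= c * rnorm x.

Lemma op_le_mono E F c d (T : E -> F) : c <= d -> op_le c T -> op_le d T.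
Proof. by move=> cd cT x; rewrite (le_trans (cT x))// ler_wpM2r ?rnorm_ge0. Qed.

Lemma op_le_comp E F G c d (S : F -> G) (T : E -> F) : 0 <= c ->
  op_le c S -> op_le d T -> op_le (c * d) (fun x => S (T x)).
Proof.
by move=> c0 cS dT x; rewrite (le_trans (cS _))// -mulrA ler_wpM2l.
Qed.

Lemma op_leD E F c d (S T : E -> F) :
  op_le c S -> op_le d T -> op_le (c + d) (fun x => S x + T x).
Proof.
by move=> cS dT x; rewrite (le_trans (rnormD _ _))// mulrDl lerD.
Qed.

Lemma op_leN E F c (T : E -> F) : op_le c T -> op_le c (fun x => - T x).
Proof. by move=> cT x; rewrite rnormN. Qed.

Lemma op_leB E F c d (S T : E -> F) :
  op_le c S -> op_le d T -> op_le (c + d) (fun x => S x - T x).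
Proof. by move=> cS /op_leN; exact: op_leD. Qed.

Lemma op_le_id E : op_le 1 (fun x : E => x).
Proof. by move=> x; rewrite mul1r. Qed.

End Bounds.

Definition restr (Y : zmodType) (L : Type) (I : eqType) (b : L -> I) (i : I)
  (y : L -> Y) : L -> Y := fun l => if b l == i then y l else 0.

(* An abstract l_p- or c_0-sum of copies of Y: fle s y means that the family y
   belongs to the space and has norm at most s, and fle_block expresses that the
   norm only depends on the norms of the blocks of an arbitrary partition. *)
Record family_space (R : realType) (k : scalar_kind)
    (Y : normedModType (scalar_field R k)) := FamilySpace {
  fam :> choiceType -> normedModType (scalar_field R k);
  fval : forall L : choiceType, fam L -> L -> Y;
  fle : forall L : choiceType, R -> (L -> Y) -> Prop;
  fvalP : forall (L : choiceType) a (x y : fam L) l,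
    fval (a *: x + y) l = a *: fval x l + fval y l;
  fnormP : forall (L : choiceType) (x : fam L) s, 0 <= s ->
    rnorm x <= s <-> fle s (fval x);
  fle_ex : forall (L : choiceType) (y : L -> Y) s, 0 <= s -> fle s y ->
    exists x : fam L, fval x = y;
  fle_mono : forall (L : choiceType) (y : L -> Y) s t, 0 <= s -> s <= t ->
    fle s y -> fle t y;
  fle_coord : forall (L : choiceType) (y : L -> Y) s l, 0 <= s -> fle s y ->
    rnorm (y l) <= s;
  fle_single : forall (L : choiceType) (y : L -> Y) l,
    fle (rnorm (y l)) (restr id l y);
  fle_block : forall (L L' I : choiceType) (b : L -> I) (b' : L' -> I)
      (y : L -> Y) (z : L' -> Y) c s, 0 <= c -> 0 <= s ->
    (forall i t, 0 <= t -> fle t (restr b i y) -> fle (c * t) (restr b' i z)) ->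
    fle s y -> fle (c * s) z;
  fle_approx : forall (L : choiceType) (y : L -> Y) s e, 0 <= s -> 0 < e ->
    fle s y -> exists A : {fset L}, fle e (fun l => if l \in A then 0 else y l) }.

Section FamilySpace.
Variables (R : realType) (k : scalar_kind).
Local Notation K := (scalar_field R k).
Variables (Y : normedModType K) (E : family_space Y).
Implicit Types L M I : choiceType.

Lemma fval0 L l : fval (0 : E L) l = 0.
Proof.
apply: (@addrI _ (fval (0 : E L) l)).
by have := fvalP 1 (0 : E L) 0 l; rewrite !scale1r !addr0 => <-.
Qed.

Lemma fvalD L (x y : E L) l : fval (x + y) l = fval x l + fval y l.
Proof. by rewrite -[x]scale1r fvalP !scale1r. Qed.

Lemma fvalZ L a (x : E L) l : fval (a *: x) l = a *: fval x l.
Proof. by rewrite -[a *: x]addr0 fvalP fval0 addr0. Qed.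

Lemma fvalN L (x : E L) l : fval (- x) l = - fval x l.
Proof. by rewrite -scaleN1r fvalZ scaleN1r. Qed.

Lemma fvalB L (x y : E L) l : fval (x - y) l = fval x l - fval y l.
Proof. by rewrite fvalD fvalN. Qed.

Lemma fle_rnorm L (x : E L) : fle E (rnorm x) (fval x).
Proof. by apply/fnormP => //; exact: rnorm_ge0. Qed.

Lemma fval_coord L (x : E L) l : rnorm (fval x l) <= rnorm x.
Proof. by apply: fle_coord (fle_rnorm x); exact: rnorm_ge0. Qed.

Lemma fle0 L s : 0 <= s -> fle E s (fun _ : L => 0).
Proof.
move=> s0; rewrite (_ : (fun=> 0) = fval (0 : E L)); last first.
  by apply/funext => l; rewrite fval0.
by apply/fnormP; rewrite // rnorm0.
Qed.

Lemma fval_inj L (x y : E L) : fval x =1 fval y -> x = y.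
Proof.
move=> xy; apply/eqP; rewrite -subr_eq0; apply/eqP/rnorm_eq0/eqP.
rewrite eq_le rnorm_ge0 andbT; apply/(fnormP _ (lexx 0)).
rewrite (_ : fval _ = fun=> 0); first exact: fle0.
by apply/funext => l; rewrite fvalB xy subrr.
Qed.

Lemma fop_ex (V : normedModType K) L (c : R) (phi : V -> L -> Y) : 0 <= c ->
  (forall a x y l, phi (a *: x + y) l = a *: phi x l + phi y l) ->
  (forall x, fle E (c * rnorm x) (phi x)) ->
  exists T : {linear V -> E L}, (forall x, fval (T x) = phi x) /\ op_le c T.
Proof.
move=> c0 phil phic; have c_ge0 (x : V) : 0 <= c * rnorm x by rewrite mulr_ge0 ?rnorm_ge0.
have /choice[T TP] : forall x, exists z : E L, fval z = phi x.
  by move=> x; exact: fle_ex (phic x).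
have [|T' TE] := @linear_ex _ _ V (E L) T.
  by move=> a x y; apply: fval_inj => l; rewrite fvalP !TP phil.
exists T'; split => x; first by rewrite TE TP.
by apply/fnormP => //; rewrite TE TP; exact: phic.
Qed.

(** [u] points backwards: it says from which coordinate, if any, the new coordinate is read. Thus
    one operator, [relabel], covers cut-offs, embeddings, restrictions, shifts and bijections. *)
Definition pinj (L L' : Type) (u : L' -> option L) :=
  forall a b l, u a = Some l -> u b = Some l -> a = b.

(** Apply [fle_block] with blocks indexed by [option L]: each block [Some l] has one old and at most
    one new coordinate, and the block [None] receives only zeros. *)
Lemma fle_relabel L L' (u : L' -> option L) (y : L -> Y) s : pinj u -> 0 <= s ->
  fle E s y -> fle E s (fun l' => if u l' is Some l then y l else 0).
Proof.
move=> uI s0 ys; rewrite -[s]mul1r.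
apply: (fle_block (b := Some) (b' := u) (y := y)) => // -[l|] t t0 yt; last first.
  rewrite mul1r (_ : restr _ _ _ = fun=> 0); first exact: fle0.
  by apply/funext => l'; rewrite /restr; case: (u l').
have [[l' ul']|nu] := pselect (exists l', u l' = Some l); last first.
  rewrite mul1r (_ : restr _ _ _ = fun=> 0); first exact: fle0.
  by apply/funext => l'; rewrite /restr; case: eqP => // ul'; case: nu; exists l'.
pose z l'' := if u l'' is Some l then y l else 0.
rewrite mul1r (_ : restr _ _ _ = restr id l' z); last first.
  apply/funext => l''; rewrite /restr /z; case: eqP => [ul''|nul''].
    by rewrite (uI _ _ _ ul'' ul') eqxx.
  by case: eqP => // l''E; case: nul''; rewrite l''E.
apply: fle_mono (fle_single E z l'); first exact: rnorm_ge0.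
by have := fle_coord l t0 yt; rewrite /restr eqxx /z ul'.
Qed.

Lemma relabel_ex L L' (u : L' -> option L) : pinj u ->
  exists T : {linear E L -> E L'},
    (forall x l', fval (T x) l' = if u l' is Some l then fval x l else 0) /\ op_le 1 T.
Proof.
move=> uI; have [||T [TE T1]] := @fop_ex (E L) L' 1
    (fun x l' => if u l' is Some l then fval x l else 0) ler01.
- by move=> a x y l'; case: (u l') => [l|]; rewrite ?fvalP// scaler0 addr0.
- by move=> x; rewrite mul1r; apply: fle_relabel => //; [exact: rnorm_ge0|exact: fle_rnorm].
by exists T; split=> // x l'; rewrite TE.
Qed.

Definition relabel L L' (u : L' -> option L) (uI : pinj u) : {linear E L -> E L'} :=
  sval (cid (relabel_ex uI)).

Lemma relabelE L L' (u : L' -> option L) (uI : pinj u) x l' :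
  fval (relabel uI x) l' = if u l' is Some l then fval x l else 0.
Proof. by rewrite /relabel; case: cid => T [] /= ->. Qed.

Lemma relabel_le L L' (u : L' -> option L) (uI : pinj u) : op_le 1 (relabel uI).
Proof. by rewrite /relabel; case: cid => T []. Qed.

Lemma single_ex L l : exists T : {linear Y -> E L},
  (forall v l', fval (T v) l' = if l' == l then v else 0) /\ op_le 1 T.
Proof.
have [||T [TE T1]] := @fop_ex Y L 1 (fun v l' => if l' == l then v else 0) ler01.
- by move=> a x y l'; case: eqP => // _; rewrite scaler0 addr0.
- move=> x; rewrite mul1r; exact: (fle_single E (fun=> x) l).
by exists T; split=> // v l'; rewrite TE.
Qed.

Definition single L (l : L) : {linear Y -> E L} := sval (cid (single_ex l)).

Lemma singleE L (l : L) v l' : fval (single l v) l' = if l' == l then v else 0.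
Proof. by rewrite /single; case: cid => T [] /= ->. Qed.

Lemma single_le L (l : L) : op_le 1 (single l).
Proof. by rewrite /single; case: cid => T []. Qed.

Lemma cutoff_pinj L (A : pred L) : pinj (fun l => if A l then Some l else None).
Proof. by move=> a b l; case: ifP => // _ [->]; case: ifP => // _ []. Qed.

Definition cutoff L (A : pred L) : {linear E L -> E L} := relabel (cutoff_pinj (A := A)).

Lemma cutoffE L (A : pred L) x l : fval (cutoff A x) l = if A l then fval x l else 0.
Proof. by rewrite relabelE; case: (A l). Qed.

Lemma cutoff_approx L (x : E L) e : 0 < e ->
  exists A : {fset L}, rnorm (x - cutoff (fun l => l \in A) x) <= e.
Proof.
move=> e0; have [A Ae] := fle_approx (rnorm_ge0 x) e0 (fle_rnorm x).
exists A; apply/(fnormP _ (ltW e0)); rewrite (_ : fval _ = fun l => if l \in A then 0 else fval x l)//.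
apply/funext => l; rewrite fvalB cutoffE /=.
by case: ifP; rewrite ?subrr ?subr0.
Qed.

End FamilySpace.
Arguments single {R k Y} E {L} l.
Arguments cutoff {R k Y E L} A.

(** * Columns of operators, slices and diagonal operators *)

Section Vanish.
Variables (R : realType) (k : scalar_kind).
Local Notation K := (scalar_field R k).
Variables (Y : normedModType K) (E : family_space Y).
Implicit Types L M I : choiceType.

Lemma rnorm_small (V : normedModType K) (c : R) (v : V) : 0 <= c ->
  (forall e, 0 < e -> rnorm v <= c * e) -> v = 0.
Proof.
move=> c0 vc; apply: rnorm_eq0; apply/eqP; rewrite eq_le rnorm_ge0 andbT.
apply/ler_addgt0Pr => e e0; rewrite add0r.
have c1 : 0 < c + 1 by rewrite ltr_wpDl.
rewrite (le_trans (vc _ (divr_gt0 e0 c1)))// mulrA ler_pdivrMr// mulrC.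
by rewrite ler_wpM2l ?lerDl// ltW.
Qed.

(* the support of the column of T at l *)
Definition entry L L' (T : E L -> E L') (l : L) : set L' :=
  [set m | exists v, fval (T (single E l v)) m != 0].

(** Finitely supported families are dense and the coordinate [m] of [T x] is continuous in [x], so
    it suffices to add up finitely many columns. *)
Lemma vanish L L' (T : {linear E L -> E L'}) c (x : E L) m : 0 <= c ->
  op_le c T -> (forall l, fval x l != 0 -> ~ entry T l m) -> fval (T x) m = 0.
Proof.
move=> c0 cT Tx.
have Tcut (s : seq L) : fval (T (cutoff (fun l => l \in s) x)) m = 0.
  elim: s => [|l s IH].
    rewrite (_ : cutoff _ x = 0) ?linear0 ?fval0//.
    by apply: fval_inj => l; rewrite cutoffE fval0.
  have [ls|ls] := boolP (l \in s).
    rewrite (_ : cutoff _ x = cutoff (fun l => l \in s) x)//.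
    apply: fval_inj => l'; rewrite !cutoffE inE; case: eqP => // ->.
    by rewrite ls.
  rewrite (_ : cutoff _ x = single E l (fval x l) + cutoff (fun l => l \in s) x).
    rewrite linearD fvalD IH addr0.
    have [->|xl] := eqVneq (fval x l) 0; first by rewrite !linear0 fval0.
    have := Tx _ xl; rewrite /entry/= => /forallNP/(_ (fval x l))/negP.
    by rewrite negbK => /eqP.
  apply: fval_inj => l'; rewrite fvalD !cutoffE singleE inE; case: eqP => [->|_] /=.
    by rewrite (negbTE ls) addr0.
  by rewrite add0r.
apply: (rnorm_small c0) => e e0; have [A Ae] := cutoff_approx x e0.
rewrite -[fval (T x) m]subr0 -(Tcut A) -fvalB -linearB.
rewrite (le_trans (fval_coord _ _))// (le_trans (cT _))//.
exact: ler_wpM2l.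
Qed.

Lemma countable_support L (x : E L) : countable [set l | fval x l != 0].
Proof.
have /choice[A AP] : forall n : nat, exists A : {fset L},
    rnorm (x - cutoff (fun l => l \in A) x) <= n.+1%:R^-1.
  by move=> n; apply: cutoff_approx; rewrite invr_gt0.
apply: (@card_le_trans _ _ _ (\bigcup_n [set` A n])); last first.
  by apply: bigcup_countable => // n _; exact: countable_fset.
apply: subset_card_le => l /= xl; apply: contrapT => nA.
move/eqP: xl; apply; apply: (rnorm_small ler01) => e e0; rewrite mul1r.
have [n ne] : exists n : nat, n.+1%:R^-1 <= e.
  exists (Num.truncn e^-1); rewrite invf_ple ?posrE// ltW//.
  exact: Num.Theory.truncnS_gt.
apply: le_trans ne; apply: le_trans (AP n); rewrite -[fval x l]subr0.
have -> : 0 = fval (cutoff (fun l => l \in A n) x) l.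
  rewrite cutoffE; case: ifPn => // lA; case: nA; exists n => //.
by rewrite -fvalB; exact: fval_coord.
Qed.

Lemma slice_pinj I M (i : I) : pinj (fun m : M => Some (i, m)).
Proof. by move=> a b l <- [->]. Qed.

Lemma slot_pinj I M (i : I) :
  pinj (fun p : I * M => if p.1 == i then Some p.2 else None).
Proof.
move=> [a a'] [b b'] l /=.
by case: eqP => // -> [->]; case: eqP => // -> [->].
Qed.

Definition slice I M (i : I) : {linear E (I * M)%type -> E M} :=
  relabel E (slice_pinj (i := i)).

Definition slot I M (i : I) : {linear E M -> E (I * M)%type} :=
  relabel E (slot_pinj (i := i)).

Lemma sliceE I M (i : I) x (m : M) : fval (slice M i x) m = fval x (i, m).
Proof. by rewrite relabelE. Qed.

Lemma slotE I M (i : I) (x : E M) p :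
  fval (slot M i x) p = if p.1 == i then fval x p.2 else 0.
Proof. by rewrite relabelE; case: eqP. Qed.

Lemma slice_slot I M (i j : I) (x : E M) :
  slice M i (slot M j x) = if i == j then x else 0.
Proof.
apply: fval_inj => m; rewrite sliceE slotE /=; case: eqP => // _.
by rewrite fval0.
Qed.

Lemma slice_inj I M (x y : E (I * M)%type) :
  (forall i, slice M i x = slice M i y) -> x = y.
Proof. by move=> xy; apply: fval_inj => -[i m]; rewrite -!sliceE xy. Qed.

(** The slices are the blocks of the partition by the first index, so [fle_block] bounds the
    diagonal operator by the common bound of its entries, however many there are. *)
Lemma diag_ex I M M' (c : R) (T : I -> {linear E M -> E M'}) : 0 <= c ->
  (forall i, op_le c (T i)) ->
  exists D : {linear E (I * M)%type -> E (I * M')%type},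
    (forall i x, slice M' i (D x) = T i (slice M i x)) /\ op_le c D.
Proof.
move=> c0 cT.
have [||D [DE cD]] := @fop_ex _ _ _ E (E (I * M)%type) (I * M')%type c
    (fun x p => fval (T p.1 (slice M p.1 x)) p.2) c0.
- by move=> a x y p; rewrite !linearP fvalP.
- move=> x; have x0 := rnorm_ge0 x.
  apply: (fle_block (b := fst) (b' := fst) (y := fval x)) => // [i t t0 xt|]; last first.
    exact: fle_rnorm.
  have xi : rnorm (slot M i (slice M i x)) <= t.
    apply/fnormP => //; rewrite (_ : fval _ = restr fst i (fval x))//.
    apply/funext => -[j m]; rewrite slotE /restr/=.
    by case: eqP => // ->; rewrite sliceE.
  have Txi : rnorm (T i (slice M i x)) <= c * t.
    rewrite (le_trans (cT _ _))// ler_wpM2l// (le_trans _ xi)//.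
    have := relabel_le (slice_pinj (i := i)) (slot M i (slice M i x)).
    by rewrite mul1r -/(slice M i) slice_slot eqxx.
  rewrite (_ : restr _ _ _ = fval (slot M' i (T i (slice M i x)))).
    apply/fnormP; first exact: mulr_ge0.
    by rewrite (le_trans (relabel_le _ _))// mul1r.
  by apply/funext => -[j m]; rewrite slotE /restr/=; case: eqP => // ->.
exists D; split => // i x; apply: fval_inj => m.
by rewrite sliceE DE.
Qed.

End Vanish.

(* Z is a countable sum of copies of X with first slot j0, first slice s0 and
   shifts F and G, and Q is q on each copy. Since P X is B X + q X and Z is the sum
   of the copies of q X + (1 - q) X, T absorbs the summand q X by shifting the
   copies of q X by one place. *)
Lemma pelczynski_algebra (K : pzRingType) (X Z : lmodType K)
    (P q A B : {linear X -> X}) (J j0 : {linear X -> Z}) (J' s0 : {linear Z -> X})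
    (Q F G : {linear Z -> Z}) :
  (forall z, J (J' z) = z) -> (forall x, J' (J x) = x) ->
  (forall x, s0 (j0 x) = x) -> (forall z, s0 (F z) = 0) ->
  (forall z, G (F z) = z) -> (forall x, G (j0 x) = 0) ->
  (forall z, j0 (s0 z) + F (G z) = z) ->
  (forall z, Q (F z) = F (Q z)) -> (forall z, Q (G z) = G (Q z)) ->
  (forall x, Q (j0 x) = j0 (q x)) -> (forall z, s0 (Q z) = q (s0 z)) ->
  (forall z, Q (Q z) = Q z) -> (forall x, q (q x) = q x) ->
  (forall x, A (B x) = x) -> (forall x, q (B x) = 0) -> (forall x, A (q x) = 0) ->
  (forall x, B (A x) + q x = P x) ->
  let T x := J' (j0 (q x) + F (Q (J (A x))) + (J (A x) - Q (J (A x)))) in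
  let S x := B (J' (Q (G (J x)) + (J x - Q (J x)))) + q (s0 (J x)) in
  (forall x, T (S x) = x) /\ (forall x, S (T x) = P x).
Proof.
move=> JJ' J'J sj sF GF Gj jsFG QF QG Qj sQ QQ qq AB qB Aq BAq T S.
split=> x.
  have -> : T (S x) = J' (j0 (q (s0 (J x))) + F (Q (Q (G (J x)) + (J x - Q (J x)))) +
      (Q (G (J x)) + (J x - Q (J x)) - Q (Q (G (J x)) + (J x - Q (J x))))).
    by rewrite /T /S !(linearD q) !(linearD A) qB add0r qq AB Aq addr0 JJ'.
  have -> : Q (Q (G (J x)) + (J x - Q (J x))) = Q (G (J x)).
    by rewrite linearD linearB !QQ subrr addr0.
  rewrite [X in _ + X](_ : _ = J x - Q (J x)); last by rewrite addrAC subrr add0r.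
  by rewrite -sQ QG jsFG addrC subrK.
rewrite -BAq; congr (_ + _).
  rewrite /T /S JJ'; set u := J (A x).
  have QE : Q (j0 (q x) + F (Q u) + (u - Q u)) = j0 (q x) + F (Q u).
    by rewrite !linearD linearN Qj qq QF !QQ subrr addr0.
  have -> : Q (G (j0 (q x) + F (Q u) + (u - Q u))) = Q u.
    by rewrite QG QE linearD Gj GF add0r.
  rewrite QE [X in Q u + X](_ : _ = u - Q u); last by rewrite addrAC subrr add0r.
  by rewrite addrC subrK J'J.
rewrite /T JJ' -sQ; set u := J (A x).
have -> : Q (j0 (q x) + F (Q u) + (u - Q u)) = j0 (q x) + F (Q u).
  by rewrite !linearD linearN Qj qq QF !QQ subrr addr0.
by rewrite linearD sj sF addr0.
Qed.

(** * The Pelczynski decomposition method with constants *)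

Section Pelczynski.
Variables (R : realType) (k : scalar_kind).
Local Notation K := (scalar_field R k).
Variables (Y : normedModType K) (E : family_space Y).

(* Murray-von Neumann style equivalence of the idempotent P with the identity of
   F: for a projection P it says that P E is isomorphic to F. *)
Definition mvn (c : R) (V W : normedModType K) (P : V -> V) :=
  exists (S : {linear W -> V}) (T : {linear V -> W}),
    [/\ forall x, T (S x) = x, forall x, S (T x) = P x, op_le c S & op_le c T].

(** Here [t] bounds P and [a] bounds A and B. Then [d] bounds the complement q = P - PBAP of the
    copy inside the range of P, and [2 * d + 1] bounds the operator that shifts the copies of the
    range of q and fixes the rest. *)
Definition pelczynski_bound (a t : R) : R :=
  let d := t + (a * t) ^+ 2 in d + a * t * (2 * d + 1).

(** Through [iota] the space is isometric to a countable sum of copies of itself, and [A P B = 1]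
    makes it a complemented part of the range of [P]; [q] projects onto the remaining part. *)
Lemma pelczynski (L : choiceType) (iota : nat * L -> L) (iota' : L -> nat * L)
    (P A B : {linear E L -> E L}) (a t : R) :
  cancel iota iota' -> cancel iota' iota -> 0 <= a -> 0 <= t ->
  (forall x, P (P x) = P x) -> op_le t P ->
  (forall x, A (P (B x)) = x) -> op_le a A -> op_le a B ->
  mvn (pelczynski_bound a t) (E L) P.
Proof.
move=> iK iK' a0 t0 PP Pt APB Aa Ba.
have iI : pinj (fun p => Some (iota p)) by move=> p q l [<-] [/(can_inj iK)].
have iI' : pinj (fun l => Some (iota' l)) by move=> p q l [<-] [/(can_inj iK')].
(* [F] moves every copy up by one place and leaves slot 0 empty; [G] moves down and forgets slot
   0. *)
have fI : pinj (fun p : nat * L => if p.1 is n.+1 then Some (n, p.2) else None).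
  by move=> [[|n] l] [[|n'] l'] [m l''] //= [<- <-] [-> ->].
have gI : pinj (fun p : nat * L => Some (p.1.+1, p.2)).
  by move=> [n l] [n' l'] _ [<-] [-> ->].
pose J := relabel E iI; pose J' := relabel E iI'.
pose F := relabel E fI; pose G := relabel E gI.
(* Compressing with [P] preserves the relation [A' B' = 1] and gives [P B' = B'] and [A' P = A'],
   which makes [q] idempotent. *)
have [A' A'E] : exists A' : {linear E L -> E L}, forall x, A' x = A (P x).
  by exists (A \o P).
have [B' B'E] : exists B' : {linear E L -> E L}, forall x, B' x = P (B x).
  by exists (P \o B).
have [q qE] : exists q : {linear E L -> E L}, forall x, q x = P x - B' (A' x).
  by exists (P \- (B' \o A')).
pose d := t + (a * t) ^+ 2.
have at0 : 0 <= a * t by exact: mulr_ge0.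
have d0 : 0 <= d by rewrite addr_ge0// exprn_ge0.
have A't : op_le (a * t) A'.
  by move=> x; rewrite A'E; exact: (op_le_comp a0 Aa Pt).
have B't : op_le (a * t) B'.
  by move=> x; rewrite B'E (mulrC a t); exact: (op_le_comp t0 Pt Ba).
have qd : op_le d q.
  by move=> x; rewrite qE /d expr2; exact: (op_leB Pt (op_le_comp at0 B't A't)).
have A'B' x : A' (B' x) = x by rewrite A'E B'E PP APB.
have PB' x : P (B' x) = B' x by rewrite B'E PP.
have A'P x : A' (P x) = A' x by rewrite !A'E PP.
have qB x : q (B' x) = 0 by rewrite qE A'B' PB' subrr.
have Aq x : A' (q x) = 0 by rewrite qE linearB A'P A'B' subrr.
have qq x : q (q x) = q x.
  by rewrite [LHS]qE Aq linear0 subr0 qE linearB PP PB'.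
have [Q [QE Qd]] := diag_ex d0 (fun _ : nat => qd).
have JE x p : fval (J x) p = fval x (iota p) by rewrite relabelE.
have J'E z l : fval (J' z) l = fval z (iota' l) by rewrite relabelE.
have J1 : op_le 1 J by exact: relabel_le.
have J'1 : op_le 1 J' by exact: relabel_le.
have F1 : op_le 1 F by exact: relabel_le.
have G1 : op_le 1 G by exact: relabel_le.
have s1 : op_le 1 (slice E L 0%N : {linear E (nat * L)%type -> E L}) by exact: relabel_le.
have j1 : op_le 1 (slot E L 0%N : {linear E L -> E (nat * L)%type}) by exact: relabel_le.
have FE n z : slice E L n (F z) = if n is m.+1 then slice E L m z else 0.
  by apply: fval_inj => l; rewrite sliceE relabelE /=; case: n => [|n]; rewrite ?fval0 ?sliceE.
have GE n z : slice E L n (G z) = slice E L n.+1 z.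
  by apply: fval_inj => l; rewrite !sliceE relabelE.
have [T [S [TE SE]]] : exists (T S : {linear E L -> E L}),
    (forall x, T x = J' (slot E L 0%N (q x) + F (Q (J (A' x))) + (J (A' x) - Q (J (A' x))))) /\
    (forall x, S x = B' (J' (Q (G (J x)) + (J x - Q (J x)))) + q (slice E L 0%N (J x))).
  exists (J' \o ((slot E L 0%N \o q) \+ (F \o Q \o J \o A') \+ ((J \o A') \- (Q \o J \o A')))).
  by exists ((B' \o J' \o ((Q \o G \o J) \+ (J \- (Q \o J)))) \+ (q \o slice E L 0%N \o J)).
have [|||||||||||||||||TS ST] := @pelczynski_algebra K (E L) (E (nat * L)%type) P q A' B' J
  (slot E L 0%N) J' (slice E L 0%N) Q F G.
- by move=> z; apply: fval_inj => p; rewrite JE J'E iK.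
- by move=> x; apply: fval_inj => l; rewrite J'E JE iK'.
- by move=> x; rewrite slice_slot.
- by move=> z; rewrite FE.
- by move=> z; apply: slice_inj => n; rewrite GE FE.
- by move=> x; apply: slice_inj => n; rewrite GE slice_slot linear0.
- move=> z; apply: slice_inj => -[|n]; rewrite linearD FE slice_slot ?addr0//.
  by rewrite add0r GE.
- by move=> z; apply: slice_inj => -[|n]; rewrite QE !FE ?QE// linear0.
- by move=> z; apply: slice_inj => n; rewrite QE !GE QE.
- by move=> x; apply: slice_inj => n; rewrite QE !slice_slot; case: eqP => // _; rewrite linear0.
- by move=> z; rewrite QE.
- by move=> z; apply: slice_inj => n; rewrite !QE qq.
- by [].
- by [].
- by [].
- by [].
- by move=> x; rewrite qE addrC subrK.
have bndE : pelczynski_bound a t = d + a * t * (2 * d + 1) by [].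
exists S, T; split.
- by move=> x; rewrite TE SE TS.
- by move=> x; rewrite SE TE ST.
- move=> x; rewrite SE bndE.
  have b1 := op_leB J1 (op_le_comp d0 Qd J1).
  have b2 := op_leD (op_le_comp d0 Qd (op_le_comp ler01 G1 J1)) b1.
  have b3 := op_le_comp at0 B't (op_le_comp ler01 J'1 b2).
  have b4 := op_leD b3 (op_le_comp d0 qd (op_le_comp ler01 s1 J1)).
  apply: (op_le_mono _ b4) => {x}.
  by rewrite le_eqVlt; apply/orP; left; apply/eqP; ring.
- move=> x; rewrite TE bndE.
  have b0 := op_le_comp ler01 J1 A't.
  have b1 := op_leB b0 (op_le_comp d0 Qd b0).
  have b2 := op_leD (op_le_comp ler01 j1 qd) (op_le_comp ler01 F1 (op_le_comp d0 Qd b0)).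
  have b3 := op_le_comp ler01 J'1 (op_leD b2 b1).
  apply: (op_le_mono _ b3) => {x}.
  by rewrite le_eqVlt; apply/orP; left; apply/eqP; ring.
Qed.
End Pelczynski.

Lemma mvn_ext (R : realType) (k : scalar_kind) (V W : normedModType (scalar_field R k))
  (c : R) (P Q : V -> V) : P =1 Q -> mvn c W P -> mvn c W Q.
Proof.
by move=> PQ [S [T [TS ST Sc Tc]]]; exists S, T; split => // x; rewrite ST PQ.
Qed.

(** Loops do no harm to a block system. This covers the complement of a projection, whose entries
    differ only on the diagonal. *)
Lemma block_system_refl (T : Type) (r r' : T -> set T) e :
  (forall x y, r' x y -> x = y \/ r x y) -> block_system r e -> block_system r' e.
Proof.
move=> rr' [eI eA eC]; split => // [g n g' n' gg' /rr'[|]|g n n' m /rr'[<-|gm]].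
- by move/eI => -[]/gg'.
- exact: eA.
- by exists n.
- by move/rr' => [->|]; [exists n'|exact: eC gm].
Qed.

(** * Compression of a projection to its blocks *)

Section Blocks.
Variables (R : realType) (k : scalar_kind).
Local Notation K := (scalar_field R k).
Variables (Y : normedModType K) (E : family_space Y).
Variables (L : choiceType) (e : L * nat -> L) (eI : injective e).

Let einv_ex : exists u : L -> option (L * nat),
  (forall p, u (e p) = Some p) /\ forall l p, u l = Some p -> e p = l.
Proof.
have /choice[u uP] : forall l, exists o : option (L * nat), forall p, e p = l <-> o = Some p.
  move=> l; have [[p pl]|nl] := pselect (exists p, e p = l).
    exists (Some p) => p'; rewrite -pl; split=> [/eI->//|[->]//].
  by exists None => p; split => // pl; case: nl; exists p.
by exists u; split=> [p|l p /uP//]; apply/uP.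
Qed.

Let einv := sval (cid einv_ex).

Let eK p : einv (e p) = Some p.
Proof. by rewrite /einv; case: cid => u [] /= ->. Qed.

Let einvK l p : einv l = Some p -> e p = l.
Proof. by rewrite /einv; case: cid => u [] /= _; apply. Qed.

Let embed_pinj : pinj einv.
Proof. by move=> a b p /einvK <- /einvK <-. Qed.

Let retract_pinj : pinj (fun p => Some (e p)).
Proof. by move=> p q l [<-] [/eI]. Qed.

Definition embed_blocks : {linear E (L * nat)%type -> E L} := relabel E embed_pinj.

Definition retract_blocks : {linear E L -> E (L * nat)%type} := relabel E retract_pinj.

Local Notation U := embed_blocks.
Local Notation V := retract_blocks.

Lemma retractE x p : fval (V x) p = fval x (e p).
Proof. by rewrite relabelE. Qed.

Lemma embedE x p : fval (U x) (e p) = fval x p.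
Proof. by rewrite relabelE eK. Qed.

Lemma embed_out x l : fval (U x) l != 0 -> exists p, l = e p.
Proof.
rewrite relabelE; case el: (einv l) => [p|]; last by rewrite eqxx.
by move=> _; exists p; rewrite (einvK el).
Qed.

Lemma embed_slot g x n : fval (U (slot E nat g x)) (e (g, n)) = fval x n.
Proof. by rewrite embedE slotE eqxx. Qed.

Lemma embed_slot_out g x l : (forall n, l <> e (g, n)) ->
  fval (U (slot E nat g x)) l = 0.
Proof.
move=> lg; apply/eqP; apply: contrapT => /negP /[dup] /embed_out[[g' n] lE].
by rewrite lE embedE slotE /=; case: (g' =P g) => [g'g|]; [case: (lg n); rewrite lE g'g|rewrite eqxx].
Qed.

Lemma embedK x : V (U x) = x.
Proof. by apply: fval_inj => p; rewrite retractE embedE. Qed.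

Definition block (P : {linear E L -> E L}) (g : L) : {linear E nat -> E nat} :=
  slice E nat g \o V \o P \o U \o slot E nat g.

Lemma blockE (P : {linear E L -> E L}) g x : block P g x = slice E nat g (V (P (U (slot E nat g x)))).
Proof. by []. Qed.

Lemma block_le (P : {linear E L -> E L}) t g : 0 <= t -> op_le t P -> op_le t (block P g).
Proof.
move=> t0 Pt.
have U1 : op_le 1 U by exact: relabel_le.
have V1 : op_le 1 V by exact: relabel_le.
have s1 : op_le 1 (slice E nat g) by exact: relabel_le.
have j1 : op_le 1 (slot E nat g) by exact: relabel_le.
have := op_le_comp ler01 s1 (op_le_comp ler01 V1 (op_le_comp t0 Pt (op_le_comp ler01 U1 j1))).
by rewrite !mulr1 !mul1r.
Qed.

Lemma block_compl (P P' : {linear E L -> E L}) g x : (forall y, P' y = y - P y) ->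
  block P' g x = x - block P g x.
Proof. by move=> PP'; rewrite !blockE PP' !linearB embedK slice_slot eqxx. Qed.

Variables (P : {linear E L -> E L}) (t : R).
Hypotheses (t0 : 0 <= t) (Pt : op_le t P) (PP : forall x, P (P x) = P x).
Hypothesis eP : block_system (entry P) e.

Lemma slice_block g x :
  slice E nat g (V (P (U x))) = block P g (slice E nat g x).
Proof.
have [_ eA _] := eP.
apply/eqP; rewrite -subr_eq0 blockE -!linearB; apply/eqP.
apply: fval_inj => n; rewrite sliceE retractE fval0.
apply: (vanish t0 Pt) => l xl; have [[g' n'] lE] := embed_out xl.
move: xl; rewrite lE embedE fvalB slotE /=; case: (g' =P g) => [->|g'g _].
  by rewrite sliceE subrr eqxx.
exact: eA.
Qed.

(** Write [z = P z] for the image of a vector of block [g]. The part of [z] off the block sits at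
    points reached from it, and by the third condition of [block_system] these have no entry back
    into it. *)
Lemma block_idem g x : block P g (block P g x) = block P g x.
Proof.
have [_ eA eC] := eP.
rewrite [in RHS]blockE -PP; set z := P (U (slot E nat g x)).
apply/eqP; rewrite eq_sym -subr_eq0 !blockE -/z -!linearB; apply/eqP.
apply: fval_inj => n; rewrite sliceE retractE fval0.
apply: (vanish t0 Pt) => l zl lg.
have nlg i : l <> e (g, i).
  by move=> lE; move: zl; rewrite lE fvalB embedE slotE /= eqxx sliceE retractE subrr eqxx.
have zl' : fval z l != 0.
  apply: contra_neq zl => zl; rewrite fvalB zl sub0r; apply/eqP; rewrite oppr_eq0.
  apply: contrapT => /negP /[dup] /embed_out[[g' i] lE].
  rewrite lE embedE slotE /=; case: (g' =P g) => [g'g|]; last by rewrite eqxx.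
  by move: (nlg i); rewrite lE g'g.
move/eqP: zl'; apply; apply: (vanish t0 Pt) => l' xl' l'l.
have [[g' i] l'E] := embed_out xl'.
move: xl'; rewrite l'E embedE slotE /=; case: (g' =P g) => [g'g _|]; last by rewrite eqxx.
have [j lE] : exists j, l = e (g, j) by apply: (eC g i n) => //; rewrite -g'g -l'E.
exact: nlg lE.
Qed.

(** The factorizations of all blocks have the same constant, so they form diagonal operators over
    [L]; [iota] identifies the sum of these copies of [E nat] with [E L]. *)
Lemma block_factor (c : R) (iota : L * nat -> L) (iota' : L -> L * nat) :
  cancel iota iota' -> cancel iota' iota -> 0 <= c ->
  (forall g, mvn c (E nat) (block P g)) ->
  exists A B : {linear E L -> E L},
    [/\ forall x, A (P (B x)) = x, op_le c A & op_le c B].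
Proof.
move=> iK iK' c0 bc.
have iI : pinj (fun p => Some (iota p)) by move=> p q l [<-] [/(can_inj iK)].
have iI' : pinj (fun l => Some (iota' l)) by move=> p q l [<-] [/(can_inj iK')].
pose J := relabel E iI; pose J' := relabel E iI'.
have JK x : J' (J x) = x by apply: fval_inj => l; rewrite !relabelE iK'.
have [S /choice[T ST]] := choice bc.
have Sc g : op_le c (S g) by have [] := ST g.
have Tc g : op_le c (T g) by have [] := ST g.
have [DS [DSE DSc]] := diag_ex c0 Sc.
have [DT [DTE DTc]] := diag_ex c0 Tc.
exists (J' \o DT \o V), (U \o DS \o J); split.
- move=> x /=; rewrite -[RHS]JK; congr (J' _); apply: slice_inj => g.
  rewrite DTE slice_block DSE.
  by have [TS STE _ _] := ST g; rewrite -STE !TS.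
- have J'1 : op_le 1 J' by exact: relabel_le.
  have V1 : op_le 1 V by exact: relabel_le.
  by have := op_le_comp ler01 J'1 (op_le_comp c0 DTc V1); rewrite mulr1 mul1r.
- have J1 : op_le 1 J by exact: relabel_le.
  have U1 : op_le 1 U by exact: relabel_le.
  by have := op_le_comp ler01 U1 (op_le_comp c0 DSc J1); rewrite mulr1 mul1r.
Qed.

End Blocks.

Section Dichotomy.
Variables (R : realType) (k : scalar_kind).
Local Notation K := (scalar_field R k).
Variables (Y : normedModType K) (E : family_space Y).
Variables (L : choiceType).
Hypothesis L_uncountable : ~ countable [set: L].

Lemma bij_nat : exists (iota : L * nat -> L) (iota' : L -> L * nat),
  cancel iota iota' /\ cancel iota' iota.
Proof.
have infL := infinite_uncountable L_uncountable.
have [l0 _] := infinite_setN0 infL.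
have : ([set: L * nat] #= [set: L])%card.
  rewrite card_eq_le; apply/andP; split; first by rewrite -setXTT; exact: card_setX_nat.
  by apply: (@card_le_inj _ _ _ _ (fun l => (l, 0%N))) => // l l' _ _ [].
move=> /(card_bij_ex l0)[u]; rewrite setTT_bijective => -[u' uK u'K].
by exists u, u'.
Qed.

Lemma mvn_dichotomy (P P' : {linear E L -> E L}) (t c : R) (e : L * nat -> L)
    (eI : injective e) :
  0 <= t -> op_le t P -> (forall x, P (P x) = P x) -> (forall x, P' x = x - P x) ->
  block_system (entry P) e -> 0 <= c ->
  ([set: L] #<= [set g | mvn c (E nat) (block eI P g) \/ mvn c (E nat) (block eI P' g)])%card ->
  mvn (pelczynski_bound c (1 + t)) (E L) P \/ mvn (pelczynski_bound c (1 + t)) (E L) P'.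
Proof.
move=> t0 Pt PP P'E eP c0 dich.
have infL := infinite_uncountable L_uncountable.
have [l0 _] := infinite_setN0 infL.
have [i [i' [iK iK']]] := bij_nat.
pose i2 (p : nat * L) := i (p.2, p.1).
pose i2' l := let: (a, b) := i' l in (b, a).
have i2K : cancel i2 i2' by move=> [a b]; rewrite /i2/i2' iK.
have i2K' : cancel i2' i2 by move=> l; rewrite /i2/i2' -[RHS]iK'; case: (i' l).
have t1 : 0 <= 1 + t by rewrite addr_ge0.
have Pt1 : op_le (1 + t) P by apply: (op_le_mono _ Pt); rewrite lerDr.
have P't : op_le (1 + t) P'.
  by move=> x; rewrite P'E; exact: (op_leB (@op_le_id _ _ _) Pt).
have P'P' x : P' (P' x) = P' x by rewrite !P'E linearB PP subrr subr0.
have eP' : block_system (entry P') e.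
  apply: block_system_refl eP => l m [v]; rewrite P'E fvalB singleE.
  case: (m =P l) => [->|_]; first by left.
  by rewrite sub0r oppr_eq0 => Pv; right; exists v.
(* Reindexing along [h] keeps only good blocks. The blocks themselves do not change: the embedding
   of one slice only depends on the points of its block. *)
have main (Q : {linear E L -> E L}) : op_le (1 + t) Q -> (forall x, Q (Q x) = Q x) ->
    block_system (entry Q) e ->
    ([set: L] #<= [set g | mvn c (E nat) (block eI Q g)])%card ->
    mvn (pelczynski_bound c (1 + t)) (E L) Q.
  move=> Qt QQ eQ /(card_le_ex l0)[h [hc hI]].
  have {}hI : injective h by move=> a b; exact: hI.
  have eh := block_system_sub hI eQ; have [ehI _ _] := eh.
  have [|A [B [AQB Ac Bc]]] := @block_factor _ _ _ E L _ ehI Q _ t1 Qt eh c i i' iK iK' c0.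
    move=> g; apply: mvn_ext (hc g I) => x.
    apply: fval_inj => n; rewrite !blockE !sliceE !retractE /=.
    congr (fval (Q _) _); apply: fval_inj => l.
    have [[m ->]|nl] := pselect (exists m, l = e (h g, m)).
      by rewrite embed_slot -[e _]/((fun p => e (h p.1, p.2)) (g, m)) embed_slot.
    have lg m : l <> e (h g, m) by move=> lm; apply: nl; exists m.
    by rewrite !embed_slot_out.
  by apply: (@pelczynski _ _ _ E L i2 i2' Q A B).
have [h [hP hI]] := card_le_ex l0 dich.
have sub (Q : {linear E L -> E L}) :
    ([set: L] #<= [set g | mvn c (E nat) (block eI Q (h g))])%card ->
    ([set: L] #<= [set g | mvn c (E nat) (block eI Q g)])%card.
  move=> /card_le_trans; apply; apply: (@card_le_inj _ _ _ _ h) => // g g' _ _.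
  exact: hI.
have [|AL|AL] := @card_le_setU L [set g | mvn c (E nat) (block eI P (h g))]
  [set g | mvn c (E nat) (block eI P' (h g))] infL.
- by apply/seteqP; split=> // g _; exact: hP.
- by left; apply: main => //; exact: sub.
- by right; apply: main => //; exact: sub.
Qed.

End Dichotomy.

(** * Operator norms and transfer of primariness *)

Section OperatorNorm.
Variables (R : realType) (k : scalar_kind).
Local Notation K := (scalar_field R k).
Implicit Types V W : normedModType K.

Lemma bounded_op_le V W (T : {linear V -> W}) :
  bounded_near T (nbhs (0 : V)) <-> exists2 c, 0 <= c & op_le c T.
Proof.
split=> [/linear_boundedP/pinfty_ex_gt0[r r0 Tr]|[c c0 cT]].
  have rE := scalar_reK (ltW r0); exists (scalar_re r).
    by rewrite -(of_real_le k) of_real0 rE ltW.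
  by move=> x; rewrite -(of_real_le k) of_realM !rnormE rE.
apply/ex_bound; exists (of_real k c); apply/nbhs_norm0P; exists 1 => //= x /= x1.
rewrite -rnormE of_real_le (le_trans (cT x))// ler_piMr//.
rewrite -(of_real_le k) rnormE (le_trans (ltW x1))//.
by rewrite /of_real /scalar_field; case: k.
Qed.

Lemma continuous_op_le V W (T : {linear V -> W}) :
  continuous T <-> exists2 c, 0 <= c & op_le c T.
Proof. by rewrite -bounded_op_le; apply: iff_sym; exact: linear_bounded_continuous. Qed.

Lemma opnorm_le V W (T : {linear V -> W}) c : 0 <= c -> op_le c T -> opnorm T <= c.
Proof.
move=> c0 cT; apply: ge_sup.
  by exists (rnorm (T 0)), 0 => //=; rewrite rnorm0 ler01.
by move=> _ [x /= x1 <-]; rewrite (le_trans (cT x))// ler_piMr.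
Qed.

Lemma op_le_opnorm V W (T : {linear V -> W}) c : 0 <= c -> op_le c T ->
  op_le (opnorm T) T.
Proof.
move=> c0 cT x; have [->|x0] := eqVneq x 0.
  by rewrite linear0 !rnorm0 mulr0.
have xp := rnorm_gt0 x0.
have aE : rabs (of_real k (rnorm x)^-1) = (rnorm x)^-1.
  by rewrite rabs_of_real// invr_ge0 ltW.
rewrite -ler_pdivrMr// mulrC -aE -rnormZ -linearZ.
apply: ub_le_sup; last first.
  by exists (of_real k (rnorm x)^-1 *: x) => //=; rewrite rnormZ aE mulVf// gt_eqF.
by exists c => _ [z /= z1 <-]; rewrite (le_trans (cT z))// ler_piMr.
Qed.

Lemma opnorm_ge0 V W (T : {linear V -> W}) : continuous T -> 0 <= opnorm T.
Proof.
move=> /continuous_op_le[c c0 cT]; rewrite (le_trans (rnorm_ge0 (T 0)))//.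
apply: ub_le_sup; last by exists 0; rewrite //= rnorm0 ler01.
by exists c => _ [z /= z1 <-]; rewrite (le_trans (cT z))// ler_piMr.
Qed.

Lemma mvn_mono V W (P : V -> V) c d : c <= d -> mvn c W P -> mvn d W P.
Proof.
by move=> cd [S [T [TS ST Sc Tc]]]; exists S, T; split => //; exact: op_le_mono cd _.
Qed.

Lemma mvn_id V (P : V -> V) c : 1 <= c -> (forall x, P x = x) -> mvn c V P.
Proof.
move=> c1 PE; apply: (mvn_mono c1); exists idfun, idfun; split => //.
- exact: op_le_id.
- exact: op_le_id.
Qed.

Lemma corestrict_ex V (P : {linear V -> V}) :
  exists T : {linear V -> range_space P}, forall x, range_val (T x) = P x.
Proof.
have rP x : P x \in range_pred P by apply/mem_set; exists x.
have [|T TE] := @linear_ex _ _ V (range_space P) (fun x => RangeSpace (rP x)).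
  by move=> a x y; apply: val_inj; rewrite /= linearP.
by exists T => x; rewrite TE.
Qed.

Lemma inclusion_ex V (P : {linear V -> V}) :
  exists T : {linear range_space P -> V}, forall x, T x = range_val x.
Proof. by apply: linear_ex. Qed.

Lemma rnorm_range V (P : {linear V -> V}) (x : range_space P) :
  rnorm x = rnorm (range_val x).
Proof. by []. Qed.

Lemma range_fix V (P : {linear V -> V}) (x : range_space P) :
  (forall x, P (P x) = P x) -> P (range_val x) = range_val x.
Proof.
move=> PP; have /set_mem[y _ <-] := range_valP x.
exact: PP.
Qed.

Lemma mvn_isomorphic V W (P : {linear V -> V}) c : 0 <= c ->
  (forall x, P (P x) = P x) -> mvn c W P ->
  isomorphic_within (c * c) (range_space P) W.
Proof.
move=> c0 PP [S [T [TS ST Sc Tc]]].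
have [rP rPE] := corestrict_ex P; have [inc incE] := inclusion_ex P.
have Tc' : op_le c (T \o inc) by move=> x /=; rewrite incE.
have Sc' : op_le c (rP \o S).
  by move=> x; rewrite rnorm_range /= rPE -ST TS.
have Tcont : continuous (T \o inc) by apply/continuous_op_le; exists c.
have Scont : continuous (rP \o S) by apply/continuous_op_le; exists c.
exists (T \o inc), (rP \o S); split => //.
- by move=> x; apply: val_inj; rewrite /= rPE incE ST !range_fix.
- by move=> x; rewrite /= incE rPE -ST !TS.
- by apply: ler_pM; rewrite ?opnorm_ge0// opnorm_le.
Qed.

(** The hypothesis bounds only the product of the two norms. Rescaling by the norm of [S] makes one
    map of norm at most 1 and the other of norm at most [C * t]. *)
Lemma isomorphic_mvn V W (P : {linear V -> V}) C t : 0 <= t -> op_le t P ->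
  (forall x, P (P x) = P x) -> isomorphic_within C (range_space P) W ->
  mvn (1 + C * t) W P.
Proof.
move=> t0 Pt PP [T [S [ST TS Tcont Scont TSC]]].
have [rP rPE] := corestrict_ex P; have [inc incE] := inclusion_ex P.
have a0 := opnorm_ge0 Tcont; have b0 := opnorm_ge0 Scont.
have /continuous_op_le[c c0 cT] := Tcont; have /continuous_op_le[d d0 dS] := Scont.
have {c c0 cT}Ta := op_le_opnorm c0 cT; have {d d0 dS}Sb := op_le_opnorm d0 dS.
have C0 : 0 <= C by rewrite (le_trans _ TSC)// mulr_ge0.
have c1 : 1 <= 1 + C * t by rewrite lerDl mulr_ge0.
have rPt : op_le t rP by move=> x; rewrite rnorm_range rPE.
(* If [S] is zero then [W] is trivial; this case is treated apart because the norm of [S] is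
   inverted below. *)
have [bz|bz] := eqVneq (opnorm S) 0.
  have Sz w : S w = 0.
    by apply: rnorm_eq0; apply/eqP; rewrite eq_le rnorm_ge0 andbT (le_trans (Sb w))// bz mul0r.
  have Wz (w : W) : w = 0 by rewrite -(TS w) Sz linear0.
  exists (inc \o S), (T \o rP); split.
  - by move=> x; rewrite [LHS]Wz [RHS]Wz.
  - by move=> x; rewrite /= ST incE rPE.
  - move=> x; rewrite /= Sz linear0 rnorm0 mulr_ge0 ?rnorm_ge0//.
    exact: le_trans c1.
  - move=> x; set w := (X in rnorm X <= _); rewrite (Wz w) rnorm0 mulr_ge0 ?rnorm_ge0//.
    exact: le_trans c1.
have bp : 0 < opnorm S by rewrite lt_neqAle eq_sym bz.
set b := opnorm S in bp bz TSC Sb b0; set a := opnorm T in a0 Ta TSC.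
have ofK (s : R) : s != 0 -> of_real k s * of_real k s^-1 = 1.
  move=> s0; rewrite -of_realM divff//.
  by rewrite /of_real /scalar_field; case: (k).
exists (of_real k b^-1 \*: (inc \o S)), (of_real k b \*: (T \o rP)); split.
- move=> x /=; rewrite linearZ /= linearZ /= scalerA ofK// scale1r.
  have -> : rP (inc (S x)) = S x by apply: val_inj; rewrite /= rPE incE range_fix.
  exact: TS.
- move=> x /=; rewrite linearZ /= linearZ /= scalerA mulrC ofK// scale1r.
  by rewrite ST incE rPE.
- move=> x /=; rewrite rnormZ rabs_of_real ?invr_ge0// incE -rnorm_range.
  rewrite ler_pdivrMl// (le_trans (Sb x))// ler_wpM2l//.
  by rewrite ler_peMl ?rnorm_ge0.
- move=> x /=; rewrite rnormZ rabs_of_real//.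
  rewrite (le_trans (ler_wpM2l b0 (op_le_comp a0 Ta rPt x)))// !mulrA.
  rewrite ler_wpM2r ?rnorm_ge0// (mulrC b) (le_trans (ler_wpM2r t0 TSC))//.
  by rewrite lerDr.
Qed.

End OperatorNorm.

(** * From the countable model to the uncountable sum *)

Section Transfer.
Variables (R : realType) (k : scalar_kind).
Local Notation K := (scalar_field R k).
Variables (Y : normedModType K) (E : family_space Y).
Variables (L : choiceType).
Hypothesis L_uncountable : ~ countable [set: L].
Hypothesis blocks : forall (P : {linear E L -> E L}) t, 0 <= t -> op_le t P ->
  (forall x, P (P x) = P x) -> exists e, block_system (entry P) e.

Lemma pelczynski_bound_ge1 (a t : R) : 0 <= a -> 1 <= t -> 1 <= pelczynski_bound a t.
Proof.
move=> a0 t1; rewrite /pelczynski_bound.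
have t0 : 0 <= t by rewrite (le_trans _ t1).
have d1 : 1 <= t + (a * t) ^+ 2 by rewrite (le_trans t1)// lerDl exprn_ge0// mulr_ge0.
rewrite (le_trans d1)// lerDl mulr_ge0 ?mulr_ge0//.
by rewrite addr_ge0// mulr_ge0// (le_trans _ d1).
Qed.

Lemma pelczynski_bound_mono (a a' t t' : R) : 0 <= a -> a <= a' -> 0 <= t -> t <= t' ->
  pelczynski_bound a t <= pelczynski_bound a' t'.
Proof.
move=> a0 aa' t0 tt'; rewrite /pelczynski_bound.
have at0 : 0 <= a * t by exact: mulr_ge0.
have atat' : a * t <= a' * t' by exact: ler_pM.
have dd' : t + (a * t) ^+ 2 <= t' + (a' * t') ^+ 2.
  by rewrite lerD// lerXn2r// nnegrE// (le_trans at0).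
have d0 : 0 <= t + (a * t) ^+ 2 by rewrite addr_ge0// exprn_ge0.
by rewrite lerD// ler_pM// ?addr_ge0 ?mulr_ge0// lerD// ler_wpM2l.
Qed.

Lemma projection_dichotomy (P : {linear E L -> E L}) t c (e : L * nat -> L)
    (eI : injective e) :
  0 <= t -> op_le t P -> (forall x, P (P x) = P x) ->
  block_system (entry P) e -> 0 <= c ->
  ([set: L] #<= [set g | mvn c (E nat) (block eI P g) \/
     mvn c (E nat) (idfun \- block eI P g)])%card ->
  let b := pelczynski_bound c (1 + t) in
  isomorphic_within (b * b) (range_space P) (E L) \/
  isomorphic_within (b * b) (range_space (idfun \- P)) (E L).
Proof.
move=> t0 Pt PP eP c0 dich b.
have b0 : 0 <= b by rewrite (le_trans ler01)// pelczynski_bound_ge1// lerDl.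
have P'E x : (idfun \- P) x = x - P x by [].
have [|Pb|Pb] := @mvn_dichotomy _ _ _ E L L_uncountable P (idfun \- P) t c e eI t0 Pt PP P'E eP c0.
- apply: card_le_trans dich _; apply: subset_card_le => g [|] bc; [by left|right].
  by apply: mvn_ext bc => x; rewrite (block_compl eI g _ P'E).
- by left; apply: mvn_isomorphic.
- right; apply: mvn_isomorphic => // x.
  by rewrite /= linearB PP subrr subr0.
Qed.

Lemma transfer_uniformly_primary :
  uniformly_primary (E nat) -> uniformly_primary (E L).
Proof.
move=> [C [C1 Cmono CE]].
(* [c s] serves for a block, of norm at most [s], and for its complement, of norm at most [1 + s].
   [b s] is the resulting decomposition constant; it is squared below since an isomorphism constant
   is a product of two norms. *)
pose c s := 1 + C s * (1 + s).
pose b s := pelczynski_bound (c s) (1 + s).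
have s0 (s : R) : 1 <= s -> 0 <= s by apply: le_trans.
have C0 s : 1 <= s -> 0 <= C s by move=> /C1; apply: le_trans.
have c1 s : 1 <= s -> 1 <= c s.
  by move=> s1; rewrite /c lerDl mulr_ge0 ?C0// addr_ge0 ?s0.
have c0 s : 1 <= s -> 0 <= c s by move=> /c1; apply: le_trans.
have b1 s : 1 <= s -> 1 <= b s.
  by move=> s1; rewrite /b pelczynski_bound_ge1 ?c0// lerDl s0.
have b0 s : 1 <= s -> 0 <= b s by move=> /b1; apply: le_trans.
exists (fun s => b s * b s); split.
- by move=> s s1; rewrite mulr_ege1 ?b1.
- move=> s s' s1 ss'; have s'1 := le_trans s1 ss'.
  have bb : b s <= b s'.
    apply: pelczynski_bound_mono; rewrite ?c0 ?addr_ge0 ?s0// ?lerD2l//.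
    by rewrite ler_pM ?C0 ?addr_ge0 ?s0 ?lerD2l// Cmono.
  by rewrite ler_pM ?b0.
move=> P [/bounded_op_le[t t0 Pt] PP] [x Px].
have Ps := op_le_opnorm t0 Pt; set s := opnorm P in Ps *.
have s1 : 1 <= s.
  by rewrite -(ler_pM2r (rnorm_gt0 Px)) mul1r -[in leLHS]PP.
have [e eP] := blocks (s0 _ s1) Ps PP; have [eI _ _] := eP.
apply: (@projection_dichotomy P _ _ e eI (s0 _ s1) Ps PP eP (c0 _ s1)).
apply: subset_card_le => g _ /=; set M := block eI P g.
have Ms : op_le s M := block_le eI g (s0 _ s1) Ps.
have MM z : M (M z) = M z := block_idem eI (s0 _ s1) Ps PP eP g z.
(* [primary_within] says nothing about the zero projection; the complement of a zero block is the
   identity. *)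
have [[z Mz]|M0] := pselect (exists z, M z != 0); last first.
  right; apply: mvn_id; first exact: c1.
  move=> z; rewrite [LHS](_ : _ = z - M z)//.
  have [->|Mz] := eqVneq (M z) 0; first by rewrite subr0.
  by case: M0; exists z.
have os : opnorm M <= s by apply: opnorm_le => //; exact: s0.
have o1 : 1 <= opnorm M.
  rewrite -(ler_pM2r (rnorm_gt0 Mz)) mul1r -[in leLHS]MM.
  exact: (op_le_opnorm (s0 _ s1) Ms).
have bM : bounded_projection M by split => //; apply/bounded_op_le; exists s => //; exact: s0.
have s10 : 0 <= 1 + s by rewrite addr_ge0// s0.
have cle u : 0 <= u -> u <= 1 + s -> 1 + C (opnorm M) * u <= c s.
  by move=> u0 us; rewrite /c lerD2l ler_pM ?C0 ?Cmono.
have [iM|iM] := CE M bM (ex_intro _ z Mz); [left|right].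
  apply: (mvn_mono (cle s _ _)); rewrite ?s0// ?lerDr//.
  by apply: isomorphic_mvn => //; exact: s0.
apply: (mvn_mono (cle (1 + s) s10 (lexx _))).
apply: isomorphic_mvn => //; first exact: (op_leB (@op_le_id _ _ _) Ms).
by move=> y; rewrite [LHS](_ : _ = (y - M y) - M (y - M y))// linearB MM subrr subr0.
Qed.

Lemma transfer_primary : primary (E nat) -> cof_gt_omega L -> primary (E L).
Proof.
move=> prE cofL P [/bounded_op_le[t t0 Pt] PP].
have [e eP] := blocks t0 Pt PP; have [eI _ _] := eP.
(* Integer constants turn the lack of a uniform bound into a countable cover of [L]. *)
pose good (n : nat) g := mvn n%:R (E nat) (block eI P g) \/
  mvn n%:R (E nat) (idfun \- block eI P g).
have goodE g : exists n, good n g.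
  set M := block eI P g.
  have Mt : op_le t M := block_le eI g t0 Pt.
  have MM z : M (M z) = M z := block_idem eI t0 Pt PP eP g z.
  have bM : bounded_projection M by split => //; apply/bounded_op_le; exists t.
  have ex (Q : {linear E nat -> E nat}) s : 0 <= s -> op_le s Q -> (forall z, Q (Q z) = Q z) ->
      isomorphic (range_space Q) (E nat) -> exists n : nat, mvn n%:R (E nat) Q.
    move=> s0 Qs QQ [T [S [ST TS Tc Sc]]].
    have iQ : isomorphic_within (opnorm T * opnorm S) (range_space Q) (E nat).
      by exists T, S; split.
    have Qm := isomorphic_mvn s0 Qs QQ iQ.
    exists (Num.truncn (1 + opnorm T * opnorm S * s)).+1; apply: mvn_mono Qm.
    exact/ltW/Num.Theory.truncnS_gt.
  have [iM|iM] := prE M bM.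
    by have [n nM] := ex M t t0 Mt MM iM; exists n; left.
  have [||n nM] := ex (idfun \- M) (1 + t) _ (op_leB (@op_le_id _ _ _) Mt) _ iM.
  - by rewrite addr_ge0.
  - by move=> y; rewrite [LHS](_ : _ = (y - M y) - M (y - M y))// linearB MM subrr subr0.
  - by exists n; right.
have [n nL] := cof_gt_omega_bigcup L_uncountable cofL goodE.
have [|] := @projection_dichotomy P _ _ e eI t0 Pt PP eP (ler0n R n) nL.
  by move=> [T [S [? ? ? ? _]]]; left; exists T, S.
by move=> [T [S [? ? ? ? _]]]; right; exists T, S.
Qed.

End Transfer.

(** * Countable rows and columns *)

Section Countability.
Variables (R : realType) (k : scalar_kind).
Local Notation K := (scalar_field R k).

Lemma rnorm_sum (V : normedModType K) (I : Type) (r : seq I) (P : pred I) (f : I -> V) :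
  rnorm (\sum_(i <- r | P i) f i) <= \sum_(i <- r | P i) rnorm (f i).
Proof.
elim/big_rec2 : _ => [|i y x _ xy]; first by rewrite rnorm0.
by rewrite (le_trans (rnormD _ _))// lerD2l.
Qed.

Lemma rnormMn (V : normedModType K) (v : V) n : rnorm (v *+ n) = rnorm v *+ n.
Proof.
apply: (@of_real_inj R k); rewrite rnormE normrMn -rnormE.
by elim: n => [|n IH]; rewrite ?of_real0// !mulrS of_realD IH.
Qed.

Lemma dense_rnorm (V : normedModType K) (D : set V) (v : V) (e : R) :
  dense D -> 0 < e -> exists2 d, D d & rnorm (v - d) < e.
Proof.
move=> dD e0; have ball_v : nbhs v (ball v (of_real k e)).
  by apply: nbhsx_ballx; rewrite of_real_gt0.
have [d [vd Dd]] : (ball v (of_real k e))° `&` D !=set0.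
  by apply: dD; [exists v|exact: open_interior].
by exists d => //; apply/ball_rnorm; exact: interior_subset vd.
Qed.

Lemma inv_nat_lt (e : R) : 0 < e -> exists n : nat, n.+1%:R^-1 < e.
Proof.
move=> e0; exists (Num.truncn e^-1); rewrite invf_plt ?posrE//.
exact: Num.Theory.truncnS_gt.
Qed.

Variables (Y : normedModType K) (E : family_space Y).

(** A coordinate that is nonzero on some vector of the column is nonzero on a vector of the dense
    set nearby, and each of these countably many vectors has an image with countable support. *)
Lemma entry_countable (L L' : choiceType) (T : {linear E L -> E L'}) c (l : L) :
  separable_space Y -> 0 <= c -> op_le c T -> countable (entry T l).
Proof.
move=> [D [cD dD]] c0 Tc.
apply: card_le_trans (bigcup_countable cD (fun d _ => countable_support (T (single E l d)))).
apply: subset_card_le => m [v]; set w := fval _ m => w0.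
have c1 : 0 < c + 1 by rewrite ltr_wpDl.
have [d Dd vd] := dense_rnorm v dD (divr_gt0 (rnorm_gt0 w0) c1).
exists d => //=; apply/negP => /eqP dm.
have : rnorm w <= c * rnorm (v - d).
  rewrite -[w]subr0 -dm -fvalB -linearB -linearB.
  rewrite (le_trans (fval_coord _ _))// (le_trans (Tc _))// ler_wpM2l//.
  by have := single_le E l (v - d); rewrite mul1r.
apply/negP; rewrite -ltNge (le_lt_trans (ler_wpM2l c0 (ltW vd)))//.
by rewrite mulrA ltr_pdivrMr// mulrC ltr_pM2l ?rnorm_gt0// ltrDl.
Qed.

(** A sum of [n] disjoint vectors of norm at most 1 has norm o(n), uniformly. This holds for p > 1
    and for c_0 and fails for p = 1 when [Y] is nonzero; it separates the two cases of the
    theorem. *)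
Definition sublinear_growth := forall (L : choiceType) (e : R), 0 < e ->
  exists2 N, (0 < N)%N & forall (A : {fset L}) (y : L -> Y), (N <= #|` A|)%N ->
    (forall l, rnorm (y l) <= (l \in A)%:R) -> fle E (e * #|` A|%:R) y.

(** If a row were uncountable, then by separability infinitely many of its entries would take values
    near one [d] different from 0 on vectors of norm at most 1. A sum of [q] such vectors has norm
    o(q), but its image has a coordinate close to [q] times [d]. *)
Lemma coentry_countable (L L' : choiceType) (T : {linear E L -> E L'}) c (m : L') :
  sublinear_growth -> separable_space Y -> 0 <= c -> op_le c T ->
  countable [set l | entry T l m].
Proof.
move=> growth [D [cD dD]] c0 Tc.
pose theta l v := fval (T (single E l v)) m.
(* The factor 3 exceeds the two errors of size [n.+1%:R^-1] per vector: one from replacing the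
   values by [d], one from the bound on the image. *)
pose Delta n d : set L := [set l | exists v, [/\ rnorm v <= 1,
  rnorm (theta l v - d) < n.+1%:R^-1 & 3 * n.+1%:R^-1 <= rnorm d]].
suff finDelta n d : finite_set (Delta n d).
  have cDelta n : countable (\bigcup_(d in D) Delta n d).
    by apply: bigcup_countable => // d _; exact: finite_set_countable.
  apply: card_le_trans (bigcup_countable (countableP [set: nat]) (fun n _ => cDelta n)).
  apply: subset_card_le => l [v lv].
  have v0 : v != 0 by apply: contraNneq lv => ->; rewrite !linear0 fval0.
  have nv0 := rnorm_gt0 v0.
  pose a := of_real k (rnorm v)^-1.
  have aE : rabs a = (rnorm v)^-1 by rewrite rabs_of_real// invr_ge0 ltW.
  have w0 : 0 < rnorm (theta l (a *: v)).
    rewrite /theta !linearZ fvalZ rnormZ aE mulr_gt0 ?invr_gt0//.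
    exact: rnorm_gt0.
  (* Less than a quarter of the norm of the value, so that after the approximation [d] still has
     norm at least three times [n.+1%:R^-1]. *)
  have [n nw] := inv_nat_lt (divr_gt0 w0 (ltr0Sn R 3)).
  have n0 : 0 < n.+1%:R^-1 :> R by rewrite invr_gt0.
  have [d Dd wd] := dense_rnorm (theta l (a *: v)) dD n0.
  exists n => //; exists d => //; exists (a *: v); split => //.
    by rewrite rnormZ aE mulVf// gt_eqF.
  have : rnorm (theta l (a *: v)) <= rnorm d + rnorm (theta l (a *: v) - d).
    by rewrite -[in leLHS](subrKC d (theta l (a *: v))) rnormD.
  move: nw wd; rewrite ltr_pdivlMr//.
  move: (rnorm (theta _ _ - d)) (rnorm (theta _ _)) (rnorm d) => u1 u2 u3.
  set i := _^-1; lra.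
set eta : R := n.+1%:R^-1.
have eta0 : 0 < eta by rewrite invr_gt0.
apply: contrapT => infDelta.
have c1 : 0 < c + 1 by rewrite ltr_wpDl.
have [N N0 growthN] := growth L (eta / (c + 1)) (divr_gt0 eta0 c1).
have [A AD NA] := infinite_set_fset N infDelta.
have /choice[v vP] : forall l, exists v, l \in A -> [/\ rnorm v <= 1,
    rnorm (theta l v - d) < eta & 3 * eta <= rnorm d].
  move=> l; have [lA|lA] := boolP (l \in A); last by exists 0.
  by have [v vP] := AD l lA; exists v.
pose x := \sum_(l <- A) single E l (v l).
have fvals (s : seq L) l : uniq s ->
    fval (\sum_(l <- s) single E l (v l)) l = if l \in s then v l else 0.
  elim: s => [|l' s IH] /=; first by rewrite big_nil fval0.
  move=> /andP[l's us]; rewrite big_cons fvalD singleE IH// inE.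
  by case: eqP => [->|_] /=; rewrite ?(negbTE l's) ?addr0// add0r.
set q : R := #|` A|%:R.
have q0 : 0 < q by rewrite ltr0n (leq_trans N0).
have xle : rnorm x <= eta / (c + 1) * q.
  apply/fnormP; first by rewrite mulr_ge0 ?divr_ge0 ?ltW.
  apply: growthN => // l; rewrite fvals//; case: ifPn => [/vP[]//|_].
  by rewrite rnorm0.
have thx : fval (T x) m = \sum_(l <- A) theta l (v l).
  rewrite /x linear_sum; elim: (enum_fset A) => [|l s IH].
    by rewrite !big_nil fval0.
  by rewrite !big_cons fvalD IH.
have small : rnorm (fval (T x) m - d *+ #|` A|) <= eta * q.
  rewrite thx (_ : d *+ #|` A| = \sum_(l <- A) d); last first.
    by rewrite big_const_seq count_predT iter_addr_0.
  rewrite -sumrB (le_trans (rnorm_sum _ _ _))//.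
  rewrite (_ : eta * q = \sum_(l <- A) eta); last first.
    by rewrite big_const_seq count_predT iter_addr_0 mulr_natr.
  by rewrite big_seq [leRHS]big_seq ler_sum// => l /vP[_ /ltW].
have large : 3 * eta * q <= rnorm (d *+ #|` A|).
  rewrite rnormMn -[leRHS]mulr_natr ler_wpM2r ?(ltW q0)//.
  have /fset0Pn[l /vP[]//] : A != fset0.
  by rewrite -cardfs_gt0 (leq_trans N0).
have Tx : rnorm (fval (T x) m) <= eta * q.
  rewrite (le_trans (fval_coord _ _))// (le_trans (Tc _))//.
  rewrite (le_trans (ler_wpM2l c0 xle))// mulrA ler_wpM2r ?(ltW q0)//.
  by rewrite mulrA ler_pdivrMr// mulrC ler_wpM2l ?(ltW eta0)// lerDl.
have : rnorm (d *+ #|` A|) <= rnorm (fval (T x) m) + rnorm (fval (T x) m - d *+ #|` A|).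
  rewrite -[in leLHS](subKr (fval (T x) m) (d *+ #|` A|)).
  by rewrite (le_trans (rnormD _ _))// rnormN.
have : 0 < eta * q by exact: mulr_gt0.
move: small large Tx; rewrite -!mulrA; set z := eta * q; lra.
Qed.

Lemma separable_blocks (L : choiceType) (P : {linear E L -> E L}) c :
  ~ countable [set: L] -> sublinear_growth -> separable_space Y ->
  0 <= c -> op_le c P -> exists e, block_system (entry P) e.
Proof.
move=> cL growth sepY c0 Pc.
have [||e eP] := @block_system_sym L (fun l => entry P l `|` [set m | entry P m l]) cL.
- move=> l; rewrite -bigcup2E; apply: bigcup_countable => [|[|[|i]] _ /=].
  + exact: countableP.
  + exact: entry_countable c0 Pc.
  + exact: coentry_countable c0 Pc.
  + exact: countable0.
- by move=> l m [|]; [right|left].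
- by exists e; apply: block_system_refl eP => l m lm; right; left.
Qed.

End Countability.

(** * The families of l_p and c_0 sums *)

Lemma sum_off (R : numDomainType) (L : choiceType) (A B : {fset L}) (f : L -> R) :
  \sum_(i <- (A `|` B)%fset) f i = \sum_(i <- A) f i + \sum_(i <- B | i \notin A) f i.
Proof.
rewrite (bigID (mem A))/=; congr (_ + _).
  rewrite -big_filter; apply: perm_big; apply: uniq_perm; rewrite ?filter_uniq//.
  by move=> i; rewrite mem_filter inE; case: (i \in A).
rewrite -big_filter -[RHS]big_filter; apply: perm_big; apply: uniq_perm; rewrite ?filter_uniq//.
by move=> i; rewrite !mem_filter inE; case: (i \in A).
Qed.

Section LpFamily.
Variables (R : realType) (k : scalar_kind).
Local Notation K := (scalar_field R k).
Variables (p : R) (p1 : 1 <= p) (Y : completeNormedModType K).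

Let p0 : 0 < p. Proof. exact: lt_le_trans p1. Qed.

Let pN0 : p != 0. Proof. by rewrite gt_eqF. Qed.

Let powK (s : R) : 0 <= s -> (s `^ p^-1) `^ p = s.
Proof. by move=> s0; rewrite -powRrM mulVf// powRr1. Qed.

Let pow_le (s t : R) : 0 <= s -> s <= t -> s `^ p <= t `^ p.
Proof.
move=> s0 st; have t0 := le_trans s0 st.
by apply: ge0_ler_powR => //; exact: ltW.
Qed.

Lemma lp_le_single (L : choiceType) (y : L -> Y) l :
  lp_le p (rnorm (y l)) (restr id l y).
Proof.
move=> A; rewrite /restr.
have zero i : i != l -> (rnorm (if i == l then y i else 0)) `^ p = 0.
  by move=> /negbTE->; rewrite rnorm0 powR0.
have [lA|lA] := boolP (l \in A).
  rewrite (big_fsetD1 l)//= eqxx big_seq big1 ?addr0// => i.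
  by rewrite !inE => /andP[/zero].
rewrite big_seq big1 ?powR_ge0// => i iA; apply: zero.
by apply: contraNneq lA => <-.
Qed.

(** Take [A] whose sum comes within [e] to the power [p] of the supremum of all finite sums; a
    finite sum off [A] cannot exceed that gap. *)
Lemma lp_le_approx (L : choiceType) (y : L -> Y) s e : 0 <= s -> 0 < e ->
  lp_le p s y -> exists A : {fset L}, lp_le p e (fun l => if l \in A then 0 else y l).
Proof.
move=> s0 e0 ys.
pose S : set R := [set \sum_(i <- A) rnorm (y i) `^ p | A in [set: {fset L}]].
have S_ub : has_ubound S by exists (s `^ p) => _ [A _ <-]; exact: ys.
have S_ne : S !=set0 by exists (\sum_(i <- fset0) rnorm (y i) `^ p), fset0.
have ep0 : 0 < e `^ p by exact: powR_gt0.
have [_ [A _ <-] Ae] := sup_adherent ep0 (conj S_ne S_ub).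
exists A => B.
have : \sum_(i <- (A `|` B)%fset) rnorm (y i) `^ p <= sup S.
  by apply: ub_le_sup; [exact: S_ub|exists (A `|` B)%fset].
rewrite sum_off => AB.
apply: (@le_trans _ _ (\sum_(i <- B | i \notin A) rnorm (y i) `^ p)).
  rewrite [leRHS]big_mkcond/=; apply: ler_sum => i _.
  by case: (i \in A) => //=; rewrite rnorm0 powR0.
rewrite -(lerD2l (\sum_(i <- A) rnorm (y i) `^ p)) (le_trans AB)//.
by rewrite -lerBlDr ltW.
Qed.

(** A finite sum for [z] is grouped by the values of [b']. Each group is controlled by the norm
    [t i] of the matching block of [y], and the [p]-th powers of these norms add up to at most that
    of [y]. *)
Lemma lp_le_block (L L' I : choiceType) (b : L -> I) (b' : L' -> I)
    (y : L -> Y) (z : L' -> Y) c s : 0 <= c -> 0 <= s ->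
  (forall i t, 0 <= t -> lp_le p t (restr b i y) -> lp_le p (c * t) (restr b' i z)) ->
  lp_le p s y -> lp_le p (c * s) z.
Proof.
move=> c0 s0 yz ys A.
have yi_le i : lp_le p s (restr b i y).
  move=> B; apply: le_trans (ys B); apply: ler_sum => l _.
  by rewrite /restr; case: ifP => // _; rewrite rnorm0 powR0// powR_ge0.
pose t i := lp_norm p (restr b i y).
have yi_pred i : restr b i y \in lp_pred p (L:=L) (Y:=Y).
  by have /(lp_normP p1 _ s0)[] := yi_le i.
have ti i : lp_le p (t i) (restr b i y) by exact: lp_norm_le.
have t_ge0 i : 0 <= t i by exact: powR_ge0.
have tE i : ((t i `^ p)%:E = lp_esum p (restr b i y))%E.
  have fin : lp_esum p (restr b i y) \is a fin_num.
    by rewrite ge0_fin_numE ?lp_esum_ge0//; exact: yi_pred.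
  by rewrite /t /lp_norm powK ?fineK// fine_ge0// lp_esum_ge0.
rewrite (partition_big_imfset _ b')/=.
set B := [fset b' x | x in A]%fset.
apply: (@le_trans _ _ (\sum_(i <- B) (c * t i) `^ p)).
  apply: ler_sum => i _; have := yz i _ (t_ge0 i) (ti i).
  move=> /(_ A); apply: le_trans; rewrite big_mkcond/=; apply: ler_sum => l _.
  by rewrite /restr; case: eqP => //; rewrite rnorm0 powR0.
under eq_bigr => i _ do rewrite powRM//.
rewrite -mulr_sumr powRM// ler_wpM2l ?powR_ge0//.
rewrite -lee_fin -sumEFin; under eq_bigr => i _ do rewrite tE.
rewrite /lp_esum -(@esum_sum _ _ _ _ _ xpredT (fun l i => (rnorm (restr b i y l) `^ p)%:E)); last first.
  by move=> l i _ _; rewrite lee_fin powR_ge0.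
apply: (@le_trans _ _ (lp_esum p y)).
  apply: le_esum => l _; rewrite sumEFin lee_fin.
  have zero i : i != b l -> rnorm (restr b i y l) `^ p = 0.
    by rewrite /restr eq_sym => /negbTE->; rewrite rnorm0 powR0.
  have [blB|blB] := boolP (b l \in B).
    rewrite (big_fsetD1 (b l))//= /restr eqxx big_seq big1 ?addr0// => i.
    by rewrite !inE => /andP[/zero].
  rewrite big_seq big1 ?powR_ge0// => i iB; apply: zero.
  by apply: contraNneq blB => <-.
exact/lp_esum_le.
Qed.

Lemma lp_fnormP (L : choiceType) (x : lp p1 L Y) s : 0 <= s ->
  rnorm x <= s <-> lp_le p s (lp_val x).
Proof.
move=> s0; rewrite rnorm_lp lp_normP//; split=> [|[]//].
by split => //; exact: lp_valP.
Qed.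

Lemma lp_fle_ex (L : choiceType) (y : L -> Y) s : 0 <= s -> lp_le p s y ->
  exists x : lp p1 L Y, lp_val x = y.
Proof. by move=> s0 /(lp_normP p1 _ s0)[yp _]; exists (Lp p1 yp). Qed.

Definition lp_family : family_space Y := @FamilySpace R k Y
  (fun L => lp p1 L Y) (fun L x => lp_val x) (fun L s y => lp_le p s y)
  (fun L a x y l => erefl) lp_fnormP lp_fle_ex
  (fun L y s t => @lp_le_mono R k p p1 L Y s t y)
  (fun L y s l => @lp_le_coord R k p p1 L Y s y l)
  lp_le_single lp_le_block lp_le_approx.

Lemma lp_sublinear_growth : 1 < p -> sublinear_growth lp_family.
Proof.
move=> p_gt1 L e e0; have q0 : 0 < p - 1 by rewrite subr_gt0.
(* The sum of [p]-th powers is at most [n], and [n] is at most [(e * n) ^ p] as soon as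
   [n ^ (p - 1)] is at least [e ^ (- p)]; [a] is this threshold. *)
pose a := (e `^ p)^-1 `^ (p - 1)^-1.
have ep0 : 0 < e `^ p by exact: powR_gt0.
exists (Num.truncn a).+1 => // A y NA yA B.
set n : R := #|` A|%:R.
have an : a <= n.
  by rewrite (le_trans (ltW (Num.Theory.truncnS_gt _)))// ler_nat.
have n0 : 0 < n by rewrite ltr0n (leq_trans _ NA).
apply: (@le_trans _ _ n).
  rewrite (bigID (mem A))/= [X in _ + X]big1 ?addr0; last first.
    move=> i iA; have := yA i; rewrite (negbTE iA) => yi0.
    have -> : rnorm (y i) = 0 by apply/eqP; rewrite eq_le yi0 rnorm_ge0.
    by rewrite powR0.
  apply: (@le_trans _ _ (\sum_(i <- B | i \in A) 1)).
    apply: ler_sum => i iA; have := yA i; rewrite iA => yi1.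
    have p1E : 1 = 1 `^ p :> R by rewrite powR1.
    by rewrite [leRHS]p1E pow_le ?rnorm_ge0.
  rewrite -big_filter big_const_seq count_predT iter_addr_0 ler_nat.
  apply: uniq_leq_size; first by rewrite filter_uniq.
  by move=> i; rewrite mem_filter => /andP[].
rewrite powRM ?(ltW e0) ?(ltW n0)// -(mulr_powRB1 (ltW n0) p0) mulrCA.
apply: ler_peMr; rewrite ?(ltW n0)// -ler_pdivrMl// mulr1.
have -> : (e `^ p)^-1 = a `^ (p - 1).
  by rewrite /a -powRrM mulVf ?gt_eqF// powRr1// invr_ge0 ltW.
by apply: ge0_ler_powR; rewrite ?nnegrE ?powR_ge0 ?(ltW n0) ?(ltW q0).
Qed.

End LpFamily.

Section C0Family.
Variables (R : realType) (k : scalar_kind).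
Local Notation K := (scalar_field R k).
Variables (Y : completeNormedModType K).

Definition c0_le (L : choiceType) (s : R) (y : L -> Y) :=
  y \in c0_pred (L := L) (Y := Y) /\ forall l, rnorm (y l) <= s.

Lemma c0_le_single (L : choiceType) (y : L -> Y) l :
  c0_le (rnorm (y l)) (restr id l y).
Proof.
split=> [|i]; last first.
  by rewrite /restr; case: eqP => [->//|_]; rewrite rnorm0 rnorm_ge0.
apply/c0_predP => e e0; apply: sub_finite_set (finite_set1 l) => i /=.
by rewrite /restr; case: eqP => // _; rewrite rnorm0 leNgt e0.
Qed.

Lemma c0_le_block (L L' I : choiceType) (b : L -> I) (b' : L' -> I)
    (y : L -> Y) (z : L' -> Y) c s : 0 <= c -> 0 <= s ->
  (forall i t, 0 <= t -> c0_le t (restr b i y) -> c0_le (c * t) (restr b' i z)) ->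
  c0_le s y -> c0_le (c * s) z.
Proof.
move=> c0 s0 yz [/c0_predP yc0 ys].
have yi_c0 i : restr b i y \in c0_pred (L := L) (Y := Y).
  apply/c0_predP => e e0; apply: sub_finite_set (yc0 e e0) => l /=.
  by rewrite /restr; case: eqP => // _; rewrite rnorm0 leNgt e0.
have zi i t : 0 <= t -> (forall l, b l = i -> rnorm (y l) <= t) ->
    c0_le (c * t) (restr b' i z).
  move=> t0 yt; apply: yz => //; split => // l; rewrite /restr.
  by case: eqP => [/yt//|_]; rewrite rnorm0.
split; last first.
  move=> l; have [_ /(_ l)] := zi (b' l) s s0 (fun l _ => ys l).
  by rewrite /restr eqxx.
apply/c0_predP => e e0.
have c1 : 0 < c + 1 by rewrite ltr_wpDl.
have d0 : 0 < e / (c + 1) by exact: divr_gt0.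
(* Off these finitely many blocks [y] stays below [e / (c + 1)], hence [z] stays below [e]; inside
   each of them [z] has finitely many large coordinates. *)
pose B := b @` [set l | e / (c + 1) <= rnorm (y l)].
have finB : finite_set B by apply: finite_image; exact: yc0.
apply: (@sub_finite_set _ _ (\bigcup_(i in B) [set l | e <= rnorm (restr b' i z l)])).
  move=> l /= el; exists (b' l); last by rewrite /= /restr eqxx.
  apply: contrapT => nB.
  have yB l' : b l' = b' l -> rnorm (y l') <= e / (c + 1).
    by move=> bl'; rewrite leNgt; apply/negP => yl'; apply: nB; exists l' => //=; exact: ltW.
  have [_ /(_ l)] := zi (b' l) _ (ltW d0) yB.
  rewrite /restr eqxx => zl; move: el; apply/negP; rewrite -ltNge.
  apply: le_lt_trans zl _; rewrite mulrA ltr_pdivrMr// mulrC.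
  by rewrite ltr_pM2l// ltrDl.
apply: bigcup_finite => // i _.
have [/c0_predP/(_ e e0)//] := zi i s s0 (fun l _ => ys l).
Qed.

Lemma c0_le_approx (L : choiceType) (y : L -> Y) s e : 0 <= s -> 0 < e ->
  c0_le s y -> exists A : {fset L}, c0_le e (fun l => if l \in A then 0 else y l).
Proof.
move=> s0 e0 [/c0_predP yc0 _].
exists (fset_set [set l | e <= rnorm (y l)]); split=> [|l].
  apply/c0_predP => d d0; apply: sub_finite_set (yc0 d d0) => l /=.
  by case: ifP => // _; rewrite rnorm0 leNgt d0.
rewrite in_fset_set; last exact: yc0.
case: ifPn => [_|]; first by rewrite rnorm0 ltW.
by rewrite notin_setE /= => /negP; rewrite -ltNge => /ltW.
Qed.

Lemma c0_fnormP (L : choiceType) (x : c0 L Y) s : 0 <= s ->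
  rnorm x <= s <-> c0_le s (c0_val x).
Proof.
move=> s0; rewrite rnorm_c0; split=> [xs|[_ xs]]; last exact: c0_norm_le.
split=> [|l]; first exact: c0_valP.
by apply: le_trans xs; apply: c0_coord; exact: c0_valP.
Qed.

Lemma c0_fle_ex (L : choiceType) (y : L -> Y) s : 0 <= s -> c0_le s y ->
  exists x : c0 L Y, c0_val x = y.
Proof. by move=> s0 [yc0 _]; exists (C0 yc0). Qed.

Lemma c0_fle_mono (L : choiceType) (y : L -> Y) (s t : R) : 0 <= s -> s <= t ->
  c0_le s y -> c0_le t y.
Proof. by move=> _ st [yc0 ys]; split => // l; exact: le_trans (ys l) st. Qed.

Lemma c0_fle_coord (L : choiceType) (y : L -> Y) (s : R) l : 0 <= s -> c0_le s y ->
  rnorm (y l) <= s.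
Proof. by move=> _ []. Qed.

Definition c0_family : family_space Y := @FamilySpace R k Y
  (fun L => c0 L Y) (fun L x => c0_val x) (fun L s y => c0_le s y)
  (fun L a x y l => erefl) c0_fnormP c0_fle_ex c0_fle_mono c0_fle_coord
  c0_le_single c0_le_block c0_le_approx.

Lemma c0_sublinear_growth : sublinear_growth c0_family.
Proof.
move=> L e e0; exists (Num.truncn e^-1).+1 => // A y NA yA.
have en : 1 <= e * #|` A|%:R.
  rewrite mulrC -ler_pdivrMr// div1r.
  by rewrite (le_trans (ltW (Num.Theory.truncnS_gt _)))// ler_nat.
split=> [|l]; last first.
  by rewrite (le_trans (yA l))// (le_trans _ en)//; case: (_ \in _).
apply/c0_predP => d d0; apply: sub_finite_set (finite_fset A) => l /= dl.
by apply: contraTT dl => /negbTE lA; have := yA l; rewrite lA -ltNge => /le_lt_trans; apply.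
Qed.

End C0Family.

(** * Weakly compact sets in l_1 sums *)

Section HahnBanach.
Variables (R : realType) (k : scalar_kind).
Local Notation K := (scalar_field R k).
Local Notation rl := (@of_real R k).
Variables (V : lmodType K) (q : V -> R).

Lemma of_realN (s : R) : rl (- s) = - rl s.
Proof. by apply/eqP; rewrite -addr_eq0 -of_realD addNr of_real0. Qed.

Lemma of_real1 : rl 1 = 1.
Proof. by rewrite /of_real /scalar_field; case: (k). Qed.

(* Domination makes such a relation functional: (0, r) in G forces r = 0. *)
Definition dominated_graph (G : set (V * R)) := [/\
  forall x r y s, G (x, r) -> G (y, s) -> G (x + y, r + s),
  forall t x r, G (x, r) -> G (rl t *: x, t * r) &
  forall x r, G (x, r) -> r <= q x].

Hypotheses (qD : forall x y, q (x + y) <= q x + q y)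
  (qZ : forall t x, 0 <= t -> q (rl t *: x) = t * q x).

Let q0 : q 0 = 0.
Proof. by rewrite -(scaler0 V (rl 0)) qZ// mul0r. Qed.

(** A value at [x1] must lie above all [r - q (x - x1)] and below all [q (y + x1) - s].
    Subadditivity separates the two families, and the supremum of the first is taken. *)
Lemma dominated_graph_extend (G : set (V * R)) (x1 : V) : G !=set0 ->
  dominated_graph G -> exists c, forall x r t, G (x, r) -> r + t * c <= q (x + rl t *: x1).
Proof.
move=> [[x0 r0] Gx0] [GD GZ Gq].
pose S : set R := [set s | exists x r, G (x, r) /\ s = r - q (x - x1)].
have key x r y s : G (x, r) -> G (y, s) -> r - q (x - x1) <= q (y + x1) - s.
  move=> Gx Gy; have := Gq _ _ (GD _ _ _ _ Gx Gy).
  by have := qD (x - x1) (y + x1); rewrite addrACA addNr addr0; lra.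
have S_ne : S !=set0 by exists (r0 - q (x0 - x1)), x0, r0.
have S_ub : has_ubound S by exists (q (x0 + x1) - r0) => _ [x [r [Gx ->]]]; exact: key.
exists (sup S).
have lo x r : G (x, r) -> r - sup S <= q (x - x1).
  by move=> Gx; rewrite lerBlDr -lerBlDl; apply: ub_le_sup => //; exists x, r.
have hi x r : G (x, r) -> r + sup S <= q (x + x1).
  move=> Gx; rewrite -lerBrDl; apply: ge_sup => // _ [y [s [Gy ->]]].
  exact: key.
move=> x r t Gx; have [t0|t0|->] := ltgtP t 0; last first.
- by rewrite of_real0 scale0r mul0r !addr0; exact: Gq.
- have tE : rl t * rl t^-1 = 1 by rewrite -of_realM divff ?of_real1// gt_eqF.
  have := hi _ _ (GZ t^-1 _ _ Gx); rewrite -(ler_pM2l t0) -qZ ?(ltW t0)//.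
  by rewrite scalerDr scalerA tE scale1r mulrDr mulrA divff ?mul1r// gt_eqF.
- have nt0 : 0 < - t by rewrite oppr_gt0.
  have tE : rl (- t) * rl (- t)^-1 = 1 by rewrite -of_realM divff ?of_real1// gt_eqF.
  have := lo _ _ (GZ (- t)^-1 _ _ Gx); rewrite -(ler_pM2l nt0) -qZ ?(ltW nt0)//.
  rewrite scalerBr scalerA tE scale1r mulrBr mulrA divff ?mul1r ?gt_eqF//.
  by rewrite of_realN scaleNr opprK mulNr opprK.
Qed.

(** The functional is real linear for both scalar fields; [scalar_functional] makes it linear over
    the field. *)
Lemma hahn_banach (x0 : V) : exists g : V -> R,
  [/\ forall x y, g (x + y) = g x + g y, forall t x, g (rl t *: x) = t * g x,
      forall x, g x <= q x & g x0 = q x0].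
Proof.
have qN x : - q x <= q (- x) by have := qD x (- x); rewrite subrr q0; lra.
have qZ' t x : t * q x <= q (rl t *: x).
  have [t0|t0] := leP 0 t; first by rewrite qZ.
  rewrite -[t]opprK of_realN scaleNr mulNr -qZ ?oppr_ge0 ?(ltW t0)//.
pose P (G : set (V * R)) := G = set0 \/ dominated_graph G /\ G (x0, q x0).
have [F FP Ftot|G [PG Gmax]] := @Zorn_bigcup _ P.
  have F2 a b : (\bigcup_(X in F) X) a -> (\bigcup_(X in F) X) b ->
      exists X, [/\ F X, X a & X b].
    move=> [X FX Xa] [X' FX' X'b].
    by have [|] := Ftot _ _ FX FX' => XX'; [exists X'|exists X]; split=> //; exact: XX'.
  have [[p [X FX Xp]]|nF] := pselect ((\bigcup_(X in F) X) !=set0); last first.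
    left; rewrite -subset0 => p Fp; apply: nF; by exists p.
  have good Z p' : F Z -> Z p' -> dominated_graph Z /\ Z (x0, q x0).
    by move=> /FP[->|].
  right; split; last by exists X => //; have [] := good X p FX Xp.
  split.
  - move=> x r y s /F2/[apply] -[Z [FZ Zx Zy]]; exists Z => //.
    by have [[ZD _ _] _] := good _ _ FZ Zx; exact: ZD.
  - move=> t x r [Z FZ Zx]; exists Z => //.
    by have [[_ ZZ _] _] := good _ _ FZ Zx; exact: ZZ.
  - move=> x r [Z FZ Zx].
    by have [[_ _ Zq] _] := good _ _ FZ Zx; exact: Zq.
have [[GD GZ Gq] Gx0] : dominated_graph G /\ G (x0, q x0).
  case: PG => // G0; exfalso.
  apply: (Gmax [set p | exists t, p = (rl t *: x0, t * q x0)]).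
    split; first by rewrite G0.
    move=> /(_ (x0, q x0)); rewrite G0; apply.
    by exists 1; rewrite of_real1 scale1r mul1r.
  right; split; last by exists 1; rewrite of_real1 scale1r mul1r.
  split.
  - move=> x r y s [t [-> ->]] [u [-> ->]]; exists (t + u).
    by rewrite of_realD scalerDl mulrDl.
  - by move=> t x r [u [-> ->]]; exists (t * u); rewrite scalerA of_realM mulrA.
  - by move=> x r [t [-> ->]]; exact: qZ'.
have dG : dominated_graph G by [].
have Gtot x1 : exists r, G (x1, r).
  apply: contrapT => /forallNP nG.
  have [c cP] := dominated_graph_extend x1 (ex_intro _ _ Gx0) dG.
  have G00 : G (0, 0) by have := GZ 0 _ _ Gx0; rewrite of_real0 scale0r mul0r.
  apply: (Gmax [set p | exists x r t, G (x, r) /\ p = (x + rl t *: x1, r + t * c)]).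
    split.
      by move=> [x r] Gx; exists x, r, 0; rewrite of_real0 scale0r mul0r !addr0.
    move=> /(_ (x1, c)) h; apply: (nG c); apply: h.
    by exists 0, 0, 1; rewrite of_real1 scale1r mul1r !add0r.
  right; split; last by exists x0, (q x0), 0; rewrite of_real0 scale0r mul0r !addr0.
  split.
  - move=> x r y s [x' [r' [t [Gx [-> ->]]]]] [y' [s' [u [Gy [-> ->]]]]].
    exists (x' + y'), (r' + s'), (t + u); split; first exact: GD.
    by rewrite of_realD scalerDl mulrDl addrACA [r' + _ + _]addrACA.
  - move=> t x r [x' [r' [u [Gx [-> ->]]]]].
    exists (rl t *: x'), (t * r'), (t * u); split; first exact: GZ.
    by rewrite scalerDr scalerA of_realM mulrDr mulrA.
  - by move=> x r [x' [r' [u [Gx [-> ->]]]]]; exact: cP.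
have [g gP] := choice Gtot.
have Guniq x r s : G (x, r) -> G (x, s) -> r = s.
  move=> Gr Gs.
  have le a b : G (x, a) -> G (x, b) -> a <= b.
    move=> Ga Gb; have := Gq _ _ (GD _ _ _ _ Ga (GZ (-1) _ _ Gb)).
    by rewrite of_realN of_real1 scaleN1r subrr q0 mulN1r subr_le0.
  by apply/eqP; rewrite eq_le !le.
exists g; split.
- by move=> x y; apply: Guniq (gP _) _; exact: GD.
- by move=> t x; apply: Guniq (gP _) _; exact: GZ.
- by move=> x; exact: Gq.
- exact: Guniq (gP _) _.
Qed.

End HahnBanach.

Lemma rabs_real (R : realType) (k : scalar_kind) (s : R) : rabs (of_real k s) = `|s|.
Proof.
have [s0|s0] := leP 0 s; first by rewrite rabs_of_real// ger0_norm.
rewrite -[s in LHS]opprK of_realN.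
have -> : rabs (- of_real k (- s)) = rabs (of_real k (- s)).
  by apply: (@of_real_inj R k); rewrite !rabsE normrN.
by rewrite rabs_of_real ?ltr0_norm// oppr_ge0 ltW.
Qed.

Lemma rabsB (R : realType) (k : scalar_kind) (a b : scalar_field R k) :
  rabs (a - b) <= rabs a + rabs b.
Proof. by rewrite -(of_real_le k) of_realD !rabsE ler_normB. Qed.

(** In the complex case F x = g x - i g (i x). This is needed because the weak topology is generated
    by functionals linear over the field; only continuity matters, so the bound [c + c] may be
    crude. *)
Lemma scalar_functional (R : realType) (k : scalar_kind)
    (V : normedModType (scalar_field R k)) (g : V -> R) (c : R) : 0 <= c ->
  (forall x y, g (x + y) = g x + g y) ->
  (forall t x, g (of_real k t *: x) = t * g x) ->
  (forall x, g x <= c * rnorm x) ->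
  exists F : {linear V -> (scalar_field R k)^o},
    continuous F /\ forall x, scalar_re (F x) = g x.
Proof.
move=> c0 gD gZ gc.
have gN x : g (- x) = - g x.
  by have := gZ (-1) x; rewrite of_realN of_real1 scaleN1r mulN1r.
have gabs x : `|g x| <= c * rnorm x.
  by rewrite ler_norml gc andbT lerNl -gN -(rnormN x) gc.
suff [F [Flin FE cF]] : exists F : V -> (scalar_field R k)^o, [/\ linear F,
    forall x, scalar_re (F x) = g x & forall x, rabs (F x) <= (c + c) * rnorm x].
  have [F' F'E] := linear_ex Flin; exists F'; split=> [|x]; last by rewrite F'E.
  apply/continuous_op_le; exists (c + c); first exact: addr_ge0.
  by move=> x; rewrite F'E; exact: cF.
case: k V g gD gZ gc gN gabs => V g gD gZ gc gN gabs.
  exists g; split => [a x y|//|x]; first by rewrite gD gZ.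
  by rewrite (le_trans (gabs x))// ler_wpM2r ?rnorm_ge0// lerDl.
pose i : R[i]%C := 'i%C.
have ii : i * i = -1 by rewrite -expr2 /i sqr_i.
pose rl := @of_real R ComplexScalars.
have key (u v gx gix gy giy : R[i]%C) : u * gx + v * gix + gy - i * (u * gix - v * gx + giy) =
    (u + v * i) * (gx - i * gix) + (gy - i * giy).
  have -> : (u + v * i) * (gx - i * gix) + (gy - i * giy) =
    u * gx + v * i * gx - u * i * gix - v * (i * i) * gix + (gy - i * giy) by ring.
  by rewrite ii; ring.
exists (fun x => rl (g x) - i * rl (g (i *: x))); split.
- move=> a x y.
  have aE : a = rl (complex.Re a) + rl (complex.Im a) * i.
    by rewrite {1}(complexE a) mulrC.
  have aZ : g (a *: x) = complex.Re a * g x + complex.Im a * g (i *: x).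
    by rewrite {1}aE scalerDl gD gZ -scalerA gZ.
  have iaZ : g (i *: (a *: x)) = complex.Re a * g (i *: x) - complex.Im a * g x.
    rewrite scalerA mulrC -scalerA {1}aE scalerDl gD gZ -scalerA gZ.
    by rewrite scalerA ii scaleN1r gN mulrN.
  rewrite scalerDr !gD aZ iaZ.
  have scE (u v : R[i]%C) : (u : scalar_field R ComplexScalars) *: (v : (scalar_field R ComplexScalars)^o) = u * v by [].
  rewrite scE /rl !of_realD of_realN !of_realM -/rl.
  rewrite [in RHS]aE; exact: key.
- by move=> x; rewrite /scalar_re /rl /of_real /i /=; ring.
- move=> x; have ri : rabs (i : scalar_field R ComplexScalars) = 1.
    by rewrite /rabs /i /scalar_re normc_def /= expr0n expr1n add0r sqrtr1.
  apply: (le_trans (rabsB (rl (g x)) ((i : scalar_field R ComplexScalars) * rl (g (i *: x))))).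
  rewrite rabsM ri mul1r !rabs_real mulrDl lerD// (le_trans (gabs _))//.
  by rewrite rnormZ ri mul1r.
Qed.

Section WeakCluster.
Variables (R : realType) (k : scalar_kind).
Local Notation K := (scalar_field R k).
Variables (V : normedModType K).

Lemma scalar_re_lipschitz (a b : K) : `|scalar_re a - scalar_re b| <= rabs (a - b).
Proof.
rewrite /rabs /scalar_re; move: a b; rewrite /scalar_field; case: (k) => // a b.
rewrite -lecR; have := normc_ge_Re (a - b).
by rewrite raddfB normc_def.
Qed.

(** The point [a] is chosen before the functional [g]. The gliding hump relies on this order, since
    its functional is built with knowledge of the cluster point. *)
Lemma weakly_compact_cluster (A : set V) (u : nat -> V) :
  @compact (weak_space V) A -> (forall n, A (u n)) ->
  exists a, forall (g : V -> R) (c : R), 0 <= c ->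
    (forall x y, g (x + y) = g x + g y) ->
    (forall t x, g (of_real k t *: x) = t * g x) ->
    (forall x, g x <= c * rnorm x) ->
    forall (e : R) (N : nat), 0 < e -> exists2 n, (N <= n)%N & `|g (u n) - g a| < e.
Proof.
move=> cA Au.
have [|a [Aa ua]] := cA (u @ \oo) _; first by exists 0%N => // n _; exact: Au.
exists a => g c c0 gD gZ gc e N e0.
have [F [Fcont FE]] := scalar_functional c0 gD gZ gc.
pose i : {f : {linear V -> K^o} | continuous f} := exist _ F Fcont.
pose B := [set y : V | rnorm (F a - F y) < e].
have aB : @nbhs V (weak_space V) a B.
  have /cvg_sup/(_ i) : nbhs (a : weak_space V) --> (a : weak_space V) by [].
  apply; apply: (@initial_continuous V K^o F a [set z : K^o | rnorm (F a - z) < e]).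
  have e0' : 0 < of_real k e by rewrite of_real_gt0.
  apply: filterS (nbhsx_ballx (F a) _ e0') => z.
  by move/ball_rnorm.
have uN : (u @ \oo) [set u n | n in [set n | (N <= n)%N]].
  by exists N => // n /= Nn; exists n.
have [_ [[n Nn <-] un]] := ua _ _ uN aB.
exists n => //; apply: le_lt_trans un; rewrite -!FE distrC.
exact: scalar_re_lipschitz.
Qed.

End WeakCluster.

Lemma wo_leq : wochoice.well_order leq.
Proof.
move=> A exA; have [m Am mmin] := ex_minnP exA.
exists m; split=> [|m' [Am' m'min]]; first by split=> // n; exact: mmin.
by apply/eqP; rewrite eqn_leq mmin//= m'min.
Qed.

(** * The gliding hump *)

Section GlidingHump.
Variables (R : realType) (k : scalar_kind).
Local Notation K := (scalar_field R k).
Variables (V : normedModType K) (Y : completeNormedModType K) (L : choiceType).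
Local Notation E := (@lp_family R k 1 (lexx 1) Y).
Variable T : {linear V -> E L}.

Lemma l1_sum_le (z : L -> Y) (t : R) (m : nat -> L) M N : 0 <= t -> injective m ->
  fle E t z -> \sum_(M <= j < N) rnorm (z (m j)) <= t.
Proof.
move=> t0 mI zt; pose s := [seq m j | j <- index_iota M N].
have us : uniq s by rewrite map_inj_uniq ?iota_uniq.
have := zt [fset x in s]%fset; rewrite powRr1//; apply: le_trans.
rewrite -(big_map m xpredT (fun l => rnorm (z l))) -/s.
rewrite le_eqVlt; apply/orP; left; apply/eqP.
under [RHS]eq_bigr => l _ do rewrite powRr1 ?rnorm_ge0//.
apply: perm_big; apply: uniq_perm => // l; by rewrite inE.
Qed.

Section Hump.
Variables (e : R) (m : nat -> L) (a : nat -> V).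
Hypotheses (mI : injective m)
  (ma : forall n, e < rnorm (fval (T (a n)) (m n)))
  (tail : forall n M, \sum_(n.+1 <= j < M) rnorm (fval (T (a n)) (m j)) <= e / 4).

(* A functional supported on the coordinates m j with j >= N that is large on all
   later a n: since the tail bound controls the coordinates after n, it suffices to
   choose the coefficients recursively in {0, 1}, the n-th one in view of a n. *)
Lemma hump_functional N : exists g : V -> R, [/\
  forall x y, g (x + y) = g x + g y, forall t x, g (of_real k t *: x) = t * g x,
  forall x t, (forall M, \sum_(N <= j < M) rnorm (fval (T x) (m j)) <= t) -> `|g x| <= t &
  forall n, (N <= n)%N -> e / 4 <= `|g (a n)|].
Proof.
(* [phi n] factors through coordinate [m n], in the sense of being dominated by its norm, and is
   norming there for [a n]. *)
have /choice[phi phiP] : forall n, exists g : V -> R,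
    [/\ forall x y, g (x + y) = g x + g y, forall t x, g (of_real k t *: x) = t * g x,
      forall x, g x <= rnorm (fval (T x) (m n)) & g (a n) = rnorm (fval (T (a n)) (m n))].
  move=> n; apply: hahn_banach => [x y|t x t0].
    by rewrite linearD fvalD rnormD.
  by rewrite linearZ fvalZ rnormZ rabs_of_real.
have phi_abs n x : `|phi n x| <= rnorm (fval (T x) (m n)).
  have [_ phiZ phi_le _] := phiP n; rewrite ler_norml phi_le andbT lerNl.
  have := phi_le (of_real k (-1) *: x); rewrite phiZ mulN1r => /le_trans; apply.
  by rewrite linearZ fvalZ rnormZ rabs_real normrN1 mul1r.
(* If the earlier terms already reach [e / 2] on [a n], take 0. Otherwise take 1: the new term
   exceeds [e] and the earlier ones cancel less than half of it. The later terms change the value by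
   at most [e / 4], which leaves [e / 4]. *)
pose Q n (s : nat -> R) u := `|u| <= 1 /\
  e / 2 <= `|\sum_(N <= j < n) s j * phi j (a n) + u * phi n (a n)|.
have Qloc n s s' u : (forall j, ~~ (n <= j)%N -> s j = s' j) -> Q n s u -> Q n s' u.
  move=> ss' [u1 h]; split => //; rewrite (eq_big_nat _ _ (F2 := fun j => s j * phi j (a n)))//.
  by move=> j /andP[_ jn]; rewrite ss' -?ltnNge.
have Qex n s : exists u, Q n s u.
  set r := \sum_(N <= j < n) s j * phi j (a n).
  have [er|re] := leP (e / 2) `|r|.
    by exists 0; split; rewrite ?normr0 ?mul0r ?addr0.
  exists 1; split; first by rewrite normr1.
  have [_ _ _ phia] := phiP n; have := ma n; rewrite -phia mul1r -/r => ephi.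
  by move: re; rewrite ltr_norml => /andP[r1 r2]; rewrite ler_normr; apply/orP; left; lra.
have [s sP] := wo_choice wo_leq 0 Qloc Qex.
pose S x M := \sum_(N <= j < M) s j * phi j x.
have term_le j x : `|s j * phi j x| <= rnorm (fval (T x) (m j)).
  by rewrite normrM -[leRHS]mul1r ler_pM//; have [] := sP j.
have S_le x t M : (forall M, \sum_(N <= j < M) rnorm (fval (T x) (m j)) <= t) -> `|S x M| <= t.
  move=> xt; apply: le_trans (xt M); rewrite (le_trans (ler_norm_sum _ _ _))//.
  by apply: ler_sum => j _.
have Scvg x : cvgn (S x).
  pose u j := if (N <= j)%N then s j * phi j x else 0.
  have SE : S x = series u.
    apply/funext => M; rewrite /S seriesEnat /=.
    have [NM|MN] := leqP N M; last first.
      rewrite big_geq ?(ltnW MN)// big_nat_cond big1// => j /andP[jM _].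
      by rewrite /u leqNgt (ltn_trans jM MN).
    have uN : \sum_(0 <= j < N) u j = 0.
      by rewrite big_nat_cond; apply: big1 => j /andP[/andP[_ jN] _]; rewrite /u leqNgt jN.
    rewrite (@big_cat_nat _ _ _ N 0 M)//= uN add0r.
    by apply: eq_big_nat => j /andP[Nj _]; rewrite /u Nj.
  rewrite SE; apply: normed_cvg; apply: nondecreasing_is_cvgn.
    by apply: nondecreasing_series => j _ _ /=.
  exists (rnorm (T x)) => _ [M _ <-]; rewrite /= seriesEnat /=.
  have := @l1_sum_le (fval (T x)) (rnorm (T x)) m 0 M (rnorm_ge0 _) mI (fle_rnorm (T x)).
  apply: le_trans; apply: ler_sum => j _; rewrite /u; case: ifP => // _.
  by rewrite normr0 rnorm_ge0.
pose g x := limn (S x).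
have gcvg x : S x @ \oo --> g x by exact: Scvg.
have uniq_lim x l : S x @ \oo --> l -> g x = l by move=> h; exact: cvg_lim h.
exists g; split.
- move=> x y; apply: uniq_lim; rewrite (_ : S (x + y) = S x \+ S y).
    exact: cvgD.
  apply/funext => M; rewrite /S /= -big_split/=; apply: eq_bigr => j _.
  by have [-> _ _ _] := phiP j; rewrite mulrDr.
- move=> t x; apply: uniq_lim; rewrite (_ : S _ = fun M => t * S x M).
    exact: cvgMr.
  apply/funext => M; rewrite /S mulr_sumr; apply: eq_bigr => j _.
  by have [_ -> _ _] := phiP j; rewrite mulrCA.
- move=> x t xt; have h : `|S x M| @[M --> \oo] --> `|g x| by apply: cvg_norm.
  rewrite -(cvg_lim _ h)//; apply: limr_le; first by apply/cvg_ex; exists `|g x|.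
  by apply: nearW => M; exact: S_le.
- move=> n Nn; have h : `|S (a n) M| @[M --> \oo] --> `|g (a n)| by apply: cvg_norm.
  rewrite -(cvg_lim _ h)//; apply: limr_ge; first by apply/cvg_ex; exists `|g (a n)|.
  exists n.+1 => // M /= nM.
  have SnM : S (a n) M = S (a n) n.+1 + \sum_(n.+1 <= j < M) s j * phi j (a n).
    by rewrite /S (@big_cat_nat _ _ _ n.+1)//= (leq_trans Nn).
  have big : e / 2 <= `|S (a n) n.+1| by rewrite /S big_nat_recr//=; have [] := sP n.
  have small : `|\sum_(n.+1 <= j < M) s j * phi j (a n)| <= e / 4.
    apply: le_trans (tail n M); rewrite (le_trans (ler_norm_sum _ _ _))//.
    by apply: ler_sum => j _.
  rewrite SnM; have := lerB_normD (S (a n) n.+1) (\sum_(n.+1 <= j < M) s j * phi j (a n)).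
  by move: big small; lra.
Qed.

End Hump.
End GlidingHump.

Section WCGColumns.
Variables (R : realType) (k : scalar_kind).
Local Notation K := (scalar_field R k).
Variables (V : normedModType K) (Y : completeNormedModType K) (L : choiceType).
Local Notation E := (@lp_family R k 1 (lexx 1) Y).
Variables (T : {linear V -> E L}) (c : R).
Hypotheses (c0 : 0 <= c) (Tc : op_le c T).

Lemma eventually_notin (m : nat -> L) (s : seq L) : injective m ->
  exists N, forall j, (N <= j)%N -> m j \notin s.
Proof.
move=> mI; elim: s => [|x s [N Ns]]; first by exists 0%N.
have [[i mi]|nm] := pselect (exists i, m i = x).
  exists (maxn N i.+1) => j; rewrite geq_max => /andP[Nj ij].
  rewrite inE negb_or Ns// andbT -mi; apply/eqP => /mI ji.
  by move: ij; rewrite ji ltnn.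
exists N => j Nj; rewrite inE negb_or Ns// andbT.
by apply/eqP => mj; apply: nm; exists j.
Qed.

Lemma l1_tail (x : E L) (e : R) (A : {fset L}) (m : nat -> L) N M : 0 <= e ->
  injective m -> rnorm (x - cutoff (fun l => l \in A) x) <= e ->
  (forall j, (N <= j)%N -> m j \notin A) ->
  \sum_(N <= j < M) rnorm (fval x (m j)) <= e.
Proof.
move=> e0 mI xA mA; have := fle_rnorm (x - cutoff (fun l => l \in A) x).
move=> /(fle_mono (rnorm_ge0 _) xA) /(l1_sum_le N M e0 mI); apply: le_trans.
rewrite le_eqVlt; apply/orP; left; apply/eqP; apply: eq_big_nat => j /andP[Nj _].
by rewrite fvalB cutoffE (negbTE (mA j Nj)) subr0.
Qed.

(** Infinitely many large coordinates would give a sequence in [A] with essentially disjoint humps,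
    and the functional built on the humps would separate this sequence from its weak cluster
    point. *)
Lemma weakly_compact_coords (A : set V) (e : R) : 0 < e ->
  @compact (weak_space V) A ->
  finite_set [set l | exists2 a, A a & e < rnorm (fval (T a) l)].
Proof.
move=> e0 cA; apply: contrapT => infG; set G := [set l | _] in infG.
have e4 : 0 < e / 4 by rewrite divr_gt0.
have /choice[F FP] : forall a : V, exists B : {fset L},
    rnorm (T a - cutoff (fun l => l \in B) (T a)) <= e / 4.
  by move=> a; exact: cutoff_approx.
have /choice[h hP] : forall B : {fset L}, exists p : L * V,
    [/\ p.1 \notin B, A p.2 & e < rnorm (fval (T p.2) p.1)].
  move=> B; have [l [[a Aa al] lB]] := infinite_setN0 (infinite_setD infG (finite_fset B)).
  by exists (l, a); split => //; apply/negP.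
(* [B n] contains the earlier [m i] and finite sets carrying the earlier [T (a i)] up to [e / 4].
   Choosing [m n] outside [B n] gives both injectivity and the tail bound. *)
pose next B := (B `|` ((h B).1 |` F (h B).2))%fset.
pose B n := iter n next fset0.
pose m n := (h (B n)).1; pose a n := (h (B n)).2.
have Bmono i j : (i <= j)%N -> (B i `<=` B j)%fset.
  move=> /subnK <-; elim: (j - i)%N => // d IH.
  exact: fsubset_trans IH (fsubsetUl _ _).
have mB i j : (i < j)%N -> m i \in B j.
  move=> ij; apply: (fsubsetP (Bmono _ _ ij)).
  by rewrite /B iterS -/(B i) /next !inE eqxx orbT.
have mnB j : m j \notin B j by have [] := hP (B j).
have mI : injective m.
  have lt_neq i j : (i < j)%N -> m i <> m j.
    by move=> ij mij; have := mB _ _ ij; rewrite mij (negbTE (mnB j)).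
  by move=> i j mij; have [/lt_neq//|/lt_neq/(_ (esym mij))//|//] := ltngtP i j.
have mF i j : (i < j)%N -> m j \notin F (a i).
  move=> ij; apply: contra (mnB j) => mF; apply: (fsubsetP (Bmono _ _ ij)).
  by rewrite /B iterS -/(B i) /next !inE -/(a i) mF !orbT.
have ma n : e < rnorm (fval (T (a n)) (m n)) by have [] := hP (B n).
have Aa n : A (a n) by have [] := hP (B n).
have tail n M : \sum_(n.+1 <= j < M) rnorm (fval (T (a n)) (m j)) <= e / 4.
  exact: l1_tail (ltW e4) mI (FP (a n)) (mF n).
have [b bP] := weakly_compact_cluster cA Aa.
have e16 : 0 < e / 16 by rewrite divr_gt0.
have [Fb Fbe] := cutoff_approx (T b) e16.
have [N Nm] := eventually_notin (enum_fset Fb) mI.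
(* The functional starts beyond the finite set carrying [T b] up to [e / 16], so [g b] is at most
   [e / 16] in absolute value. Some later [g (a n)] would be within [e / 16] of it, against the
   lower bound [e / 4]. *)
have [g [gD gZ gle ge]] := hump_functional mI ma tail N.
have gc x : g x <= c * rnorm x.
  apply: le_trans (ler_norm _) _; apply: gle => M; apply: le_trans (Tc x).
  exact: l1_sum_le (rnorm_ge0 _) mI (fle_rnorm (T x)).
have [n Nn gn] := bP g c c0 gD gZ gc (e / 16) N e16.
have gb : `|g b| <= e / 16 by apply: gle => M; exact: l1_tail (ltW e16) mI Fbe Nm.
have := ge n Nn; have := ler_normB (g (a n) - g b) (- g b).
rewrite opprK subrK normrN; move: gn gb; lra.
Qed.

(** Off the countably many coordinates that are large somewhere on the compact set, [T] vanishes on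
    that set, hence on its span and, by continuity, everywhere. *)
Lemma wcg_coords_countable : WCG V ->
  countable [set l | exists v, fval (T v) l != 0].
Proof.
move=> [A [cA spanA]].
pose G (n : nat) := [set l | exists2 a, A a & n.+1%:R^-1 < rnorm (fval (T a) l)].
apply: (@card_le_trans _ _ _ (\bigcup_n G n)); last first.
  apply: bigcup_countable => // n _; apply: finite_set_countable.
  by apply: weakly_compact_coords cA; rewrite invr_gt0.
apply: subset_card_le => l [v vl]; apply: contrapT => nG.
have Al x : A x -> fval (T x) l = 0.
  move=> Ax; apply/eqP; apply: contrapT => /negP xl; apply: nG.
  by have [n nx] := inv_nat_lt (rnorm_gt0 xl); exists n => //; exists x.
have spanl x : linear_span A x -> fval (T x) l = 0.
  move=> [n [a [y [Ay ->]]]]; rewrite linear_sum.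
  elim/big_ind : _ => [|u w ul wl|i _]; first exact: fval0.
    by rewrite fvalD ul wl addr0.
  by rewrite linearZ fvalZ Al// scaler0.
move/eqP: vl; apply; apply: (rnorm_small c0) => e e0.
have : closure (linear_span A) v by rewrite spanA.
have e0' : 0 < of_real k e by rewrite of_real_gt0.
move=> /(_ _ (nbhsx_ballx v _ e0')) [x [/spanl xl /ball_rnorm /ltW vx]].
rewrite (_ : fval _ l = fval (T (v - x)) l); last by rewrite linearB fvalB xl subr0.
by rewrite (le_trans (fval_coord _ _))// (le_trans (Tc _))// ler_wpM2l.
Qed.

End WCGColumns.

Lemma wcg_blocks (R : realType) (k : scalar_kind)
    (Y : completeNormedModType (scalar_field R k)) (L : choiceType)
    (P : {linear lp_family (lexx 1) Y L -> lp_family (lexx 1) Y L}) (c : R) :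
  WCG Y -> card_gt_omega1 L -> 0 <= c -> op_le c P ->
  exists e, block_system (entry P) e.
Proof.
move=> wcgY cardL c0 Pc; apply: block_system_omega1 => // l.
have Pl : op_le c (P \o single (lp_family (lexx 1) Y) l).
  by have := op_le_comp c0 Pc (single_le (lp_family (lexx 1) Y) l); rewrite mulr1.
exact: (wcg_coords_countable c0 Pl wcgY).
Qed.

Lemma uniformly_primary_primary (R : realType) (k : scalar_kind)
    (E : normedModType (scalar_field R k)) : uniformly_primary E -> primary E.
Proof.
move=> [C [_ _ CE]] P bP; have [Pnz|P0] := pselect (exists x, P x != 0).
  have [|] := CE P bP Pnz.
    by move=> [T [S [? ? ? ? _]]]; left; exists T, S.
  by move=> [T [S [? ? ? ? _]]]; right; exists T, S.
right; have PE x : (idfun \- P) x = x.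
  rewrite [LHS](_ : _ = x - P x)//.
  have [->|Px] := eqVneq (P x) 0; first by rewrite subr0.
  by case: P0; exists x.
have [|T [S [? ? ? ? _]]] := mvn_isomorphic ler01 _ (mvn_id (lexx 1) PE).
  by move=> x; exact: PE.
by exists T, S.
Qed.

Theorem theorem4p1 (R : realType) (k : scalar_kind) (Gamma : choiceType)
    (Gamma_uncountable : ~ countable [set: Gamma]) :
  (forall Y : completeNormedModType (scalar_field R k),
     WCG Y -> card_gt_omega1 Gamma ->
     let X1 := lp (lexx (1 : R)) nat Y in
     let U := uniformly_primary X1 in
     let CF := primary X1 /\ cof_gt_omega Gamma in
     (U \/ CF -> primary (lp (lexx (1 : R)) Gamma Y)) /\
     (U -> uniformly_primary (lp (lexx (1 : R)) Gamma Y)))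
  /\
  (forall Y : completeNormedModType (scalar_field R k), separable_space Y ->
     (forall (p : R) (p_gt1 : 1 < p),
        (uniformly_primary (lp (ltW p_gt1) nat Y) ->
           uniformly_primary (lp (ltW p_gt1) Gamma Y)) /\
        (primary (lp (ltW p_gt1) nat Y) -> cof_gt_omega Gamma ->
           primary (lp (ltW p_gt1) Gamma Y))) /\
     (uniformly_primary (c0 nat Y) -> uniformly_primary (c0 Gamma Y)) /\
     (primary (c0 nat Y) -> cof_gt_omega Gamma -> primary (c0 Gamma Y))).
Proof.
split=> [Y wcgY cardGamma X1 U CF|Y sepY].
  have blocks (P : {linear lp_family (lexx 1) Y Gamma -> lp_family (lexx 1) Y Gamma}) t :
      0 <= t -> op_le t P -> (forall x, P (P x) = P x) -> exists e, block_system (entry P) e.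
    by move=> t0 Pt _; exact: wcg_blocks wcgY cardGamma t0 Pt.
  have UU : U -> uniformly_primary (lp (lexx (1 : R)) Gamma Y).
    exact: (transfer_uniformly_primary Gamma_uncountable blocks).
  split=> // -[/UU/uniformly_primary_primary//|[prX cofG]].
  exact: (transfer_primary Gamma_uncountable blocks).
have blocks (E : family_space Y) (growth : sublinear_growth E)
    (P : {linear E Gamma -> E Gamma}) t :
    0 <= t -> op_le t P -> (forall x, P (P x) = P x) -> exists e, block_system (entry P) e.
  by move=> t0 Pt _; exact: separable_blocks growth sepY t0 Pt.
split=> [p p_gt1|].
  have lp_blocks := blocks _ (lp_sublinear_growth (ltW p_gt1) Y p_gt1).
  split; first exact: (transfer_uniformly_primary Gamma_uncountable lp_blocks).
  exact: (transfer_primary Gamma_uncountable lp_blocks).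
have c0_blocks := blocks _ (@c0_sublinear_growth R k Y).
split; first exact: (transfer_uniformly_primary Gamma_uncountable c0_blocks).
exact: (transfer_primary Gamma_uncountable c0_blocks).
Qed.
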